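(* Let $u\in H^2(\Omega)\cap H^1_0(\Omega)$ be a strong extremum of the variational problem $\mathcal J[u]=\inf_{v\in H^1_0(\Omega)}\mathcal J[v]$, $\mathcal J[v]=\int_\Omega L(x,v,\nabla v)\,dx$. Suppose that the problem is invariant under a variational symmetry group with infinitesimals $\xi$ and $\phi$, so that Noether's first theorem holds with conservation law $$\mathcal C[w]=-\bigl(L\,\xi+\partial_3L\,(\phi-\xi^T\nabla w)\bigr),$$ and let $U$ be the finite element approximation to $u$. Then there exists a constant $C$, dependent on the shape regularity of $\mathcal T$, such that $$\|\mathrm{Div}\,\mathcal C[U]\|_{H^{-1}(\Omega)}\le C\Bigl(\sum_{K\in\mathcal T}\|\mathrm{Div}\,\mathcal C[U]\|_{L^2(K)}+\sum_{e\in\mathcal E}\|[\![\mathcal C[U]]\!]\|_{L^2(e)}\Bigr).$$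
   Context: $\Omega\subset\mathbb R^d$ is a bounded domain. $L=L(x,u,p)$, with $p=\nabla u$, is the (smooth) Lagrangian; $\partial_3L=(\partial L/\partial p_1,\dots,\partial L/\partial p_d)^T$. In $\mathcal C[w]$, $L$ and $\partial_3L$ are evaluated at $(x,w,\nabla w)$ and $\xi,\phi$ at $(x,w)$. $\mathrm{Div}$ is the total divergence, i.e. the divergence in $x$ of the composed field $x\mapsto q(x,w(x),\nabla w(x))$. On the left-hand side it is a distribution: $\langle\mathrm{Div}\,\mathcal C[U],\varphi\rangle=-\int_\Omega\mathcal C[U]^T\nabla\varphi\,dx$ for $\varphi\in H^1_0(\Omega)$, and $\|F\|_{H^{-1}(\Omega)}=\sup_{0\ne\varphi\in H^1_0(\Omega)}\langle F,\varphi\rangle/\|\nabla\varphi\|_{L^2(\Omega)}$. On the right-hand side $\mathrm{Div}\,\mathcal C[U]$ is computed inside each element $K$. One-parameter group: a smooth transformation $(x,u)\mapsto(\widetilde x,\widetilde u)=(\Xi(x,u;\epsilon),\Phi(x,u;\epsilon))$ which is the identity for $\epsilon=0$, whose inverse is given by the parameter $-\epsilon$, and such that composing the transformations with parameters $\epsilon$ and $\delta$ gives that with parameter $\epsilon+\delta$. Its infinitesimals are $\xi(x,u)=\lim_{\epsilon\to0}\frac{d\Xi(x,u;\epsilon)}{d\epsilon}$ (vector valued) and $\phi(x,u)=\lim_{\epsilon\to0}\frac{d\Phi(x,u;\epsilon)}{d\epsilon}$ (scalar valued). It is a variational symmetry if $\int_\Upsilon L(x,u,\nabla u)\,dx=\int_{\Upsilon_\Xi}L(\widetilde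 x,\widetilde u,\widetilde{\nabla u})\,d\widetilde x$ for every smooth subdomain $\Upsilon$ with $\overline\Upsilon\subset\Omega$, where $\Upsilon_\Xi$ is the image of the graph $\{(x,u(x)):x\in\Upsilon\}$ under $\Xi(\cdot;\epsilon)$ and $\widetilde{\nabla u}$ is the gradient with respect to $\widetilde x$ of the transformed function $\widetilde u$. Noether's first theorem then gives $\mathrm{Div}(\mathcal C[u])=0$ for solutions $u$ of the Euler--Lagrange equation. Finite elements. $\mathcal T$ is a conforming triangulation of $\Omega$ into finitely many open simplices (closures of two elements meet in the empty set or a full common subsimplex; the closures cover $\overline\Omega$); $\mathcal E$ is the set of internal common interfaces $e$. The shape regularity of $\mathcal T$ is $\mu(\mathcal T)=\inf_{K\in\mathcal T}\rho_K/h_K$, with $\rho_K$ the radius of the largest ball contained in $K$ and $h_K$ the diameter of $K$. For fixed $k\ge1$, $\mathbb V=\{\Phi\in C^0(\Omega):\Phi|_K\in\mathbb P^k\ \forall K\in\mathcal T\}$ with $\mathbb P^k$ the polynomials of degree at most $k$, and $\mathbb V_0=\mathbb V\cap H^1_0(\Omega)$. The finite element approximation is the minimiser $U\in\mathbb V_0$ with $\mathcal J[U]=\inf_{V\in\mathbb V_0}\mathcal J[V]$. The continuous minimisation problem is assumed to have a unique solution. For a vector field $v$, across the interface between elements $K_1,K_2$ with outward unit normals $n_1,n_2$, $[\![v]\!]=(v|_{K_1})^Tn_1+(v|_{K_2})^Tn_2$. *)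

(* Defs.v *)
From HB Require Import structures.
From mathcomp Require Import all_boot all_order all_algebra.
From mathcomp Require Import all_classical all_reals all_analysis.
Set Implicit Arguments.
Unset Strict Implicit.
Unset Printing Implicit Defensive.
Import Order.TTheory GRing.Theory Num.Theory.
Import numFieldNormedType.Exports.
Local Open Scope classical_set_scope.
Local Open Scope ring_scope.

(* R^n is 'rV[R]_n with the product (Borel) sigma-algebra, generated by the
   coordinates exactly as the library does for n.-tuple T. *)
Section rV_measurable.
Context {d} {T : measurableType d}.
Variable n : nat.
Let coord (i : 'I_n) (x : 'rV[T]_n) : T := x ord0 i.
Let rV0 : g_sigma_preimage coord set0.
Proof. exact: sigma_algebra0. Qed.
Let rVC A : g_sigma_preimage coord A -> g_sigma_preimage coord (~` A).
Proof. exact: sigma_algebraC. Qed.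
Let rV_bigcup (F : (set 'rV[T]_n)^nat) :
  (forall i, g_sigma_preimage coord (F i)) ->
  g_sigma_preimage coord (\bigcup_i F i).
Proof. exact: sigma_algebra_bigcup. Qed.
HB.instance Definition _ := @isMeasurable.Build (measure_tuple_display d)
  'rV[T]_n (g_sigma_preimage coord) rV0 rVC rV_bigcup.
End rV_measurable.

Section lebesgue.
Context {R : realType}.

Definition rV_cons n (p : measurableTypeR R * 'rV[R]_n) : 'rV[R]_n.+1 :=
  \row_i (if unlift ord0 i is Some j then p.2 ord0 j else p.1).

Lemma measurable_coord n (i : 'I_n) :
  measurable_fun [set: 'rV[R]_n] (fun x : 'rV[R]_n => x ord0 i : R).
Proof.
move=> _ Y mY; rewrite setTI; apply: sub_sigma_algebra => /=.
rewrite -bigcup_seq/=; exists i => /=; first by rewrite mem_index_enum.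
by exists Y => //; rewrite setTI.
Qed.

Lemma measurable_rV d (T : measurableType d) n (f : T -> 'rV[R]_n) :
  (forall i, measurable_fun setT (fun x => f x ord0 i)) -> measurable_fun setT f.
Proof.
move=> mf _ A mA; rewrite setTI.
suff : preimage_set_system setT f (g_sigma_preimage
   (fun (i : 'I_n) (x : 'rV[R]_n) => x ord0 i)) `<=` measurable.
  by apply; exists A => //; rewrite setTI.
rewrite -g_sigma_preimage_comp; apply: smallest_sub.
  exact: sigma_algebra_measurable.
case: n => [|n] in f mf A mA *; first by rewrite big_ord0.
rewrite -bigcup_mkord_ord; apply: bigcup_sub => i Ii.
by move=> B [C mC <-]; exact: mf.
Qed.

Lemma measurable_rV_cons n : measurable_fun setT (@rV_cons n).
Proof.
apply: measurable_rV => i; under eq_fun do rewrite mxE.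
case: unliftP => [j _|_]; last exact: measurable_fst.
exact: (measurableT_comp (measurable_coord j) (@measurable_snd _ _ _ _)).
Qed.


Definition rV_uncons n (x : 'rV[R]_n.+1) : measurableTypeR R * 'rV[R]_n :=
  (x ord0 ord0, \row_j x ord0 (lift ord0 j)).

Lemma rV_consK n : cancel (@rV_cons n) (@rV_uncons n).
Proof.
case=> a x; rewrite /rV_uncons /rV_cons !mxE unlift_none /=; congr pair.
by apply/rowP => j; rewrite !mxE liftK.
Qed.

Lemma measurable_rV_uncons n : measurable_fun setT (@rV_uncons n).
Proof.
apply/measurable_fun_pairP; split => /=; first exact: measurable_coord.
apply: measurable_rV => j /=; under eq_fun do rewrite mxE.
exact: measurable_coord.
Qed.

Section step.
Variables (n : nat) (mu : {sigma_finite_measure set 'rV[R]_n -> \bar R}).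

Definition rV_lebesgue_step : set 'rV[R]_n.+1 -> \bar R :=
  pushforward (@lebesgue_measure R \x mu)%E (@rV_cons n).

Let step0 : rV_lebesgue_step set0 = 0%E.
Proof. by rewrite /rV_lebesgue_step /pushforward preimage_set0 measure0. Qed.

Let step_ge0 A : (0 <= rV_lebesgue_step A)%E.
Proof. exact: (measure_ge0 (@lebesgue_measure R \x mu)%E). Qed.

Let step_additive : semi_sigma_additive rV_lebesgue_step.
Proof.
move=> F mF tF mUF; rewrite /rV_lebesgue_step /pushforward preimage_bigcup.
apply: measure_semi_sigma_additive.
- by move=> i; rewrite -[X in measurable X]setTI; exact: measurable_rV_cons.
- apply/trivIsetP => /= i j _ _ ij; rewrite -preimage_setI.
  by move/trivIsetP : tF => /(_ _ _ _ _ ij) ->//; rewrite preimage_set0.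
- rewrite -preimage_bigcup -[X in measurable X]setTI.
  exact: measurable_rV_cons.
Qed.

HB.instance Definition _ := isMeasure.Build _ _ _
  rV_lebesgue_step step0 step_ge0 step_additive.

Let step_sigma_finite : sigma_finite setT rV_lebesgue_step.
Proof.
have /sigma_finiteP[F [FT ndF Foo]] := sigma_finiteT (@lebesgue_measure R).
have /sigma_finiteP[G [GT ndG Goo]] := sigma_finiteT mu.
exists (fun i => @rV_uncons n @^-1` (F i `*` G i)).
  rewrite -preimage_bigcup -[LHS](preimage_setT (@rV_uncons n)); congr preimage.
  rewrite -setXTT FT GT predeqE => -[x y]; split.
    move=> [/= [i _ Fix] [k _ Gky]]; exists (maxn i k) => //; split.
    - by move: x Fix; exact/subsetPset/ndF/leq_maxl.
    - by move: y Gky; exact/subsetPset/ndG/leq_maxr.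
  by move=> [i _ []/= ? ?]; split; exists i.
move=> i; have [mFi Fi] := Foo i; have [mGi Gi] := Goo i; split.
  rewrite -[X in measurable X]setTI; apply: measurable_rV_uncons => //.
  exact: measurableX.
rewrite /rV_lebesgue_step /pushforward -comp_preimage.
rewrite (_ : _ \o _ = id) ?preimage_id; last exact/funext/rV_consK.
by rewrite product_measure1E// lte_mul_pinfty// ge0_fin_numE.
Qed.

HB.instance Definition _ := Measure_isSigmaFinite.Build _ _ _
  rV_lebesgue_step step_sigma_finite.
End step.

(* n-dimensional Lebesgue measure; on the one-point space R^0 it is the unit
   mass, so that in dimension one the surface measure of a vertex is 1. *)
Fixpoint rV_lebesgue (n : nat) : {sigma_finite_measure set 'rV[R]_n -> \bar R} :=
  if n is m.+1 then rV_lebesgue_step (rV_lebesgue m) else dirac (0 : 'rV[R]_0).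
End lebesgue.

Section calculus.
Context {R : realType}.

(* The norm of 'rV[R]_n in the library is the sup norm; lengths, balls and
   diameters below are Euclidean. *)
Definition dot n (x y : 'rV[R]_n) : R := \sum_i x ord0 i * y ord0 i.
Definition enorm n (x : 'rV[R]_n) : R := Num.sqrt (dot x x).

Fixpoint iter_derive (V W : normedModType R) (vs : seq V) (f : V -> W) : V -> W :=
  if vs is v :: vs' then 'D_v (iter_derive vs' f) else f.

(* C^oo on an open set A *)
Definition smooth_on (V W : normedModType R) (A : set V) (f : V -> W) : Prop :=
  forall (vs : seq V) (x : V), A x ->
    {for x, continuous (iter_derive vs f)} /\
    (forall v, derivable (iter_derive vs f) x v).

Definition grad n (f : 'rV[R]_n -> R) (x : 'rV[R]_n) : 'rV[R]_n :=
  \row_i 'D_(delta_mx ord0 i) f x.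

Definition div n (q : 'rV[R]_n -> 'rV[R]_n) (x : 'rV[R]_n) : R :=
  \sum_i 'D_(delta_mx ord0 i) (fun y => q y ord0 i) x.

Definition domain n (A : set 'rV[R]_n) : Prop :=
  [/\ open A, connected A & A !=set0].

(* For an open set Y, closure Y `\` Y is the boundary. *)
Definition smooth_domain n (Y : set 'rV[R]_n) : Prop :=
  domain Y /\
  forall x, (closure Y `\` Y) x -> exists rho : 'rV[R]_n -> R,
    [/\ smooth_on setT rho, grad rho x != 0 &
        \forall y \near x, Y y <-> rho y < 0].

End calculus.

Section sobolev.
Context {R : realType} {n : nat}.
Implicit Types (Omega : set 'rV[R]_n) (v f : 'rV[R]_n -> R).

Definition L2norm Omega f : \bar R :=
  Lnorm (rV_lebesgue n) 2%:E ((fun x => (f x)%:E) \_ Omega).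

Definition L2 Omega f : Prop :=
  measurable_fun Omega f /\ (L2norm Omega f < +oo)%E.

(* C_c^oo(Omega) *)
Definition test_function Omega (psi : 'rV[R]_n -> R) : Prop :=
  smooth_on setT psi /\
  exists2 A, compact A & A `<=` Omega /\ (forall x, ~ A x -> psi x = 0).

Definition is_weak_grad Omega v (g : 'rV[R]_n -> 'rV[R]_n) : Prop :=
  forall i, L2 Omega (fun x => g x ord0 i) /\
  forall psi, test_function Omega psi ->
    \int[rV_lebesgue n]_(x in Omega) (v x * 'D_(delta_mx ord0 i) psi x) =
    - \int[rV_lebesgue n]_(x in Omega) (g x ord0 i * psi x).

Definition H1 Omega v : Prop := L2 Omega v /\ exists g, is_weak_grad Omega v g.

(* a representative of the weak gradient, which is unique almost everywhere *)
Definition weak_grad Omega v : 'rV[R]_n -> 'rV[R]_n :=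
  xget (fun=> 0) [set g | is_weak_grad Omega v g].

Definition H2 Omega v : Prop :=
  H1 Omega v /\ forall i, H1 Omega (fun x => weak_grad Omega v x ord0 i).

(* the closure of C_c^oo(Omega) in H^1(Omega) *)
Definition H10 Omega v : Prop :=
  H1 Omega v /\
  forall eps : R, 0 < eps -> exists2 psi, test_function Omega psi &
    (L2norm Omega (fun x => (v x - psi x)%R) +
     L2norm Omega (fun x => enorm (weak_grad Omega v x - grad psi x)%R)
       < eps%:E)%E.

(* the distributional divergence of a vector field *)
Definition distr_div Omega (q : 'rV[R]_n -> 'rV[R]_n) (v : 'rV[R]_n -> R) : R :=
  - \int[rV_lebesgue n]_(x in Omega) dot (q x) (weak_grad Omega v x).

Definition Hm1norm Omega (F : ('rV[R]_n -> R) -> R) : \bar R :=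
  ereal_sup [set (F v / fine (L2norm Omega (fun x => enorm (weak_grad Omega v x))))%:E
    | v in [set v | H10 Omega v /\
              ~ {ae rV_lebesgue n, forall x, Omega x -> v x = 0}]].

End sobolev.

Section variational.
Context {R : realType} {n : nat}.
Implicit Types (Omega : set 'rV[R]_n) (L : 'rV[R]_n -> R -> 'rV[R]_n -> R).
Implicit Types (Xi : 'rV[R]_n -> R -> R -> 'rV[R]_n) (Phi : 'rV[R]_n -> R -> R -> R).
Implicit Types (xi : 'rV[R]_n -> R -> 'rV[R]_n) (phi : 'rV[R]_n -> R -> R).

Definition smooth_lagrangian L : Prop :=
  smooth_on setT (fun z : 'rV[R]_n * R * 'rV[R]_n => L z.1.1 z.1.2 z.2).

Definition action Omega L (v : 'rV[R]_n -> R) : \bar R :=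
  (\int[rV_lebesgue n]_(x in Omega) (L x (v x) (weak_grad Omega v x))%:E)%E.

Definition minimiser (J : ('rV[R]_n -> R) -> \bar R)
    (X : set ('rV[R]_n -> R)) (u : 'rV[R]_n -> R) : Prop :=
  X u /\ J u = ereal_inf (J @` X).

Definition one_parameter_group Xi Phi : Prop :=
  [/\ smooth_on setT (fun z : 'rV[R]_n * R * R => Xi z.1.1 z.1.2 z.2),
      smooth_on setT (fun z : 'rV[R]_n * R * R => Phi z.1.1 z.1.2 z.2),
      forall x u, Xi x u 0 = x /\ Phi x u 0 = u,
      forall x u eps, Xi (Xi x u eps) (Phi x u eps) (- eps) = x /\
                      Phi (Xi x u eps) (Phi x u eps) (- eps) = u &
      forall x u eps delta,
        Xi (Xi x u eps) (Phi x u eps) delta = Xi x u (eps + delta) /\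
        Phi (Xi x u eps) (Phi x u eps) delta = Phi x u (eps + delta)].

Definition infinitesimals Xi Phi xi phi : Prop :=
  forall x u, derive1 (Xi x u) @ 0^' --> xi x u /\
              derive1 (Phi x u) @ 0^' --> phi x u.

(* wt is the transformed function: its graph over YXi is the image of the graph
   of w over Y.  The quantification is over all w and eps for which that image
   is the graph of a smooth function. *)
Definition variational_symmetry Omega L Xi Phi : Prop :=
  forall (Y : set 'rV[R]_n) (w wt : 'rV[R]_n -> R) (eps : R),
    let YXi := [set Xi x (w x) eps | x in Y] in
    smooth_domain Y -> closure Y `<=` Omega ->
    smooth_on Omega w ->
    (forall x, Y x -> wt (Xi x (w x) eps) = Phi x (w x) eps) ->
    open YXi -> smooth_on YXi wt ->
    (\int[rV_lebesgue n]_(x in Y) (L x (w x) (grad w x))%:E =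
     \int[rV_lebesgue n]_(y in YXi) (L y (wt y) (grad wt y))%:E)%E.

(* The gradient is the pointwise one.  For a piecewise polynomial w in H^1 it is
   defined off the null set formed by the faces of the elements, where it is the
   elementwise gradient and hence almost everywhere the weak gradient. *)
Definition conservation_law L xi phi (w : 'rV[R]_n -> R) (x : 'rV[R]_n) :
    'rV[R]_n :=
  let p := grad w x in
  - (L x (w x) p *: xi x (w x) +
     (phi x (w x) - dot (xi x (w x)) p) *: grad (L x (w x)) p).

End variational.

Section simplices.
Context {R : realType}.

(* The rows of a matrix F : 'M[R]_(m.+1, n) are the vertices of an
   m-dimensional simplex in R^n. *)
Definition edges m n (F : 'M[R]_(m.+1, n)) : 'M[R]_(m, n) :=
  \matrix_(i, j) (F (lift ord0 i) j - F ord0 j).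

Definition open_simplex m n (F : 'M[R]_(m.+1, n)) : set 'rV[R]_n :=
  [set x | exists w : 'rV[R]_m.+1,
    [/\ forall i, 0 < w ord0 i, \sum_i w ord0 i = 1 & x = w *m F]].

(* closed; empty if S is *)
Definition subsimplex m n (F : 'M[R]_(m.+1, n)) (S : {set 'I_m.+1}) :
    set 'rV[R]_n :=
  [set x | exists w : 'rV[R]_m.+1,
    [/\ forall i, 0 <= w ord0 i, forall i, i \notin S -> w ord0 i = 0,
        \sum_i w ord0 i = 1 & x = w *m F]].

Definition ref_simplex m : set 'rV[R]_m :=
  [set t | (forall i, 0 <= t ord0 i) /\ \sum_i t ord0 i <= 1].

(* L^2 norm for the m-dimensional surface measure on the simplex F: affine
   parametrisation over the reference simplex, with Gram determinant. *)
Definition simplex_L2norm m n (F : 'M[R]_(m.+1, n)) (f : 'rV[R]_n -> R) : \bar R :=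
  (((Num.sqrt (\det (edges F *m (edges F)^T)))%:E *
    \int[rV_lebesgue m]_(t in @ref_simplex m)
      (`|f (row ord0 F + t *m edges F)| ^+ 2)%:E) `^ 2^-1)%E.

Definition diameter n (A : set 'rV[R]_n) : R :=
  sup [set enorm (x.1 - x.2) | x in A `*` A].

Definition inradius n (A : set 'rV[R]_n) : R :=
  sup [set r : R | 0 <= r /\
    exists c : 'rV[R]_n, [set x | enorm (x - c) < r] `<=` A].

(* the facet opposite to the vertex a *)
Definition facet d (F : 'M[R]_(d.+2, d.+1)) (a : 'I_d.+2) : 'M[R]_(d.+1, d.+1) :=
  row' a F.

(* the unit normal to the facet opposite to the vertex a, pointing away from a *)
Definition outer_normal d (F : 'M[R]_(d.+2, d.+1)) (a : 'I_d.+2) : 'rV[R]_d.+1 :=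
  xget 0 [set nu | [/\ enorm nu = 1,
    forall b c, b != a -> c != a -> dot nu (row b F - row c F) = 0 &
    forall b, b != a -> dot nu (row a F - row b F) < 0]].

(* The trace at x of a field given in A: the limit from inside A. *)
Definition trace_from n (A : set 'rV[R]_n) (q : 'rV[R]_n -> 'rV[R]_n)
    (x : 'rV[R]_n) : 'rV[R]_n :=
  lim (q @ within A (nbhs x)).

End simplices.

Section finite_elements.
Context {R : realType} {d : nat}.

Record mesh := Mesh {
  nelt : nat ;
  vertices : 'I_nelt -> 'M[R]_(d.+2, d.+1) }.

Definition elt (T : mesh) (i : 'I_(nelt T)) : set 'rV[R]_d.+1 :=
  open_simplex (vertices i).

Definition triangulation (Omega : set 'rV[R]_d.+1) (T : mesh) : Prop :=
  [/\ forall i : 'I_(nelt T), row_free (edges (vertices i)),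
      forall i : 'I_(nelt T), elt i `<=` Omega,
      injective (@elt T),
      forall i j : 'I_(nelt T), i != j -> exists S S' : {set 'I_d.+2},
        closure (elt i) `&` closure (elt j) = subsimplex (vertices i) S /\
        closure (elt i) `&` closure (elt j) = subsimplex (vertices j) S' &
      closure Omega `<=` \bigcup_i closure (@elt T i)].

Definition shape_regularity (T : mesh) : R :=
  inf [set inradius (@elt T i) / diameter (@elt T i) | i in setT].

(* An internal interface is a facet common to two elements: (i, a) stands for
   the facet of element i opposite to its a-th vertex; i < j so that each
   interface occurs once. *)
Definition side (T : mesh) : finType := ('I_(nelt T) * 'I_d.+2)%type.

Definition interface (T : mesh) (e : side T * side T) : bool :=
  (e.1.1 < e.2.1)%N &&
  perm_eq [seq row b (facet (vertices e.1.1) e.1.2) | b : 'I_d.+1]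
          [seq row b (facet (vertices e.2.1) e.2.2) | b : 'I_d.+1].

Definition jump (T : mesh) (e : side T * side T)
    (q : 'rV[R]_d.+1 -> 'rV[R]_d.+1) (x : 'rV[R]_d.+1) : R :=
  dot (trace_from (elt e.1.1) q x) (outer_normal (vertices e.1.1) e.1.2) +
  dot (trace_from (elt e.2.1) q x) (outer_normal (vertices e.2.1) e.2.2).

Definition interface_L2norm (T : mesh) (e : side T * side T)
    (f : 'rV[R]_d.+1 -> R) : \bar R :=
  simplex_L2norm (facet (vertices e.1.1) e.1.2) f.

(* polynomial functions of total degree at most k *)
Definition polyfun n (k : nat) (p : 'rV[R]_n -> R) : Prop :=
  exists c : {ffun 'I_n -> 'I_k.+1} -> R, forall x,
    p x = \sum_(al : {ffun 'I_n -> 'I_k.+1} | (\sum_i al i <= k)%N)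
            c al * \prod_i x ord0 i ^+ al i.

Definition fe_space (Omega : set 'rV[R]_d.+1) (T : mesh) (k : nat) :
    set ('rV[R]_d.+1 -> R) :=
  [set v | {within Omega, continuous v} /\
    forall i : 'I_(nelt T), exists2 p, polyfun k p &
      forall x, elt i x -> v x = p x].

Definition fe_space0 (Omega : set 'rV[R]_d.+1) (T : mesh) (k : nat) :
    set ('rV[R]_d.+1 -> R) :=
  fe_space Omega T k `&` H10 Omega.

End finite_elements.
Arguments mesh : clear implicits.

(* Main.v *)
Require Import Defs.
From mathcomp Require Import all_boot all_order all_algebra.
From mathcomp Require Import all_classical all_reals all_analysis.
From mathcomp Require Import measurable_realfun.
From mathcomp Require Import fingroup perm.
From mathcomp Require Import lra ring.
Set Implicit Arguments.
Unset Strict Implicit.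
Unset Printing Implicit Defensive.
Import Order.TTheory GRing.Theory Num.Theory.
Import numFieldNormedType.Exports.
Local Open Scope classical_set_scope.
Local Open Scope ring_scope.

(** The estimate is an integration by parts on each element, followed by two
    inequalities for test functions that do not see the mesh at all.

    Write q for the conservation law of U. On an element U is a polynomial p,
    and q is the restriction of the C1 field built from p. This uses that the
    infinitesimals, given as limits, are derivatives of the smooth group action
    at the parameter 0 (conservation_law_C1). For a test function psi the
    divergence theorem on the elements (divergence_simplex) gives

      - int q . grad psi = sum_K int_K psi div q - sum_e int_e psi [q],

    because a side of an element is shared with at most one other element, and
    if there is none then its relative interior lies outside the open domain,
    where psi vanishes (adjacent_unique, facet_neighbour, sum_sides, green_mesh).

    By the Cauchy-Schwarz inequality it remains to bound the L2 norms of psi on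
    the elements and on the interfaces by that of grad psi on the domain. As psi
    vanishes outside a cube of half width N, the square of psi is at each point
    at most the integral of |d_nu psi^2| along the line through it in any
    direction nu. With nu a coordinate direction this gives Poincare's
    inequality (poincare); with nu normal to a facet, extended to the whole
    hyperplane, it bounds the trace on the facet (facet_trace). Both are
    statements about the whole domain, with constants that depend on N only;
    together they give the constant 4 N + sqrt (8 N) (residual_estimate).

    The supremum defining the dual norm ranges over the H1-closure of the test
    functions, and passes to the limit because q is bounded on the finitely
    many elements (distr_div_le). What remains is measure theory: outside the
    elements q is an arbitrary function, since the pointwise gradient of U need
    not exist there, and this is a null set on which integrands may be changed
    even if they are not measurable (integral_off_null, mesh_integral). Areas,
    the simplex divergence theorem and the trace inequality rest on the affine
    change of variables for the product Lebesgue measure, proved by Gaussian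
    elimination and Fubini (affine_scaling_unitmx). *)

(** * Lebesgue measure on R^n and affine substitutions *)

Section borel.
Context {R : realType}.

Lemma measurable_ball_rV n (x : 'rV[R]_n) (e : R) : measurable (ball x e).
Proof.
have [e0|e0] := leP e 0.
  rewrite (_ : ball x e = set0) ?predeqE// => y; split => // -[].
  by rewrite ltNge e0.
rewrite (_ : ball x e = \bigcap_(i in [set: 'I_n])
    ((fun y : 'rV[R]_n => y ord0 i) @^-1` ball (x ord0 i) e)).
  apply: fin_bigcap_measurable => // i _.
  rewrite -[X in measurable X]setTI; apply: measurable_coord => //.
  by apply: open_measurable; exact: ball_open.
rewrite predeqE => y; split => [[_ h] i _|h]; first exact: h.
by split => // i j; rewrite (ord1 i); exact: h.
Qed.

(** Every open set is a countable union of balls with rational centres and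
    radii, so the coordinates generate the Borel sets of R^n. *)
Lemma open_measurable_rV n (A : set 'rV[R]_n) : open A -> measurable A.
Proof.
move=> oA.
pose c (q : 'rV[rat]_n * nat) := [set y | ball (map_mx ratr q.1 : 'rV[R]_n) q.2.+1%:R^-1 y].
pose F q := if `[< c q `<=` A >] then c q else set0.
have -> : A = \bigcup_q F q.
  rewrite predeqE => x; split => [Ax|[q _]]; last first.
    by rewrite /F; case: asboolP => // qA /qA.
  have /nbhs_ballP[e /= e0 eA] : nbhs x A by exact: open_nbhs_nbhs.
  have [k ke] : exists k : nat, k.+1%:R^-1 < e / 2.
    have [k _ /(_ _ (leqnn k)) H] := near_infty_natSinv_lt (PosNum (divr_gt0 e0 (ltr0Sn R 1))).
    by exists k.
  have k0 : 0 < (k.+1%:R : R)^-1 by rewrite invr_gt0.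
  have [q hq] : {q : 'I_n -> rat & forall i, ball (x ord0 i) (k.+1%:R^-1 : R) (ratr (q i))}.
    apply: (@choice _ _ (fun i y => ball (x ord0 i) (k.+1%:R^-1 : R) (ratr y))) => i.
    have [||r [Br [y _ yr]]] := @dense_rat R (ball (x ord0 i) (k.+1%:R^-1 : R)).
    - by exists (x ord0 i); exact: ballxx.
    - exact: ball_open.
    - by exists y; rewrite yr.
  exists (\row_i q i, k) => //; rewrite /F; case: asboolP => [_|].
    by split => // i j; rewrite (ord1 i) !mxE; exact/ball_sym/hq.
  case=> y [/= _ hy]; apply: eA; split => // i j; rewrite (ord1 i).
  rewrite (splitr e); apply: (@ball_triangle _ R (ratr (q j))).
    exact: le_ball (ltW ke) _ (hq j).
  by apply: le_ball (ltW ke) _ _; have := hy ord0 j; rewrite !mxE.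
apply: countable_bigcupT_measurable => [|q]; first exact: countableP.
by rewrite /F; case: ifP => _ //; exact: measurable_ball_rV.
Qed.

Lemma continuous_measurable_rV n (f : 'rV[R]_n -> R) :
  continuous f -> measurable_fun setT f.
Proof.
move=> cf; apply: (@measurability _ _ _ _ _ _ (@RGenOpens.G R) (RGenOpens.measurableE R)).
move=> _ [_ [a [b ->] <-]]; rewrite setTI.
apply: open_measurable_rV; apply: open_comp; last exact: interval_open.
by move=> x _; exact: cf.
Qed.

Lemma continuous_rV (T : topologicalType) n (f : T -> 'rV[R]_n) (x : T) :
  (forall i, {for x, continuous (fun y => f y ord0 i)}) -> {for x, continuous f}.
Proof.
move=> h; apply/cvgrPdist_lt => e e0.
have : \forall y \near x, forall i, `|f x ord0 i - f y ord0 i| < e.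
  by apply: filter_forall => i; have /cvgrPdist_lt := h i; exact.
apply: filterS => y hy.
have : ball (f x) e (f y) by split => // i j; rewrite (ord1 i); exact: hy.
by rewrite mx_norm_ball.
Qed.

Lemma continuous_coord (T : topologicalType) n (f : T -> 'rV[R]_n) (x : T) (i : 'I_n) :
  {for x, continuous f} -> {for x, continuous (fun y => f y ord0 i)}.
Proof.
move=> cf.
have cg : {for f x, continuous (fun z : 'rV[R]_n => z ord0 i)}.
  by have h := @coord_continuous R 1 n ord0 i (f x); exact: h.
exact: (continuous_comp cf cg).
Qed.

Lemma continuous_measurable_rV2 m n (f : 'rV[R]_m -> 'rV[R]_n) :
  continuous f -> measurable_fun setT f.
Proof.
move=> cf; apply: measurable_rV => i; apply: continuous_measurable_rV => x.
by have h := @continuous_coord 'rV[R]_m n f x i (cf x); exact: h.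
Qed.

Lemma continuous_sumr (T : topologicalType) (V : normedModType R) (I : Type) (r : seq I) (P : pred I)
    (f : I -> T -> V) (x : T) : (forall i, P i -> {for x, continuous (f i)}) ->
  {for x, continuous (fun y => \sum_(i <- r | P i) f i y)}.
Proof.
move=> cf; elim: r => [|i r IH].
  rewrite (_ : (fun y => _) = cst 0); first exact: cst_continuous.
  by apply/funext => y; rewrite big_nil.
case Pi : (P i); last first.
  by rewrite (_ : (fun y => _) = (fun y => \sum_(i <- r | P i) f i y)) //; apply/funext => y; rewrite big_cons Pi.
rewrite (_ : (fun y => _) = (f i \+ (fun y => \sum_(i <- r | P i) f i y))).
  by apply: continuousD => //; exact: cf.
by apply/funext => y; rewrite big_cons Pi.
Qed.

Lemma continuous_mulmx m n (M : 'M[R]_(m, n)) :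
  continuous (fun x : 'rV[R]_m => x *m M).
Proof.
move=> x; apply: continuous_rV => i.
rewrite (_ : (fun y => _) = (fun y : 'rV[R]_m => \sum_j y ord0 j * M j i)); last first.
  by apply/funext => y; rewrite mxE.
apply: continuous_sumr => j _.
have h : {for x, continuous (fun y : 'rV[R]_m => y ord0 j)} := @coord_continuous R 1 m ord0 j x.
have h' := @cvgMr_tmp R 'rV[R]_m (nbhs x) _ (fun y => y ord0 j) _ (M j i) h.
exact: h'.
Qed.

Lemma continuous_affine m n (b : 'rV[R]_n) (M : 'M[R]_(m, n)) :
  continuous (fun x : 'rV[R]_m => b + x *m M).
Proof.
move=> x; have h := @continuousD _ 'rV[R]_n 'rV[R]_m (cst b) (fun x => x *m M) x
  (@cst_continuous _ _ b x) (@continuous_mulmx m n M x).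
exact: h.
Qed.

Lemma measurable_affine m n (b : 'rV[R]_n) (M : 'M[R]_(m, n)) :
  measurable_fun setT (fun x : 'rV[R]_m => b + x *m M).
Proof. by apply: continuous_measurable_rV2; exact: continuous_affine. Qed.

End borel.

Section fubini.
Context {R : realType}.
Local Notation mu n := (@rV_lebesgue R n).
Local Notation lam := (@lebesgue_measure R).
Implicit Types n : nat.
Local Open Scope ereal_scope.

Section ge0.
Variables (n : nat) (f : 'rV[R]_n.+1 -> \bar R).
Hypotheses (mf : measurable_fun setT f) (f0 : forall x, 0 <= f x).

Lemma integral_rV_cons :
  \int[mu n.+1]_x f x = \int[lam \x mu n]_z f (rV_cons z).
Proof.
by rewrite [LHS](ge0_integral_pushforward (@measurable_rV_cons _ n)).
Qed.

Let mfc : measurable_fun setT (f \o @rV_cons R n).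
Proof. exact: (measurableT_comp mf (@measurable_rV_cons _ n)). Qed.

Lemma tonelli_rV1 :
  \int[mu n.+1]_x f x = \int[lam]_a \int[mu n]_y f (rV_cons (a, y)).
Proof. rewrite integral_rV_cons; exact: (fubini_tonelli1 (f \o @rV_cons R n) mfc (fun z => f0 _)). Qed.

Lemma tonelli_rV2 :
  \int[mu n.+1]_x f x = \int[mu n]_y \int[lam]_a f (rV_cons (a, y)).
Proof. rewrite integral_rV_cons; exact: (fubini_tonelli2 (f \o @rV_cons R n) mfc (fun z => f0 _)). Qed.

Lemma measurable_tonelli_rV1 :
  measurable_fun setT (fun a : measurableTypeR R => \int[mu n]_y f (rV_cons (a, y))).
Proof. exact: (measurable_fun_fubini_tonelli_F (f \o @rV_cons R n) mfc (fun z => f0 _)). Qed.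

Lemma measurable_tonelli_rV2 :
  measurable_fun setT (fun y : 'rV[R]_n => \int[lam]_a f (rV_cons (a, y))).
Proof. exact: (measurable_fun_fubini_tonelli_G (f \o @rV_cons R n) mfc (fun z => f0 _)). Qed.

End ge0.

Lemma lebesgue_affine (m b : R) (A : set R) : (m != 0)%R -> measurable A ->
  lam A = `|m|%:E * lam ((fun a => (m * a + b)%R) @^-1` A).
Proof.
move=> m0 mA.
have mg : measurable_fun setT (fun a : measurableTypeR R => (m * a + b)%R : measurableTypeR R).
  by apply: measurable_funD => //; apply: measurable_funM.
apply: (eq_trans (@lebesgue_measure_unique R (mscale (NngNum (normr_ge0 m)) (pushforward lam (fun a : measurableTypeR R => (m * a + b)%R : measurableTypeR R))) _ A mA)) => //.
move=> _ [[u v] _ <-] /=; rewrite /mscale /pushforward /=.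
rewrite /pushforward.
have -> : (fun a : R => (m * a + b)%R) @^-1` `]u, v] =
  if (0 < m)%R then `]((u - b) / m)%R, ((v - b) / m)%R]%classic else `[((v - b) / m)%R, ((u - b) / m)%R[%classic.
  rewrite predeqE => x; case: ifPn => mp /=; rewrite !in_itv/=.
    by rewrite ltr_pdivrMr// ler_pdivlMr// ltrBlDr lerBrDr mulrC.
  have mn : (m < 0)%R by rewrite lt_neqAle m0 leNgt.
  rewrite ltr_ndivlMr// ler_ndivrMr// ltrBlDr lerBrDr mulrC.
  by split => /andP[-> ->].
case: ifPn => mp; rewrite !lebesgue_measure_itv/= !lte_fin.
  rewrite ltr_pM2r ?invr_gt0// ltrD2r; case: ifPn => uv; last by rewrite mule0.
  by rewrite -!EFinB -EFinM gtr0_norm// -mulrBl mulrC divfK//; congr EFin; ring.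
have mn : (m < 0)%R by rewrite lt_neqAle m0 leNgt.
rewrite ltr_nM2r ?invr_lt0// ltrD2r; case: ifPn => uv; last by rewrite mule0.
rewrite -!EFinB -EFinM ltr0_norm// -mulrBl mulrC mulrN divfK//; congr EFin; ring.
Qed.

Lemma ge0_integral_lebesgue_affine (m b : R) (f : R -> \bar R) : (m != 0)%R ->
  measurable_fun setT f -> (forall x, 0 <= f x) ->
  \int[lam]_a f (m * a + b)%R = `|m|^-1%:E * \int[lam]_a f a.
Proof.
move=> m0 mf f0.
have mg : measurable_fun setT (fun a : measurableTypeR R => (m * a + b)%R : measurableTypeR R).
  by apply: measurable_funD => //; apply: measurable_funM.
have n0 : (0 <= `|m|^-1)%R by rewrite invr_ge0.
transitivity (\int[mscale (NngNum n0) lam]_a f a); last by rewrite ge0_integral_mscale.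
transitivity (\int[pushforward lam (fun a : measurableTypeR R => (m * a + b)%R : measurableTypeR R)]_a f a).
  by rewrite ge0_integral_pushforward// preimage_setT.
apply: eq_measure_integral => A mA _.
change (lam ((fun a => (m * a + b)%R) @^-1` A) = `|m|^-1%:E * lam A).
rewrite (@lebesgue_affine m b A m0 mA).
by rewrite muleA -EFinM mulVf ?normr_eq0// mul1e.
Qed.

End fubini.

Section change_of_variables.
Context {R : realType}.
Local Notation mu n := (@rV_lebesgue R n).
Local Notation lam := (@lebesgue_measure R).
Local Open Scope ereal_scope.

(** The substitution rule for x |-> b + x M. All translations b are included
    because a triangular M translates the trailing coordinates by an amount that
    depends on the leading one. *)
Definition affine_scaling n (M : 'M[R]_n) :=
  forall (b : 'rV[R]_n) (f : 'rV[R]_n -> \bar R),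
  measurable_fun setT f -> (forall x, 0 <= f x) ->
  \int[mu n]_x f (b + x *m M)%R = `|\det M|^-1%:E * \int[mu n]_x f x.

Lemma measurable_comp_affine m n (b : 'rV[R]_n) (M : 'M[R]_(m, n)) (f : 'rV[R]_n -> \bar R) :
  measurable_fun setT f -> measurable_fun setT (fun x : 'rV[R]_m => f (b + x *m M)%R).
Proof. by move=> mf; exact: (measurableT_comp mf (measurable_affine b M)). Qed.

Lemma affine_scalingM n (M N : 'M[R]_n) :
  affine_scaling M -> affine_scaling N -> affine_scaling (M *m N).
Proof.
move=> hM hN b f mf f0; rewrite det_mulmx normrM invfM EFinM -muleA -(hN b f mf f0).
rewrite -(hM 0%R (fun x => f (b + x *m N)%R)) //.
  by apply: eq_integral => x _; rewrite add0r mulmxA.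
exact: measurable_comp_affine.
Qed.

Lemma rV_consE n (a : R) (y : 'rV[R]_n) :
  rV_cons (a, y) = row_mx (a%:M : 'M[R]_1) y :> 'rV[R]_n.+1.
Proof.
apply/rowP => i; rewrite !mxE; case: splitP => k ik; case: unliftP => [j ji|i0].
- by move: ik; rewrite ji /= /bump /= ord1.
- by rewrite mxE ord1 eqxx.
- by congr (y _ _); apply/ord_inj; move: ik; rewrite ji lift0 => -[].
- by move: ik; rewrite i0.
Qed.

Lemma row_mx_consE n (x : 'rV[R]_1) (y : 'rV[R]_n) :
  row_mx x y = rV_cons (x ord0 ord0, y) :> 'rV[R]_n.+1.
Proof.
by rewrite rV_consE -mx11_scalar.
Qed.

Lemma rV_consD n a b (x y : 'rV[R]_n) :
  (rV_cons (a, x) + rV_cons (b, y))%R = rV_cons ((a + b)%R, (x + y)%R).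
Proof. by apply/rowP => i; rewrite !mxE /=; case: unlift => [j|]; rewrite ?mxE. Qed.

Lemma rV_unconsK n : cancel (@rV_uncons R n) (@rV_cons R n).
Proof.
move=> x; apply/rowP => i; rewrite mxE /rV_uncons /=.
by case: unliftP => [j ->|->]; rewrite ?mxE.
Qed.

Lemma rV_cons_block n (a : R) (y : 'rV[R]_n) (m : 'M[R]_1) (r : 'rV[R]_n) (c : 'cV[R]_n) (N : 'M[R]_n) :
  rV_cons (a, y) *m (block_mx m r c N : 'M[R]_n.+1) =
  rV_cons ((a * m ord0 ord0 + (y *m c) ord0 ord0)%R, (a *: r + y *m N)%R).
Proof.
rewrite rV_consE (@mul_row_block _ 1 1 n 1 n) row_mx_consE !mxE; congr (rV_cons (_, _)).
  by rewrite big_ord1 mxE eqxx.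
by rewrite mul_scalar_mx.
Qed.

(** Integrate the trailing coordinates first: they undergo an affine
    substitution with matrix N, the leading one a scaling by m. *)
Lemma affine_scaling_upper n (m : 'M[R]_1) (r : 'rV[R]_n) (N : 'M[R]_n) :
  m ord0 ord0 != 0%R -> affine_scaling N ->
  affine_scaling (block_mx m r 0 N : 'M[R]_n.+1).
Proof.
move=> m0 hN b f mf f0; rewrite (@det_ublock _ 1) det_mx11.
rewrite -(rV_unconsK b); case: (rV_uncons b) => {b} b0 b'.
have mfc : measurable_fun setT (fun z : measurableTypeR R * 'rV[R]_n => f (rV_cons z)).
  exact: (measurableT_comp mf (@measurable_rV_cons _ n)).
rewrite tonelli_rV1//; last exact: measurable_comp_affine.
transitivity (\int[lam]_a (`|\det N|^-1%:E * \int[mu n]_y f (rV_cons ((m ord0 ord0 * a + b0)%R, y)))).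
  apply: eq_integral => a _.
  rewrite -(hN (b' + a *: r)%R (fun y => f (rV_cons ((m ord0 ord0 * a + b0)%R, y))))//; last first.
    exact: (measurableT_comp mfc (measurable_pair1 _)).
  apply: eq_integral => y _; rewrite rV_cons_block rV_consD mulmx0 mxE addr0.
  by rewrite addrA [(b0 + _)%R]addrC [(a * _)%R]mulrC.
have mF := measurable_tonelli_rV1 mf f0.
have F0 a : 0 <= \int[mu n]_y f (rV_cons (a, y)) by exact: integral_ge0.
rewrite ge0_integralZl//; last first.
- have mg : measurable_fun setT (fun a : measurableTypeR R => (m ord0 ord0 * a + b0)%R : measurableTypeR R).
    by apply: measurable_funD => //; apply: measurable_funM.
  exact: (measurableT_comp mF mg).
rewrite (ge0_integral_lebesgue_affine b0 m0 mF F0) -tonelli_rV1// muleA -EFinM.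
by rewrite normrM invfM mulrC.
Qed.

(** Integrate the leading coordinate first: it undergoes a translation by an
    amount depending on the others. *)
Lemma affine_scaling_lower n (c : 'cV[R]_n) :
  affine_scaling (1%:M : 'M[R]_n) ->
  affine_scaling (block_mx (1%:M : 'M[R]_1) 0 c 1%:M : 'M[R]_n.+1).
Proof.
move=> h1 b f mf f0; rewrite (@det_lblock _ 1) !det1 mulr1 normr1 invr1 mul1e.
rewrite -(rV_unconsK b); case: (rV_uncons b) => {b} b0 b'.
have mfc : measurable_fun setT (fun z : measurableTypeR R * 'rV[R]_n => f (rV_cons z)).
  exact: (measurableT_comp mf (@measurable_rV_cons _ n)).
rewrite tonelli_rV2//; last exact: measurable_comp_affine.
have mG := measurable_tonelli_rV2 mf f0.
transitivity (\int[mu n]_y \int[lam]_a f (rV_cons (a, (b' + y *m 1%:M)%R))).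
  apply: eq_integral => y _.
  have := @ge0_integral_lebesgue_affine R 1 (b0 + (y *m c) ord0 ord0)%R
     (fun a => f (rV_cons (a, (b' + y *m 1%:M)%R))) (oner_neq0 _) _ (fun=> f0 _).
  rewrite normr1 invr1 mul1e => <-; last exact: (measurableT_comp mfc (measurable_pair2 _)).
  apply: eq_integral => a _; rewrite rV_cons_block rV_consD scaler0 add0r !mxE eqxx mulr1n mulr1 mul1r.
  by rewrite addrCA.
rewrite (h1 b' (fun y => \int[lam]_a f (rV_cons (a, y))))//; last by move=> y; exact: integral_ge0.
by rewrite det1 normr1 invr1 mul1e -tonelli_rV2.
Qed.

Lemma affine_scaling1 n : affine_scaling (1%:M : 'M[R]_n).
Proof.
elim: n => [b f mf f0|n IH].
  rewrite det1 normr1 invr1 mul1e; apply: eq_integral => x _; congr f.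
  by apply/rowP => -[].
have := @affine_scaling_lower n 0 IH.
by rewrite -(@scalar_mx_block _ 1).
Qed.

(** Gaussian elimination: if the corner entry is non-zero the matrix is a
    product of a lower and an upper factor, and otherwise adding a suitable
    row to the first one makes it so. *)
Lemma affine_scaling_unitmx n (M : 'M[R]_n) : M \in unitmx -> affine_scaling M.
Proof.
elim: n M => [M _ b f mf f0|n IH M uM].
  rewrite det_mx00 normr1 invr1 mul1e; apply: eq_integral => x _; congr f.
  by apply/rowP => -[].
have corner (A : 'M[R]_n.+1) : A \in unitmx -> A ord0 ord0 != 0%R -> affine_scaling A.
  move=> uA A0.
  pose m := @ulsubmx _ 1 n 1 n A; pose r := @ursubmx _ 1 n 1 n A.
  pose c := @dlsubmx _ 1 n 1 n A; pose N := @drsubmx _ 1 n 1 n A.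
  have mE : m ord0 ord0 = A ord0 ord0.
    by rewrite !mxE; congr (A _ _); exact: val_inj.
  pose c' := ((m ord0 ord0)^-1 *: c)%R; pose S := (N - c' *m r)%R.
  have AE : A = (block_mx (1%:M : 'M[R]_1) 0 c' 1%:M : 'M[R]_n.+1) *m (block_mx m r 0 S : 'M[R]_n.+1).
    rewrite (@mulmx_block _ 1 n 1 n 1 n) !mul1mx !mul0mx !addr0.
    rewrite (_ : c' *m m = c).
      by rewrite /S addrC subrK -[LHS](@submxK _ 1 n 1 n).
    rewrite [m]mx11_scalar mul_mx_scalar /c' scalerA !mxE.
    by rewrite divff ?scale1r//; move: A0; rewrite -mE !mxE.
  rewrite AE; apply: affine_scalingM; first by apply: affine_scaling_lower; exact: affine_scaling1.
  apply: affine_scaling_upper; first by rewrite mE.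
  apply: IH; move: uA; rewrite AE unitmx_mul => /andP[_].
  by rewrite !unitmxE (@det_ublock _ 1) unitrM => /andP[].
have [M0|] := eqVneq (M ord0 ord0) 0%R; last exact: corner.
have [k Mk] : exists k, M (lift ord0 k) ord0 != 0%R.
  apply/existsP; apply: contraT; rewrite negb_exists => /forallP h.
  suff /eqP : col ord0 M = 0%R.
    move=> c0; move: uM; rewrite unitmxE (expand_det_col _ ord0) big1 ?unitr0// => i _.
    by have /eqP/colP/(_ i) := c0; rewrite !mxE => ->; rewrite mul0r.
  apply/colP => i; rewrite !mxE; case: (unliftP ord0 i) => [j ->|->//].
  by apply/eqP; move: (h j); rewrite negbK.
pose s : R -> 'M[R]_n.+1 := fun e => block_mx (1%:M : 'M[R]_1) (e *: delta_mx ord0 k) 0 1%:M.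
have us e : affine_scaling (s e).
  by apply: affine_scaling_upper; [rewrite mxE oner_neq0|exact: affine_scaling1].
have ME : M = s (-1)%R *m (s 1%R *m M).
  rewrite mulmxA (@mulmx_block _ 1 n 1 n 1 n) !mul1mx !mulmx1 !mul0mx !mulmx0 !addr0 add0r.
  by rewrite -scalerDl subrr scale0r -(@scalar_mx_block _ 1) mul1mx.
rewrite ME; apply: affine_scalingM => //; apply: corner.
  rewrite unitmx_mul uM andbT unitmxE (@det_ublock _ 1) !det1 mulr1; exact: unitr1.
have sE j : s 1%R ord0 (lift ord0 j) = (j == k)%:R.
  have -> : lift ord0 j = rshift 1 j by exact/ord_inj.
  have -> : (ord0 : 'I_(1 + n)) = lshift n ord0 by exact/ord_inj.
  transitivity ((1%R *: delta_mx ord0 k : 'rV[R]_n) ord0 j); last by rewrite !mxE eqxx mul1r.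
  exact: block_mxEur.
rewrite (_ : (s 1%R *m M) ord0 ord0 = M (lift ord0 k) ord0)//.
rewrite mxE (bigD1 ord0)//= M0 mulr0 add0r (bigD1 (lift ord0 k))//= big1.
  by rewrite sE eqxx mul1r addr0.
move=> i /andP[i0 ik]; case: (unliftP ord0 i) => [j ij|i0']; last by rewrite i0' eqxx in i0.
rewrite ij sE (_ : (j == k) = false) ?mul0r//; apply: contraNF ik => /eqP <-.
by rewrite ij.
Qed.

Lemma affine_rV_unit n (b : 'rV[R]_n) (M : 'M[R]_n) (f : 'rV[R]_n -> \bar R) : M \in unitmx ->
  measurable_fun setT f -> (forall x, 0 <= f x) ->
  \int[mu n]_x f x = `|\det M|%:E * \int[mu n]_x f (b + x *m M)%R.
Proof.
move=> uM mf f0; rewrite affine_scaling_unitmx// muleA -EFinM mulfV ?mul1e//.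
by rewrite normr_eq0; move: uM; rewrite unitmxE unitfE.
Qed.

Lemma integrable_affine n (b : 'rV[R]_n) (M : 'M[R]_n) (f : 'rV[R]_n -> \bar R) : M \in unitmx ->
  (mu n).-integrable setT f -> (mu n).-integrable setT (fun x => f (b + x *m M)%R).
Proof.
move=> uM /integrableP[mf fi]; apply/integrableP; split; first exact: measurable_comp_affine.
rewrite (affine_scaling_unitmx uM b (f := fun x => `|f x|))//; last exact: measurableT_comp.
by rewrite lte_mul_pinfty// lee_fin invr_ge0.
Qed.

Lemma integral_affine n (b : 'rV[R]_n) (M : 'M[R]_n) (f : 'rV[R]_n -> \bar R) : M \in unitmx ->
  (mu n).-integrable setT f ->
  \int[mu n]_x f x = `|\det M|%:E * \int[mu n]_x f (b + x *m M)%R.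
Proof.
move=> uM fi; rewrite integralE [in RHS]integralE muleBr//; last first.
  have /integrableP[_] := integrable_affine b uM fi.
  move=> h; apply: fin_num_adde_defl => //.
  rewrite fin_numN; exact: (integrable_neg_fin_num measurableT (integrable_affine b uM fi)).
have mf := measurable_int _ fi.
have ep := affine_rV_unit b uM (measurable_funepos mf) (fun x => funepos_ge0 f x).
have en := affine_rV_unit b uM (measurable_funeneg mf) (fun x => funeneg_ge0 f x).
rewrite ep en; congr (_ * _ - _ * _); apply: eq_integral => x _; by rewrite ?funeposE ?funenegE.
Qed.

End change_of_variables.

Section finiteness.
Context {R : realType}.
Local Notation mu n := (@rV_lebesgue R n).
Local Notation lam := (@lebesgue_measure R).
Local Open Scope ereal_scope.

Lemma closed_measurable_rV n (A : set 'rV[R]_n) : closed A -> measurable A.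
Proof.
by move=> cA; rewrite -(setCK A); apply: measurableC; apply: open_measurable_rV; exact: closed_openC.
Qed.

Lemma rV_lebesgue_tonelli1 n (A : set 'rV[R]_n.+1) : measurable A ->
  mu n.+1 A = \int[lam]_a mu n [set y | A (rV_cons (a, y))].
Proof.
move=> mA; transitivity (\int[mu n.+1]_x (\1_A x)%:E); first by rewrite integral_indic// setIT.
rewrite tonelli_rV1//; last by apply/measurable_EFinP; exact: measurable_indic.
apply: eq_integral => a _.
transitivity (\int[mu n]_y (\1_[set y | A (rV_cons (a, y))] y)%:E).
  by apply: eq_integral => y _; rewrite !indicE; congr (_%:R)%:E; apply/idP/idP; rewrite !inE.
rewrite integral_indic ?setIT//.
rewrite -[X in measurable X]setTI.
have : measurable_fun setT (fun y : 'rV[R]_n => rV_cons (a, y)).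
  exact: (measurableT_comp (@measurable_rV_cons R n) (measurable_pair1 _)).
exact.
Qed.

Lemma rV_lebesgue_tonelli2 n (A : set 'rV[R]_n.+1) : measurable A ->
  mu n.+1 A = \int[mu n]_y lam [set a | A (rV_cons (a, y))].
Proof.
move=> mA; transitivity (\int[mu n.+1]_x (\1_A x)%:E); first by rewrite integral_indic// setIT.
rewrite tonelli_rV2//; last by apply/measurable_EFinP; exact: measurable_indic.
apply: eq_integral => y _.
transitivity (\int[lam]_a (\1_[set a | A (rV_cons (a, y))] a)%:E).
  by apply: eq_integral => a _; rewrite !indicE; congr (_%:R)%:E; apply/idP/idP; rewrite !inE.
rewrite integral_indic ?setIT//.
rewrite -[X in measurable X]setTI.
have : measurable_fun setT (fun a : measurableTypeR R => rV_cons (a, y)).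
  exact: (measurableT_comp (@measurable_rV_cons R n) (measurable_pair2 _)).
exact.
Qed.

Lemma continuous_affine_form n (al : R) (be : 'I_n -> R) :
  continuous (fun x : 'rV[R]_n => (al + \sum_i x ord0 i * be i)%R).
Proof.
have -> : (fun x : 'rV[R]_n => (al + \sum_i x ord0 i * be i)%R) =
   (fun x : 'rV[R]_n => ((const_mx al : 'rV[R]_1) + x *m (\col_i be i)%R)%R ord0 ord0).
  by apply/funext => x; rewrite !mxE; congr +%R; apply: eq_bigr => i _; rewrite mxE.
move=> x; have h := @continuous_coord _ 'rV[R]_n 1 _ x ord0 (@continuous_affine _ n 1 (const_mx al) (\col_i be i)%R x).
exact: h.
Qed.

(** If the leading coefficient is not zero, the slices along the first axis are
    single points; otherwise the form depends on the other coordinates only. *)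
Lemma null_affine_form n (al : R) (be : 'I_n -> R) :
  (al != 0%R) || [exists i, be i != 0%R] ->
  mu n [set x | (al + \sum_i x ord0 i * be i = 0)%R] = 0.
Proof.
elim: n be => [|n IH] be h.
  have al0 : al != 0%R by case/orP: h => // /existsP[[]].
  rewrite (_ : [set _ | _] = set0) ?measure0// predeqE => x; split => //=.
  by rewrite big_ord0 addr0 => /eqP; rewrite (negbTE al0).
have mA : measurable [set x : 'rV[R]_n.+1 | (al + \sum_i x ord0 i * be i = 0)%R].
  apply: closed_measurable_rV.
  apply: (@closed_comp _ _ (fun x : 'rV[R]_n.+1 => (al + \sum_i x ord0 i * be i)%R) [set 0%R]).
    by move=> x _; exact: continuous_affine_form.
  exact: closed_eq.
have consE a y : (\sum_i (rV_cons (a, y) : 'rV[R]_n.+1) ord0 i * be i =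
    a * be ord0 + \sum_i y ord0 i * be (lift ord0 i))%R.
  rewrite big_ord_recl !mxE unlift_none /=; congr +%R.
  by apply: eq_bigr => i _; rewrite !mxE liftK.
have [b0|b0] := eqVneq (be ord0) 0%R.
  rewrite rV_lebesgue_tonelli1//; apply: integral0_eq => a _.
  apply: etrans (IH (fun j => be (lift ord0 j)) _).
    by congr (mu n _); rewrite predeqE => y; rewrite /= (consE a y) b0 mulr0 add0r.
  case/orP: h => [->//|/existsP[i bi]]; apply/orP; right.
  case: (unliftP ord0 i) bi => [j ->|->]; last by rewrite b0 eqxx.
  by move=> bj; apply/existsP; exists j.
rewrite rV_lebesgue_tonelli2//; apply: integral0_eq => y _.
apply/eqP; rewrite -measure_le0.
set c := (- (al + \sum_i y ord0 i * be (lift ord0 i)) / be ord0)%R.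
rewrite -(@lebesgue_measure_set1 R c); apply: le_measure; [apply: mem_set|apply: mem_set|].
- rewrite -[X in measurable X]setTI.
  have : measurable_fun setT (fun a : measurableTypeR R => rV_cons (a, y)).
    exact: (measurableT_comp (@measurable_rV_cons R n) (measurable_pair2 _)).
  by move=> /(_ measurableT _ mA).
- exact: measurable_set1.
move=> a /=; rewrite consE addrCA => /eqP; rewrite addr_eq0 => /eqP h'.
by rewrite /c -h' mulfK.
Qed.

Lemma measurable_cube m (M : R) : measurable [set x : 'rV[R]_m | forall i, (`|x ord0 i| <= M)%R].
Proof.
  rewrite (_ : [set _ | _] = \bigcap_(i in [set: 'I_m]) ((fun y : 'rV[R]_m => y ord0 i) @^-1` [set a | (`|a| <= M)%R])).
    apply: fin_bigcap_measurable => // i _.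
    rewrite -[X in measurable X]setTI; apply: measurable_coord => //.
    rewrite (_ : [set _ | _] = `[(- M)%R, M]%classic)//.
    by rewrite predeqE => a /=; rewrite in_itv/= ler_norml.
  by rewrite predeqE => x; split => [h i _|h i]; exact: h.
Qed.

Lemma rV_lebesgue_cube n (M : R) : mu n [set x | forall i, (`|x ord0 i| <= M)%R] < +oo.
Proof.
elim: n => [|n IH].
  by rewrite /= diracE ltry.
rewrite rV_lebesgue_tonelli1; last exact: measurable_cube.
rewrite (_ : \int[lam]_a _ = \int[lam]_a ((\1_(`[(- M)%R, M]%classic : set R) a)%:E * mu n [set x | forall i, (`|x ord0 i| <= M)%R])).
  rewrite ge0_integralZr//; last by apply/measurable_EFinP; exact: measurable_indic.
  rewrite integral_indic// setIT.
  rewrite [X in X * _](lebesgue_measure_itv `[(- M)%R, M])/=; case: ifPn => [MM|_]; last by rewrite mul0e ltry.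
  rewrite -EFinB lte_mul_pinfty//; rewrite lte_fin in MM.
  by rewrite lee_fin subr_ge0 ltW.
apply: eq_integral => a _; rewrite indicE.
have [aM|aM] := boolP (`|a| <= M)%R.
  rewrite mem_set ?mul1e /=; last by rewrite in_itv/= -ler_norml.
  congr (mu n _); rewrite predeqE => y; split => /= h i.
    by have := h (lift ord0 i); rewrite !mxE liftK.
  by rewrite mxE; case: unlift => [j|]//=.
rewrite memNset ?mul0e /=; last by rewrite in_itv/= -ler_norml; exact/negP.
rewrite (_ : [set _ | _] = set0) ?measure0// predeqE => y; split => // /(_ ord0).
by rewrite mxE unlift_none /= (negbTE aM).
Qed.

Lemma bounded_coord n (A : set 'rV[R]_n) : bounded_set A ->
  exists M : R, (0 < M)%R /\ forall x, A x -> forall i, (`|x ord0 i| <= M)%R.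
Proof.
move=> [M [_ hM]]; exists (`|M| + 1)%R; split; first by rewrite ltr_wpDl.
move=> x Ax i; apply: (@le_trans _ _ `|x|%R).
  rewrite [leRHS]/Num.Def.normr /= mx_normrE.
  by apply: (le_bigmax_cond _ (fun ij => `|x ij.1 ij.2|%R) (j := (ord0, i))).
by apply: hM => //; rewrite (le_lt_trans (ler_norm _))// ltrDl.
Qed.

Lemma bounded_finite_measure n (A : set 'rV[R]_n) : measurable A -> bounded_set A ->
  mu n A < +oo.
Proof.
move=> mA /bounded_coord[M [_ hM]].
apply: le_lt_trans (rV_lebesgue_cube n M); apply: le_measure; [apply: mem_set|apply: mem_set|] => //.
exact: measurable_cube.
Qed.

Lemma continuous_bounded n (A : set 'rV[R]_n) (f : 'rV[R]_n -> R) : bounded_set A ->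
  continuous f -> exists M : R, (0 < M)%R /\ forall x, A x -> (`|f x| <= M)%R.
Proof.
move=> /bounded_coord[N [N0 hN]] cf.
pose B := [set x : 'rV[R]_n | forall i, x ord0 i \in `[(- N)%R, N]].
have cB : compact B.
  by apply: (@rV_compact _ _ (fun=> `[(- N)%R, N]%classic)) => _; exact: segment_compact.
have /compact_bounded[M [_ hM]] : compact (f @` B).
  by apply: continuous_compact => //; apply: continuous_subspaceT.
exists (`|M| + 1)%R; split; first by rewrite ltr_wpDl.
move=> x Ax; apply: hM; first by rewrite (le_lt_trans (ler_norm _))// ltrDl.
by exists x => // i; rewrite in_itv/= -ler_norml; exact: hN.
Qed.

Lemma continuous_integrable n (A : set 'rV[R]_n) (f : 'rV[R]_n -> R) : measurable A -> bounded_set A ->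
  continuous f -> (mu n).-integrable A (EFin \o f).
Proof.
move=> mA bA cf; apply: measurable_bounded_integrable => //.
- exact: bounded_finite_measure.
- by apply: measurable_funTS; exact: continuous_measurable_rV.
have [M [M0 hM]] := continuous_bounded bA cf.
by exists M; split => [|K MK x Ax /=]; [exact: num_real|exact: le_trans (hM _ Ax) (ltW MK)].
Qed.

Lemma fubini_rV2 n (f : 'rV[R]_n.+1 -> \bar R) : (mu n.+1).-integrable setT f ->
  \int[mu n.+1]_x f x = \int[mu n]_y \int[lam]_a f (rV_cons (a, y)).
Proof.
move=> fi; have mf := measurable_int _ fi.
have fci : (lam \x mu n).-integrable setT (f \o @rV_cons R n).
  apply/integrableP; split; first exact: (measurableT_comp mf (@measurable_rV_cons _ n)).
  have /integrableP[_] := fi; rewrite integral_rV_cons//; exact: measurableT_comp.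
rewrite [LHS](integral_pushforward (@measurable_rV_cons R n) mf fci measurableT).
by rewrite preimage_setT; rewrite -(fubini2 fci).
Qed.

End finiteness.

(** * Simplices in barycentric coordinates *)

Section weights.
Context {R : realType}.

(** Barycentric weights in terms of reference coordinates: the reference
    coordinate j is the weight of the vertex j+1. *)
Definition weights m (t : 'rV[R]_m) : 'rV[R]_m.+1 :=
  rV_cons (1 - \sum_j t ord0 j, t).

(** The linear part of the affine map weights. *)
Definition weightsD m : 'M[R]_(m, m.+1) :=
  \matrix_(i, j) (if unlift ord0 j is Some k then (i == k)%:R else -1).

Definition std_simplex m : 'M[R]_(m.+1, m) :=
  \matrix_(i, j) (if unlift ord0 i is Some k then (k == j)%:R else 0).

Definition param m n (F : 'M[R]_(m.+1, n)) (t : 'rV[R]_m) : 'rV[R]_n :=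
  row ord0 F + t *m edges F.

Lemma weights0 m (t : 'rV[R]_m) : weights t ord0 ord0 = 1 - \sum_j t ord0 j.
Proof. by rewrite mxE unlift_none. Qed.

Lemma weights_lift m (t : 'rV[R]_m) j : weights t ord0 (lift ord0 j) = t ord0 j.
Proof. by rewrite mxE liftK. Qed.

Lemma weights_sum m (t : 'rV[R]_m) : \sum_i weights t ord0 i = 1.
Proof.
rewrite big_ord_recl weights0 [X in _ + X](eq_bigr (fun j => t ord0 j)) => [|j _]; last exact: weights_lift.
by rewrite subrK.
Qed.

Lemma weightsE m (t : 'rV[R]_m) : weights t = weights 0 + t *m weightsD m.
Proof.
apply/rowP => i; rewrite [RHS]mxE [X in _ + X]mxE.
case: (unliftP ord0 i) => [j ->|->]; rewrite ?weights_lift ?weights0.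
  rewrite mxE add0r (bigD1 j)//= big1 ?addr0; last first.
    by move=> k kj; rewrite !mxE liftK (negbTE kj) mulr0.
  by rewrite mxE liftK eqxx mulr1.
rewrite [X in 1 - X + _]big1 ?subr0; last by move=> j _; rewrite mxE.
congr (_ + _); rewrite -sumrN; apply: eq_bigr => j _.
by rewrite mxE unlift_none mulrN1.
Qed.

Lemma weights_of_sum m (w : 'rV[R]_m.+1) : \sum_i w ord0 i = 1 ->
  w = weights (\row_j w ord0 (lift ord0 j)).
Proof.
move=> w1; apply/rowP => i; case: (unliftP ord0 i) => [j ->|->].
  by rewrite weights_lift mxE.
rewrite weights0 -w1 big_ord_recl; under [X in _ = _ - X]eq_bigr do rewrite mxE.
by rewrite addrK.
Qed.

Lemma weightsD_mul m n (F : 'M[R]_(m.+1, n)) : weightsD m *m F = edges F.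
Proof.
apply/matrixP => i j; rewrite !mxE big_ord_recl mxE unlift_none mulN1r addrC.
congr (_ + _); rewrite (bigD1 i)//= big1 ?addr0 ?mxE ?liftK ?eqxx ?mul1r//.
by move=> k ki; rewrite mxE liftK eq_sym (negbTE ki) mul0r.
Qed.

Lemma weightsD_sum m : weightsD m *m const_mx 1 = 0 :> 'M[R]_(m, 1).
Proof.
rewrite weightsD_mul; apply/matrixP => i j; rewrite !mxE subrr//.
Qed.

Lemma weights_mul m n (F : 'M[R]_(m.+1, n)) (t : 'rV[R]_m) : weights t *m F = param F t.
Proof.
rewrite weightsE mulmxDl -mulmxA weightsD_mul; congr (_ + _).
apply/rowP => j; rewrite !mxE big_ord_recl weights0 big1 ?subr0 ?mul1r; last first.
  by move=> k _; rewrite mxE.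
by rewrite big1 ?addr0// => k _; rewrite weights_lift mxE mul0r.
Qed.

Lemma std_simplex_edges m : edges (std_simplex m) = 1%:M.
Proof. by apply/matrixP => i j; rewrite !mxE liftK unlift_none subr0. Qed.

Lemma weights_std m (t : 'rV[R]_m) : weights t *m std_simplex m = t.
Proof.
rewrite weights_mul /param std_simplex_edges mulmx1; apply/rowP => j.
by rewrite !mxE unlift_none add0r.
Qed.

Lemma weights_std_sum m (w : 'rV[R]_m.+1) : \sum_i w ord0 i = 1 ->
  weights (w *m std_simplex m) = w.
Proof. by move=> /weights_of_sum ->; rewrite weights_std. Qed.

(** The linear part, in reference coordinates, of the affine map of the standard
    simplex that permutes its vertices by s. *)
Definition perm_linear m (s : 'S_m.+1) : 'M[R]_m := edges (row_perm s (std_simplex m)).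

Lemma edges_row_perm m n (s : 'S_m.+1) (F : 'M[R]_(m.+1, n)) :
  edges (row_perm s F) = perm_linear s *m edges F.
Proof.
apply/row_matrixP => i; rewrite row_mul.
pose w := row (lift ord0 i) (row_perm s (1%:M : 'M[R]_m.+1)).
pose w0 := row ord0 (row_perm s (1%:M : 'M[R]_m.+1)).
have h j n' (G : 'M[R]_(m.+1, n')) : row j (row_perm s G) = row (s j) G.
  by apply/rowP => k; rewrite !mxE.
have he n' (G : 'M[R]_(m.+1, n')) : row i (edges G) = row (lift ord0 i) G - row ord0 G.
  by apply/rowP => k; rewrite !mxE.
have hp k : row k F = row ord0 F + row k (std_simplex m) *m edges F.
  apply/rowP => j; rewrite !mxE; case: (unliftP ord0 k) => [k' ->|->].
    rewrite (bigD1 k')//= big1 ?addr0; last first.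
      by move=> l lk; rewrite !mxE liftK eq_sym (negbTE lk) mul0r.
    by rewrite !mxE liftK eqxx mul1r addrC subrK.
  by rewrite big1 ?addr0// => l _; rewrite !mxE unlift_none mul0r.
rewrite /perm_linear !he !h (hp (s (lift ord0 i))) (hp (s ord0)) mulmxBl.
by rewrite opprD addrACA subrr add0r.
Qed.

Lemma perm_linear1 m : perm_linear (1%g : 'S_m.+1) = 1%:M.
Proof. by rewrite /perm_linear row_perm1 std_simplex_edges. Qed.

Lemma perm_linearM m (s t : 'S_m.+1) :
  perm_linear (s * t)%g = perm_linear s *m perm_linear t.
Proof. by rewrite -edges_row_perm -row_permM. Qed.

(** perm_linear is a homomorphism from a finite group, so its determinants are
    roots of unity. *)
Lemma perm_linear_det m (s : 'S_m.+1) : `|\det (perm_linear s)| = 1.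
Proof.
have hX k : \det (perm_linear (s ^+ k)%g) = \det (perm_linear s) ^+ k.
  elim: k => [|k IH]; first by rewrite expg0 perm_linear1 det1.
  by rewrite expgS perm_linearM det_mulmx IH exprS.
have := hX #[s]%g; rewrite expg_order perm_linear1 det1 => /esym/(congr1 Num.norm).
rewrite normrX normr1 => /eqP; rewrite pexpr_eq1 ?order_gt0//.
by move=> /eqP.
Qed.

Lemma perm_linear_unit m (s : 'S_m.+1) : perm_linear s \in unitmx.
Proof. by rewrite unitmxE unitfE -normr_eq0 perm_linear_det oner_neq0. Qed.

Lemma edges_row_perm_unit m (s : 'S_m.+1) (F : 'M[R]_(m.+1, m)) :
  (edges (row_perm s F) \in unitmx) = (edges F \in unitmx).
Proof. by rewrite edges_row_perm unitmx_mul perm_linear_unit. Qed.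

Lemma det_edges_row_perm m (s : 'S_m.+1) (F : 'M[R]_(m.+1, m)) :
  `|\det (edges (row_perm s F))| = `|\det (edges F)|.
Proof. by rewrite edges_row_perm det_mulmx normrM perm_linear_det mul1r. Qed.

Definition gram m n (F : 'M[R]_(m.+1, n)) := \det (edges F *m (edges F)^T).

Lemma gram_row_perm m n (s : 'S_m.+1) (F : 'M[R]_(m.+1, n)) : gram (row_perm s F) = gram F.
Proof.
rewrite /gram edges_row_perm trmx_mul mulmxA -(mulmxA (perm_linear s)) !det_mulmx det_tr.
by rewrite mulrAC -expr2 -real_normK ?num_real// perm_linear_det expr1n mul1r.
Qed.

(** Renumbering the vertices is an affine substitution of the reference
    coordinates. *)
Lemma param_row_perm m n (s : 'S_m.+1) (F : 'M[R]_(m.+1, n)) (t : 'rV[R]_m) :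
  param (row_perm s F) t = param F (param (row_perm s (std_simplex m)) t).
Proof.
rewrite -!weights_mul !row_permE (mulmxA (weights t)) (mulmxA (weights t)).
rewrite weights_std_sum//; set w := weights t.
have -> : w *m perm_mx s = col_perm s^-1 w by rewrite col_permE invgK.
rewrite -(weights_sum t) [RHS](reindex_inj (@perm_inj _ s^-1))/=.
by apply: eq_bigr => i _; rewrite mxE.
Qed.

Lemma ref_simplexP m (t : 'rV[R]_m) : ref_simplex t <-> forall i, 0 <= weights t ord0 i.
Proof.
split=> [[t0 t1] i|h]; last first.
  split=> [i|]; first by have := h (lift ord0 i); rewrite weights_lift.
  by have := h ord0; rewrite weights0 subr_ge0.
case: (unliftP ord0 i) => [j ->|->]; first by rewrite weights_lift.
by rewrite weights0 subr_ge0.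
Qed.

Lemma ref_simplex_perm m (s : 'S_m.+1) (t : 'rV[R]_m) :
  ref_simplex (param (row_perm s (std_simplex m)) t) <-> ref_simplex t.
Proof.
rewrite -weights_mul row_permE mulmxA.
have -> : weights t *m perm_mx s = col_perm s^-1 (weights t) by rewrite col_permE invgK.
rewrite !ref_simplexP weights_std_sum; last first.
  rewrite -(weights_sum t) [RHS](reindex_inj (@perm_inj _ s^-1))/=.
  by apply: eq_bigr => i _; rewrite mxE.
split=> h i; last by rewrite mxE.
by have := h (s i); rewrite mxE permK.
Qed.

End weights.

Section barycentric.
Context {R : realType} {m : nat}.
Implicit Types (F : 'M[R]_(m.+1, m)) (x y v : 'rV[R]_m).

Definition bary F x : 'rV[R]_m.+1 := weights ((x - row ord0 F) *m invmx (edges F)).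

(** The columns are the gradients of the barycentric coordinates. *)
Definition baryD F : 'M[R]_(m, m.+1) := invmx (edges F) *m weightsD m.

Lemma bary_sum F x : \sum_i bary F x ord0 i = 1.
Proof. exact: weights_sum. Qed.

Lemma baryB F x y : bary F x - bary F y = (x - y) *m baryD F.
Proof.
rewrite /bary weightsE [in X in _ - X]weightsE opprD addrACA subrr add0r.
by rewrite -mulmxBl -mulmxBl opprB addrA subrK mulmxA.
Qed.

Lemma bary_add F x v : bary F (x + v) = bary F x + v *m baryD F.
Proof. by have := baryB F (x + v) x; rewrite [x + v]addrC addrK => <-; rewrite addrCA subrr addr0. Qed.

Variable F : 'M[R]_(m.+1, m).
Hypothesis uF : edges F \in unitmx.

Lemma bary_mul x : bary F x *m F = x.
Proof. by rewrite weights_mul /param mulmxKV// addrC subrK. Qed.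

Lemma bary_param t : bary F (param F t) = weights t.
Proof. by rewrite /bary /param addrC addKr mulmxK. Qed.

Lemma mul_bary (w : 'rV[R]_m.+1) : \sum_i w ord0 i = 1 -> bary F (w *m F) = w.
Proof. by move=> /weights_of_sum ->; rewrite weights_mul bary_param. Qed.

Lemma bary_row b : bary F (row b F) = delta_mx ord0 b.
Proof.
rewrite rowE mul_bary// (bigD1 b)//= big1 ?mxE ?eqxx ?addr0// => i ib.
by rewrite mxE (negbTE ib) andbF.
Qed.

Lemma baryD_mul : baryD F *m F = 1%:M.
Proof. by rewrite /baryD -mulmxA weightsD_mul mulVmx. Qed.

Lemma baryD_sum k : \sum_b baryD F k b = 0.
Proof.
transitivity ((baryD F *m const_mx 1 : 'M[R]_(m, 1)) k ord0).
  by rewrite mxE; apply: eq_bigr => b _; rewrite [X in _ * X]mxE mulr1.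
by rewrite /baryD -mulmxA weightsD_sum mulmx0 mxE.
Qed.

Lemma baryD_rowB a b c : ((row b F - row c F) *m baryD F) ord0 a = (a == b)%:R - (a == c)%:R.
Proof. by rewrite -baryB !bary_row !mxE eqxx. Qed.

Lemma open_simplexP x : open_simplex F x <-> forall i, 0 < bary F x ord0 i.
Proof.
split=> [[w [w0 w1 ->]] i|h]; first by rewrite mul_bary.
by exists (bary F x); split => //; [exact: bary_sum|rewrite bary_mul].
Qed.

Lemma subsimplexP (S : {set 'I_m.+1}) x : subsimplex F S x <->
  (forall i, 0 <= bary F x ord0 i) /\ (forall i, i \notin S -> bary F x ord0 i = 0).
Proof.
split=> [[w [w0 wS w1 ->]]|[h hS]].
  by rewrite mul_bary//; split.
by exists (bary F x); split => //; [exact: bary_sum|rewrite bary_mul].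
Qed.

Lemma bary_affine_form i : exists al (be : 'I_m -> R),
  (forall x, bary F x ord0 i = al + \sum_j x ord0 j * be j) /\
  ((al != 0) || [exists j, be j != 0]).
Proof.
exists (bary F 0 ord0 i), (fun j => baryD F j i).
have h x : bary F x ord0 i = bary F 0 ord0 i + \sum_j x ord0 j * baryD F j i.
  by rewrite -[x in LHS]add0r bary_add !mxE.
split=> //; apply: contraT; rewrite negb_or => /andP[/negPn/eqP a0].
rewrite negb_exists => /forallP b0.
have := h (row i F); rewrite bary_row mxE !eqxx a0 add0r big1 => [/eqP|j _].
  by rewrite oner_eq0.
by have /negPn/eqP -> := b0 j; rewrite mulr0.
Qed.

Lemma continuous_bary i : continuous (fun x => bary F x ord0 i).
Proof.
have [al [be [h _]]] := bary_affine_form i.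
have -> : (fun x => bary F x ord0 i) = (fun x => al + \sum_j x ord0 j * be j) by exact/funext.
exact: continuous_affine_form.
Qed.

Lemma open_open_simplex : open (open_simplex F).
Proof.
rewrite openE => x /open_simplexP h.
have : \forall y \near x, forall i, 0 < bary F y ord0 i.
  apply: (@filter_forall _ _ _ (nbhs x)) => i.
  have hi : {for x, continuous (fun x => bary F x ord0 i)} := @continuous_bary i x.
  apply: (hi [set r | 0 < r]).
  by apply: open_nbhs_nbhs; split; [exact: open_gt|exact: h].
by apply: filterS => y hy; apply/open_simplexP.
Qed.

Lemma closed_subsimplexT : closed (subsimplex F [set: 'I_m.+1]).
Proof.
rewrite (_ : subsimplex F _ = \bigcap_(i in [set: 'I_m.+1])
    ((fun x => bary F x ord0 i) @^-1` [set r | 0 <= r])).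
  apply: closed_bigI => i _.
  by apply: closed_comp; [move=> x _; exact: continuous_bary|exact: closed_ge].
rewrite predeqE => x; rewrite subsimplexP; split => [[h _] i _|h]; first exact: h.
by split => i; [exact: h|rewrite inE].
Qed.

Definition barycenter : 'rV[R]_m := const_mx (m.+1%:R^-1) *m F.

Lemma bary_barycenter i : bary F barycenter ord0 i = m.+1%:R^-1.
Proof.
rewrite mul_bary ?mxE//; under eq_bigr do rewrite mxE.
by rewrite sumr_const card_ord -[_ *+ _]mulr_natr mulVf// pnatr_eq0.
Qed.

Lemma open_simplex_nonempty : open_simplex F !=set0.
Proof. by exists barycenter; rewrite open_simplexP => i; rewrite bary_barycenter invr_gt0 ltr0Sn. Qed.

End barycentric.

Lemma null_bigU (R : realType) d (T : measurableType d) (mu : {measure set T -> \bar R})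
    (I : Type) (r : seq I) (Z : I -> set T) :
  (forall i, measurable (Z i) /\ mu (Z i) = 0%E) -> mu (\big[setU/set0]_(i <- r) Z i) = 0%E.
Proof.
move=> h; elim: r => [|i r IH]; first by rewrite big_nil measure0.
rewrite big_cons measureU0 ?(h i).2//; first exact: (h i).1.
by elim: r {IH} => [|j r IH]; rewrite ?big_nil ?big_cons//; apply: measurableU => //; exact: (h j).1.
Qed.

Section closure.
Context {R : realType} {m : nat}.
Variable F : 'M[R]_(m.+1, m).
Hypothesis uF : edges F \in unitmx.

(** Points on the segment to the barycenter lie inside, so the closed simplex
    is the closure of the open one. *)
Lemma closure_open_simplex : closure (open_simplex F) = subsimplex F [set: 'I_m.+1].
Proof.
rewrite predeqE => x; split.
  have sub : open_simplex F `<=` subsimplex F [set: 'I_m.+1].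
    move=> y; rewrite open_simplexP// subsimplexP// => h; split=> i; first exact: ltW.
    by rewrite inE.
  by move/(closure_subset sub); rewrite -(closure_id _).1//; exact: closed_subsimplexT.
rewrite subsimplexP// => -[h _].
pose c := barycenter F.
suff : closure (open_simplex F) (x + (0 : R) *: (c - x)) by rewrite scale0r addr0.
pose y (r : R) := x + r *: (c - x).
have cy : continuous y.
  move=> r; rewrite /y.
  have h1 : {for r, continuous (fun r : R => r *: (c - x))}.
    exact: scalel_continuous.
  have := @continuousD _ _ _ (cst x) (fun r : R => r *: (c - x)) r (@cst_continuous _ _ x r) h1.
  exact.
move=> B nB; have /nbhs_ballP[e /= e0 eB] := cy 0 B nB.
pose r := Num.min (e / 2) 1.
have r0 : 0 < r by rewrite lt_min divr_gt0// ltr01.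
have r1 : r <= 1 by rewrite ge_min lexx orbT.
exists (y r); split; last first.
  apply: eB; rewrite /ball/= sub0r normrN gtr0_norm// gt_min.
  by rewrite ltr_pdivrMr// mulr2n mulrDr mulr1 ltrDl e0.
have gen (p q : 'rV[R]_m.+1) i : (p + r *: (q - p)) ord0 i = (1 - r) * p ord0 i + r * q ord0 i.
  by rewrite !mxE; ring.
apply/open_simplexP => // i; rewrite /y bary_add -scalemxAl -baryB gen bary_barycenter//.
by rewrite ltr_wpDl// ?mulr_ge0 ?subr_ge0// mulr_gt0// invr_gt0 ltr0Sn.
Qed.

(** The boundary lies in the zero sets of the barycentric coordinates, which are
    nonconstant affine forms. *)
Lemma null_simplex_boundary :
  rV_lebesgue m (closure (open_simplex F) `\` open_simplex F) = 0%E.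
Proof.
pose Z i := [set x | bary F x ord0 i = 0].
have mZ i : measurable (Z i).
  apply: closed_measurable_rV; apply: (@closed_comp _ _ (fun x => bary F x ord0 i) [set 0]).
    by move=> x _; exact: continuous_bary.
  exact: closed_eq.
apply: (@subset_measure0 _ _ _ _ _ (\big[setU/set0]_(i < m.+1) Z i)).
- apply: measurableD; [apply: closed_measurable_rV; exact: closed_closure|].
  by apply: open_measurable_rV; exact: open_open_simplex.
- by apply: bigsetU_measurable => i _.
- move=> x [+ nx]; rewrite closure_open_simplex subsimplexP// => -[h _].
  rewrite -bigcup_seq /=; apply: contrapT => hx; apply: nx; apply/open_simplexP => // i.
  rewrite lt_neqAle h andbT eq_sym; apply/eqP => b0; apply: hx; exists i => //=.
  by rewrite mem_index_enum.
apply: null_bigU => i; split=> //.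
have [al [be [h h0]]] := bary_affine_form uF i.
rewrite -(null_affine_form h0); congr (rV_lebesgue m _).
by rewrite predeqE => x /=; rewrite /Z /= h.
Qed.

End closure.

(** * Facets, normals and areas *)

Section facets.
Context {R : realType}.

Lemma dotE n (x y : 'rV[R]_n) : dot x y = (x *m y^T) ord0 ord0.
Proof. by rewrite mxE; apply: eq_bigr => i _; rewrite mxE. Qed.

Lemma dotC n (x y : 'rV[R]_n) : dot x y = dot y x.
Proof. by apply: eq_bigr => i _; rewrite mulrC. Qed.

Lemma dotDr n (x y z : 'rV[R]_n) : dot x (y + z) = dot x y + dot x z.
Proof. by rewrite -big_split; apply: eq_bigr => i _; rewrite mxE mulrDr. Qed.

Lemma dotZr n c (x y : 'rV[R]_n) : dot x (c *: y) = c * dot x y.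
Proof. by rewrite mulr_sumr; apply: eq_bigr => i _; rewrite mxE mulrCA. Qed.

Lemma dotNr n (x y : 'rV[R]_n) : dot x (- y) = - dot x y.
Proof. by rewrite -scaleN1r dotZr mulN1r. Qed.

Lemma dotDl n (x y z : 'rV[R]_n) : dot (y + z) x = dot y x + dot z x.
Proof. by rewrite ![dot _ x]dotC dotDr. Qed.

Lemma dotZl n c (x y : 'rV[R]_n) : dot (c *: y) x = c * dot y x.
Proof. by rewrite ![dot _ x]dotC dotZr. Qed.

Lemma dotNl n (x y : 'rV[R]_n) : dot (- y) x = - dot y x.
Proof. by rewrite ![dot _ x]dotC dotNr. Qed.

Lemma dot_ge0 n (x : 'rV[R]_n) : 0 <= dot x x.
Proof. by apply: sumr_ge0 => i _; rewrite -expr2 sqr_ge0. Qed.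

Lemma dot_eq0 n (x : 'rV[R]_n) : dot x x = 0 -> x = 0.
Proof.
move=> x0; apply/rowP => i; rewrite mxE.
have h : forall i : 'I_n, true -> x ord0 i * x ord0 i = 0.
  by apply/psumr_eq0P; [move=> j _; rewrite -expr2 sqr_ge0|exact: x0].
by apply/eqP; have /eqP := h i isT; rewrite mulf_eq0 orbb.
Qed.

Lemma enorm_sqr n (x : 'rV[R]_n) : enorm x ^+ 2 = dot x x.
Proof. by rewrite sqr_sqrtr// dot_ge0. Qed.

Lemma enorm_ge0 n (x : 'rV[R]_n) : 0 <= enorm x.
Proof. exact: sqrtr_ge0. Qed.

Definition bary_grad m (F : 'M[R]_(m.+1, m)) (a : 'I_m.+1) : 'rV[R]_m := (col a (baryD F))^T.

Lemma dot_bary_grad m (F : 'M[R]_(m.+1, m)) a v : dot v (bary_grad F a) = (v *m baryD F) ord0 a.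
Proof. by rewrite mxE; apply: eq_bigr => j _; rewrite !mxE. Qed.

Lemma bary_grad_row m (F : 'M[R]_(m.+1, m)) (uF : edges F \in unitmx) a b c :
  dot (bary_grad F a) (row b F - row c F) = (a == b)%:R - (a == c)%:R.
Proof. by rewrite dotC dot_bary_grad baryD_rowB. Qed.

Lemma bary_shift m (F : 'M[R]_(m.+1, m)) a x v :
  bary F (x + v) ord0 a = bary F x ord0 a + dot v (bary_grad F a).
Proof. by rewrite bary_add mxE dot_bary_grad. Qed.

Variable d : nat.
Implicit Type F : 'M[R]_(d.+2, d.+1).

Lemma bary_grad_neq0 F a : edges F \in unitmx -> bary_grad F a != 0.
Proof.
move=> uF; have [b ab] : exists b, b != a.
  by exists (lift a ord0); rewrite eq_sym neq_lift.
apply/eqP => g0; have := bary_grad_row uF a a b.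
rewrite g0 eqxx eq_sym (negbTE ab) subr0 /dot big1; last by move=> i _; rewrite mxE mul0r.
by move=> /esym/eqP; rewrite oner_eq0.
Qed.

Lemma enorm_gt0 n (x : 'rV[R]_n) : (0 < enorm x) = (x != 0).
Proof.
rewrite lt_neqAle enorm_ge0 andbT eq_sym; congr (~~ _); apply/eqP/eqP => [e0|->].
  by apply: dot_eq0; rewrite -enorm_sqr e0 expr0n.
by rewrite /enorm /dot big1 ?sqrtr0// => i _; rewrite mxE mul0r.
Qed.

Lemma edges_spanP m (F : 'M[R]_(m.+1, m)) (uF : edges F \in unitmx) (v : 'rV[R]_m) a :
  (forall b, dot v (row a F - row b F) = 0) -> v = 0.
Proof.
move=> h.
have : edges F *m v^T = 0.
  apply/matrixP => i j; rewrite ord1 [RHS]mxE.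
  have -> : (edges F *m v^T) i 0 = dot v (row (lift ord0 i) F - row ord0 F).
    by rewrite mxE; apply: eq_bigr => k _; rewrite !mxE mulrC.
  rewrite (_ : row (lift ord0 i) F - row ord0 F = (row a F - row ord0 F) - (row a F - row (lift ord0 i) F)).
    by rewrite dotDr dotNr !h subrr.
  by apply/rowP => k; rewrite !mxE; ring.
move=> /(congr1 (mulmx (invmx (edges F)))); rewrite mulKmx// mulmx0 => /(congr1 trmx).
by rewrite trmxK trmx0.
Qed.

(** A vector orthogonal to a facet is determined by its product with one edge
    that leaves the facet. *)
Lemma normal_unique F a nu : edges F \in unitmx ->
  (forall b c, b != a -> c != a -> dot nu (row b F - row c F) = 0) ->
  exists al, nu = al *: bary_grad F a.
Proof.
move=> uF no.
exists (dot nu (row a F - row (lift a ord0) F)).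
apply/eqP; rewrite -subr_eq0; apply/eqP; apply: (edges_spanP uF (a := a)) => b.
have [->|ba] := eqVneq b a.
  by rewrite subrr /dot big1// => i _; rewrite [X in _ * X]mxE mulr0.
rewrite dotDl dotNl dotZl bary_grad_row// eqxx eq_sym (negbTE ba) subr0 mulr1.
rewrite -dotNr -dotDr opprB.
have -> : row a F - row b F + (row (lift a ord0) F - row a F) = row (lift a ord0) F - row b F.
  by apply/rowP => k; rewrite !mxE; ring.
by apply: no => //; rewrite eq_sym neq_lift.
Qed.

(** The barycentric coordinate of a increases towards a and is constant along
    the opposite facet, so its gradient is the inner normal direction. *)
Lemma outer_normalE F a : edges F \in unitmx ->
  outer_normal F a = - (enorm (bary_grad F a))^-1 *: bary_grad F a.
Proof.
move=> uF; set g := bary_grad F a.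
have g0 : 0 < enorm g by rewrite enorm_gt0 bary_grad_neq0.
rewrite /outer_normal; case: xgetP => [nu _ [n1 no ni]|/(_ (- (enorm g)^-1 *: g))]; last first.
  case; split.
  - apply/eqP; rewrite -(@pexpr_eq1 _ _ 2) ?enorm_ge0// enorm_sqr dotZl dotZr mulrA mulrNN -expr2 -enorm_sqr.
    by rewrite -exprMn mulVf ?expr1n// gt_eqF.
  - move=> b c ba ca; rewrite dotZl bary_grad_row// eq_sym (negbTE ba) eq_sym (negbTE ca) subrr mulr0//.
  - move=> b ba; rewrite dotZl bary_grad_row// eqxx eq_sym (negbTE ba) subr0 mulr1.
    by rewrite oppr_lt0 invr_gt0.
have [al nuE] := normal_unique uF no.
have al0 : al < 0.
  have := ni (lift a ord0); rewrite eq_sym neq_lift nuE dotZl bary_grad_row// eqxx.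
  by rewrite (negbTE (neq_lift _ _)) subr0 mulr1; exact.
rewrite nuE; congr (_ *: _); have : al ^+ 2 * enorm g ^+ 2 = 1.
  by rewrite enorm_sqr expr2 -mulrA -dotZr -dotZl -nuE -enorm_sqr n1 expr1n.
rewrite -exprMn => /eqP; rewrite sqrf_eq1 => /orP[/eqP h|/eqP h].
  by have := mulr_gt0 (_ : 0 < - al) g0; rewrite oppr_gt0 mulNr h => /(_ al0); rewrite oppr_gt0 ltr10.
by apply: (mulIf (negbT (gt_eqF g0))); rewrite h mulNr mulVf// gt_eqF.
Qed.

(** This is d! times the area of the facet; the reference simplex, over which
    surface integrals are taken, has the volume 1 / d!. *)
Definition facet_area F a := Num.sqrt (gram (facet F a)).

Lemma bary_row_perm m (s : 'S_m.+1) (F : 'M[R]_(m.+1, m)) x : edges F \in unitmx ->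
  bary (row_perm s F) x = col_perm s (bary F x).
Proof.
move=> uF.
have e : col_perm s (bary F x) *m row_perm s F = x.
  by rewrite col_permE row_permE -mulmxA (mulmxA (perm_mx _)) -perm_mxM mulVg perm_mx1 mul1mx bary_mul.
rewrite -{1}e mul_bary ?edges_row_perm_unit//.
rewrite -(bary_sum F x) [RHS](reindex_inj (@perm_inj _ s))/=.
by apply: eq_bigr => i _; rewrite mxE.
Qed.

Lemma open_simplex_row_perm m (s : 'S_m.+1) (F : 'M[R]_(m.+1, m)) : edges F \in unitmx ->
  open_simplex (row_perm s F) = open_simplex F.
Proof.
move=> uF; rewrite predeqE => x.
rewrite !open_simplexP ?edges_row_perm_unit// bary_row_perm//; split=> h i.
  by have := h (s^-1%g i); rewrite mxE permKV.
by rewrite mxE.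
Qed.

Lemma bary_grad_row_perm m (s : 'S_m.+1) (F : 'M[R]_(m.+1, m)) i : edges F \in unitmx ->
  bary_grad (row_perm s F) i = bary_grad F (s i).
Proof.
move=> uF; apply/rowP => k.
have h G : bary_grad G i ord0 k = ((delta_mx ord0 k : 'rV[R]_m) *m baryD G) ord0 i.
  by rewrite -rowE !mxE.
rewrite h.
have -> : bary_grad F (s i) ord0 k = ((delta_mx ord0 k : 'rV[R]_m) *m baryD F) ord0 (s i) by rewrite -rowE !mxE.
have hb G j : ((delta_mx ord0 k : 'rV[R]_m) *m baryD G) ord0 j = (bary G (0 + delta_mx ord0 k) - bary G 0) ord0 j.
  by rewrite bary_add addrC addKr.
rewrite !hb !bary_row_perm//.
by move: (bary F _) (bary F 0) => p q; rewrite !mxE.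
Qed.

Definition one_ord : 'I_d.+2 := lift ord0 ord0.

(** The vertex a becomes number 1 and not 0: the edges start at the vertex 0, so
    those of the facet opposite to 1 are edges of the simplex. *)
Definition facet_perm (a : 'I_d.+2) : 'S_d.+2 := lift_perm one_ord a 1.

Lemma facet_perm_one a : facet_perm a one_ord = a.
Proof. exact: lift_perm_id. Qed.

Lemma facet_facet_perm F a : facet (row_perm (facet_perm a) F) one_ord = facet F a.
Proof. by apply/matrixP => i j; rewrite !mxE lift_perm_lift perm1. Qed.

(** Both sides are cofactor expressions in the Gram matrix of all edges: the
    facet has the corner minor, and the gradient is dual to the edges. *)
Lemma facet_area_one F : edges F \in unitmx ->
  facet_area F one_ord = `|\det (edges F)| * enorm (bary_grad F one_ord).
Proof.
move=> uF; set E := edges F; set nu := bary_grad F one_ord.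
pose H := E *m E^T.
have uH : H \in unitmx by rewrite unitmx_mul unitmx_tr uF.
have Enu : E *m nu^T = delta_mx ord0 ord0.
  apply/matrixP => i j; rewrite ord1.
  have -> : (E *m nu^T) i 0 = dot nu (row (lift ord0 i) F - row ord0 F).
    by rewrite mxE; apply: eq_bigr => k _; rewrite !mxE mulrC.
  rewrite bary_grad_row// mxE eqxx andbT [one_ord == ord0](_ : _ = false) ?subr0//.
  by rewrite /one_ord (inj_eq (@lift_inj _ _)) eq_sym.
have nuE : nu^T = invmx E *m delta_mx ord0 ord0 by rewrite -Enu mulKmx.
have HV : invmx H = (invmx E)^T *m invmx E.
  rewrite -[RHS](mulKmx uH) [X in _ = _ *m X](_ : _ = 1%:M) ?mulmx1//.
  by rewrite /H -!mulmxA (mulmxA E^T) -trmx_mul mulVmx// trmx1 mul1mx mulmxV.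
have cofH : cofactor H ord0 ord0 = gram (facet F one_ord).
  rewrite /cofactor addn0 expr0 mul1r /gram; congr (\det _).
  have -> : edges (facet F one_ord) = row' ord0 E.
    apply/matrixP => i j; rewrite !mxE; congr (F _ _ - F _ _); apply/ord_inj => //=.
  by apply/matrixP => i j; rewrite !mxE; apply: eq_bigr => k _; rewrite !mxE.
have n2 : enorm nu ^+ 2 = (\det H)^-1 * gram (facet F one_ord).
  have nuT : nu = (invmx E *m delta_mx ord0 ord0)^T by rewrite -nuE trmxK.
  rewrite enorm_sqr nuT dotE trmxK trmx_mul -mulmxA (mulmxA (invmx E)^T) -HV trmx_delta.
  by rewrite -colE -rowE mxE mxE /invmx uH mxE [X in _ * X]mxE cofH.
have dH : \det H = \det E ^+ 2 by rewrite det_mulmx det_tr expr2.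
have H0 : \det H != 0 by rewrite -unitfE -unitmxE.
rewrite /facet_area (_ : gram _ = (\det E * enorm nu) ^+ 2); last first.
  by rewrite exprMn n2 -dH mulVKf.
by rewrite sqrtr_sqr normrM (ger0_norm (enorm_ge0 _)).
Qed.

Lemma facet_areaE F a : edges F \in unitmx ->
  facet_area F a = `|\det (edges F)| * enorm (bary_grad F a).
Proof.
move=> uF; have := @facet_area_one (row_perm (facet_perm a) F).
rewrite edges_row_perm_unit det_edges_row_perm bary_grad_row_perm// facet_perm_one.
by rewrite /facet_area facet_facet_perm; exact.
Qed.

(** This is the vector surface element: it turns the gradients of barycentric
    coordinates into the area-weighted normals. *)
Lemma facet_area_normal F a : edges F \in unitmx ->
  facet_area F a *: outer_normal F a = - (`|\det (edges F)|) *: bary_grad F a.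
Proof.
move=> uF; rewrite outer_normalE// facet_areaE// scalerA mulrN mulfK//.
by rewrite gt_eqF// enorm_gt0 bary_grad_neq0.
Qed.

Lemma enorm_outer_normal F a : edges F \in unitmx -> enorm (outer_normal F a) = 1.
Proof.
move=> uF; have g0 : 0 < enorm (bary_grad F a) by rewrite enorm_gt0 bary_grad_neq0.
apply/eqP; rewrite -(@pexpr_eq1 _ _ 2) ?enorm_ge0// enorm_sqr outer_normalE// dotZl dotZr mulrA mulrNN -expr2 -enorm_sqr.
by rewrite -exprMn mulVf ?expr1n// gt_eqF.
Qed.

Lemma gram_facet_gt0 F a : edges F \in unitmx -> 0 < facet_area F a.
Proof.
move=> uF; rewrite facet_areaE// mulr_gt0 ?enorm_gt0 ?bary_grad_neq0// normr_gt0.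
by rewrite -unitfE -unitmxE.
Qed.

Lemma vertex_inj m (F : 'M[R]_(m.+1, m)) : edges F \in unitmx -> injective (fun b => row b F).
Proof.
move=> uF b c /(congr1 (bary F)); rewrite !bary_row// => /rowP/(_ b).
by rewrite !mxE eqxx /=; case: eqP => // _ /eqP; rewrite oner_eq0.
Qed.

Lemma bary_convex m (F : 'M[R]_(m.+1, m)) n (G : 'M[R]_(n.+1, m)) (w : 'rV[R]_n.+1) v :
  edges F \in unitmx -> \sum_i w ord0 i = 1 ->
  bary F (w *m G) ord0 v = \sum_c w ord0 c * bary F (row c G) ord0 v.
Proof.
move=> uF w1.
have -> : w *m G = (w *m \matrix_(c, j) bary F (row c G) ord0 j) *m F.
  rewrite -mulmxA; congr (_ *m _); apply/row_matrixP => c; rewrite row_mul.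
  rewrite (_ : row c (\matrix_(_, _) _) = bary F (row c G)) ?bary_mul//.
  by apply/rowP => j; rewrite [LHS]mxE [LHS]mxE.
rewrite mul_bary//.
  by rewrite [LHS]mxE; apply: eq_bigr => c _; congr (_ * _); rewrite [LHS]mxE.
rewrite -w1; under eq_bigr do rewrite mxE.
rewrite exchange_big /=; apply: eq_bigr => c _; rewrite -mulr_sumr.
under eq_bigr do rewrite mxE.
by rewrite bary_sum mulr1.
Qed.

(** Vertices are extreme points, so a subsimplex determines its vertices. *)
Lemma subsimplex_vertex m (F G : 'M[R]_(m.+1, m)) (S S' : {set 'I_m.+1}) v :
  edges F \in unitmx -> edges G \in unitmx ->
  subsimplex F S = subsimplex G S' -> v \in S ->
  exists2 v', v' \in S' & row v F = row v' G.
Proof.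
move=> uF uG e vS.
have xS : subsimplex F S (row v F).
  apply/subsimplexP => //; rewrite bary_row//; split=> i; rewrite mxE eqxx /= ?ler0n//.
  by case: eqVneq => [->|//]; rewrite vS.
have := xS; rewrite e => /(subsimplexP uG)[w0 wS].
set w := bary G _ in w0 wS.
have wx : w *m G = row v F by rewrite bary_mul.
have w1 : \sum_i w ord0 i = 1 by exact: bary_sum.
have cS c : c \in S' -> subsimplex F S (row c G).
  move=> cS; rewrite e; apply/subsimplexP => //; rewrite bary_row//; split=> i; rewrite mxE eqxx /= ?ler0n//.
  by case: eqVneq => [->|//]; rewrite cS.
have le1 c : c \in S' -> bary F (row c G) ord0 v <= 1.
  move=> /cS/(subsimplexP uF)[b0 _]; rewrite -(bary_sum F (row c G)) (bigD1 v)//= lerDl.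
  by apply: sumr_ge0 => i _; exact: b0.
have h1 : \sum_c w ord0 c * (1 - bary F (row c G) ord0 v) = 0.
  under eq_bigr do rewrite mulrBr mulr1.
  by rewrite sumrB w1 -bary_convex// wx bary_row// mxE !eqxx subrr.
have pos c : 0 <= w ord0 c * (1 - bary F (row c G) ord0 v).
  have [cS'|cS'] := boolP (c \in S'); last by rewrite wS// mul0r.
  by rewrite mulr_ge0// subr_ge0 le1.
have [c wc] : exists c, w ord0 c != 0.
  apply/existsP; apply: contraT; rewrite negb_exists => /forallP h.
  move: w1; rewrite big1 => [/eqP|i _]; first by rewrite eq_sym oner_eq0.
  by apply/eqP; have := h i; rewrite negbK.
have cS' : c \in S' by apply: contraNT wc => /wS ->.
exists c => //.
have : w ord0 c * (1 - bary F (row c G) ord0 v) = 0.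
  by move/psumr_eq0P: h1 => ->.
move/eqP; rewrite mulf_eq0 (negbTE wc) /= subr_eq0 => /eqP b1.
rewrite -(bary_mul uF (row c G)) -(bary_mul uF (row v F)); congr (_ *m _).
rewrite bary_row//; have /(subsimplexP uF)[b0 _] := cS c cS'.
have bs := bary_sum F (row c G).
apply/rowP => i; rewrite mxE eqxx /=.
have [->|iv] := eqVneq i v; first by rewrite -b1.
have : \sum_(j | j != v) bary F (row c G) ord0 j = 0.
  have := bs; rewrite (bigD1 v)//= -b1 => /eqP; rewrite -subr_eq0 addrAC subrr add0r.
  by move/eqP.
by move/psumr_eq0P => -> //.
Qed.

End facets.

(** * Differential calculus on R^n *)

Section directional.
Context {R : realType}.

(** Both derivatives are limits of the same difference quotient. *)
Lemma derive_along (U V W : normedModType R) (a : U -> V) (f : V -> W) x w v :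
  (forall h : R, a (h *: w + x) = h *: v + a x) ->
  'D_w (f \o a) x = 'D_v f (a x) /\ (derivable f (a x) v -> derivable (f \o a) x w).
Proof.
move=> e.
have E : (fun h : R => h^-1 *: (((f \o a) \o shift x) (h *: w) - (f \o a) x)) =
         (fun h : R => h^-1 *: ((f \o shift (a x)) (h *: v) - f (a x))).
  by apply/funext => h /=; rewrite e.
by rewrite /derive /derivable E.
Qed.

Lemma line_is_derive (V : normedModType R) (f : V -> R) (z v : V) (s : R) :
  derivable f (z + s *: v) v ->
  is_derive s 1 (fun s => f (z + s *: v)) ('D_v f (z + s *: v)).
Proof.
move=> df; have [|e h] := @derive_along _ _ _ (fun s : R => z + s *: v) f s 1 v.
  by move=> h; rewrite scalerDl addrCA -[h *: 1]/(h * 1) mulr1.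
by apply: DeriveDef; [exact: h|exact: e].
Qed.

Fixpoint Ck n (k : nat) (f : 'rV[R]_n -> R) : Prop :=
  if k is k'.+1 then
    continuous f /\ forall v, (forall x, derivable f x v) /\ Ck k' ('D_v f)
  else continuous f.

Lemma CkS n k (f : 'rV[R]_n -> R) : Ck k.+1 f -> Ck k f.
Proof.
elim: k f => [|k IH] f; first by case.
by move=> [cf df]; split=> // v; have [h1 h2] := df v; split=> //; exact: IH.
Qed.

Lemma Ck_cst n k (c : R) : Ck k (fun _ : 'rV[R]_n => c).
Proof.
have cc : continuous (fun _ : 'rV[R]_n => c) by move=> x; exact: cst_continuous.
elim: k c cc => [//|k IH] c cc; split=> // v; split=> [x|]; first exact: derivable_cst.
rewrite (_ : 'D_v _ = (fun=> 0)); last by apply/funext => x; exact: derive_cst.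
by apply: IH => x; exact: cst_continuous.
Qed.

Lemma CkD n k (f g : 'rV[R]_n -> R) : Ck k f -> Ck k g -> Ck k (fun x => f x + g x).
Proof.
elim: k f g => [|k IH] f g; first by move=> cf cg x; exact: (continuousD (cf x) (cg x)).
move=> [cf df] [cg dg]; split=> [x|v]; first exact: (continuousD (cf x) (cg x)).
have [df1 df2] := df v; have [dg1 dg2] := dg v; split=> [x|]; first exact: derivableD.
rewrite (_ : 'D_v _ = (fun x => 'D_v f x + 'D_v g x)); first exact: IH.
by apply/funext => x; rewrite -deriveD.
Qed.

Lemma CkM n k (f g : 'rV[R]_n -> R) : Ck k f -> Ck k g -> Ck k (fun x => f x * g x).
Proof.
elim: k f g => [|k IH] f g; first by move=> cf cg x; exact: (continuousM (cf x) (cg x)).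
move=> [cf df] [cg dg]; split=> [x|v]; first exact: (continuousM (cf x) (cg x)).
have [df1 df2] := df v; have [dg1 dg2] := dg v; split=> [x|]; first exact: derivableM.
rewrite (_ : 'D_v _ = (fun x => f x * 'D_v g x + g x * 'D_v f x)).
  by apply: CkD; apply: IH => //; apply: CkS; split.
by apply/funext => x; exact: (deriveM (df1 x) (dg1 x)).
Qed.

Lemma CkN n k (f : 'rV[R]_n -> R) : Ck k f -> Ck k (fun x => - f x).
Proof.
move=> h; have := CkM (@Ck_cst n k (-1)) h.
by rewrite (_ : (fun x => -1 * f x) = (fun x => - f x)) //; apply/funext => x; rewrite mulN1r.
Qed.

Lemma Ck_sum n k (I : Type) (r : seq I) (P : pred I) (f : I -> 'rV[R]_n -> R) :
  (forall i, Ck k (f i)) -> Ck k (fun x => \sum_(i <- r | P i) f i x).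
Proof.
move=> h; elim: r => [|i r IH].
  by rewrite (_ : (fun x => _) = (fun=> 0)); [exact: Ck_cst|apply/funext => x; rewrite big_nil].
case Pi : (P i).
  rewrite (_ : (fun x => _) = (fun x => f i x + \sum_(i <- r | P i) f i x)); first exact: CkD.
  by apply/funext => x; rewrite big_cons Pi.
rewrite (_ : (fun x => _) = (fun x => \sum_(i <- r | P i) f i x)) //.
by apply/funext => x; rewrite big_cons Pi.
Qed.

Lemma Ck_prod n k (I : Type) (r : seq I) (P : pred I) (f : I -> 'rV[R]_n -> R) :
  (forall i, Ck k (f i)) -> Ck k (fun x => \prod_(i <- r | P i) f i x).
Proof.
move=> h; elim: r => [|i r IH].
  by rewrite (_ : (fun x => _) = (fun=> 1)); [exact: Ck_cst|apply/funext => x; rewrite big_nil].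
case Pi : (P i).
  rewrite (_ : (fun x => _) = (fun x => f i x * \prod_(i <- r | P i) f i x)); first exact: CkM.
  by apply/funext => x; rewrite big_cons Pi.
rewrite (_ : (fun x => _) = (fun x => \prod_(i <- r | P i) f i x)) //.
by apply/funext => x; rewrite big_cons Pi.
Qed.

Lemma derive_coord n (x v : 'rV[R]_n) i :
  derivable (fun y : 'rV[R]_n => y ord0 i) x v /\ 'D_v (fun y : 'rV[R]_n => y ord0 i) x = v ord0 i.
Proof.
have E : (fun h : R => h^-1 *: (((fun y : 'rV[R]_n => y ord0 i) \o shift x) (h *: v) - x ord0 i))
    @ 0^' --> v ord0 i.
  apply: cvg_near_cst.
  near=> h; rewrite /= !mxE addrK -[_ *: _]/(_ * _) mulKf//.
  by near: h; exact: nbhs_dnbhs_neq.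
split; first by apply/cvg_ex; exists (v ord0 i).
by apply/cvg_lim => //.
Unshelve. all: by end_near.
Qed.

Lemma Ck_coord n k i : Ck k (fun x : 'rV[R]_n => x ord0 i).
Proof.
have cc : continuous (fun x : 'rV[R]_n => x ord0 i) by move=> x; exact: coord_continuous.
case: k => [//|k]; split=> // v; split=> [x|]; first exact: (derive_coord x v i).1.
rewrite (_ : 'D_v _ = (fun=> v ord0 i)); first exact: Ck_cst.
by apply/funext => x; exact: (derive_coord x v i).2.
Qed.

Lemma Ck_polyfun n k m (p : 'rV[R]_n -> R) : polyfun m p -> Ck k p.
Proof.
move=> [c pE]; rewrite (_ : p = (fun x => \sum_(al : {ffun 'I_n -> 'I_m.+1} | (\sum_i al i <= m)%N)
            c al * \prod_i x ord0 i ^+ al i)); last exact/funext.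
apply: Ck_sum => al; apply: CkM; first exact: Ck_cst.
apply: Ck_prod => i; elim: (nat_of_ord (al i)) => [|e IH].
  by rewrite (_ : (fun x => _) = (fun=> 1)); [exact: Ck_cst|apply/funext => x; rewrite expr0].
rewrite (_ : (fun x => _) = (fun x : 'rV[R]_n => x ord0 i * x ord0 i ^+ e)).
  by apply: CkM => //; exact: Ck_coord.
by apply/funext => x; rewrite exprS.
Qed.

(** Telescope along the coordinates: each increment is, by the mean value
    theorem, a partial derivative at a nearby point. *)
Lemma C1_increment n (f : 'rV[R]_n -> R) (x : 'rV[R]_n) (e : R) : Ck 1 f -> 0 < e ->
  \forall h \near (0 : 'rV[R]_n),
   `|f (x + h) - f x - \sum_i h ord0 i * 'D_(delta_mx ord0 i) f x| <= e * `|h|.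
Proof.
move=> [cf df] e0.
have n0 : 0 < n.+1%:R :> R by rewrite ltr0Sn.
have : \forall y \near x, forall i, `|'D_(delta_mx ord0 i) f x - 'D_(delta_mx ord0 i) f y| <= e / n.+1%:R.
  apply: (@filter_forall _ _ _ (nbhs x)) => i.
  have c := (df (delta_mx ord0 i)).2 x.
  have /cvgrPdist_le := c; apply; exact: divr_gt0.
move=> /nbhs_ballP[r /= r0 rB].
near=> h.
pose t k : 'rV[R]_n := \row_i (if (i < k)%N then h ord0 i else 0).
have hr : `|h| < r by near: h; apply/nbhs_ballP; exists r => // y; rewrite mx_norm_ball /ball_/= sub0r normrN.
have hle (i : 'I_n) : `|h ord0 i| <= `|h|.
  rewrite [leRHS]/Num.Def.normr /= mx_normrE.
  by apply: (le_bigmax_cond _ (fun ij => `|h ij.1 ij.2|) (j := (ord0, i))).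
have tn : t n = h by apply/rowP => i; rewrite mxE ltn_ord.
have t0 : t 0%N = 0 by apply/rowP => i; rewrite !mxE.
have tS (i : 'I_n) : t i.+1 = t i + h ord0 i *: delta_mx ord0 i.
  apply/rowP => j; rewrite !mxE ltnS eqxx /=; case: (ltngtP j i) => ij.
  - by rewrite (_ : (j == i) = false) ?mulr0 ?addr0//; apply/eqP => ji; rewrite ji ltnn in ij.
  - by rewrite (_ : (j == i) = false) ?mulr0 ?addr0//; apply/eqP => ji; rewrite ji ltnn in ij.
  - by rewrite (_ : j = i) ?eqxx ?mulr1 ?add0r//; exact: val_inj.
have tel : f (x + h) - f x = \sum_(i < n) (f (x + t i.+1) - f (x + t i)).
  rewrite -(big_mkord xpredT (fun k => f (x + t k.+1) - f (x + t k))).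
  by rewrite telescope_sumr// tn t0 addr0.
rewrite tel -sumrB; apply: le_trans (ler_norm_sum _ _ _) _.
apply: (@le_trans _ _ (\sum_(i < n) e / n.+1%:R * `|h|)); last first.
  rewrite sumr_const card_ord -[_ *+ n]mulr_natr [leLHS](_ : _ = e * `|h| * (n%:R / n.+1%:R)); last first.
    by rewrite -!mulrA; congr (_ * _); rewrite mulrC -mulrA.
  rewrite ler_piMr//; first by rewrite mulr_ge0// ltW.
  by rewrite ler_pdivrMr// mul1r ler_nat.
apply: ler_sum => i _; rewrite tS addrA; set z := x + t i.
pose a : R := h ord0 i; pose v : 'rV[R]_n := delta_mx ord0 i.
pose g (s : R) : R := f (z + (s * a) *: v).
pose dg (s : R) : R := 'D_v f (z + (s * a) *: v) * a.
have gd (s : R) : is_derive s 1 g (dg s).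
  have h1 : is_derive (s * a) 1 (fun s => f (z + s *: v)) ('D_v f (z + (s * a) *: v)).
    by apply: line_is_derive; exact: (df v).1.
  have h2 : is_derive s 1 (fun s : R => s * a) a.
    have [|e1 e2] := @derive_along _ _ _ (fun s : R => s * a) (id : R -> R) s 1 a.
      by move=> k; rewrite -![_ *: _]/(_ * _) mulr1 mulrDl.
    apply: DeriveDef; first by apply: e2; exact: derivable_id.
    by rewrite e1 derive_id.
  have h3 := @is_derive1_comp R (fun s : R => f (z + s *: v)) (fun s : R => s * a) s _ _ h1 h2.
  exact: h3.
have gc : {within `[0, 1], continuous g}.
  by apply: derivable_within_continuous => s _; exact: (@ex_derive _ _ _ _ _ _ _ (gd s)).
have [c] := MVT_segment ler01 (fun s _ => gd s) gc.
rewrite in_itv/= => /andP[c0 c1]; rewrite subr0 mulr1 /g mul1r mul0r scale0r addr0 => ->.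
have -> : dg c - h ord0 i * 'D_(delta_mx ord0 i) f x = ('D_v f (z + (c * a) *: v) - 'D_v f x) * a.
  by rewrite /dg -/v mulrBl; congr (_ - _); rewrite mulrC.
rewrite normrM distrC.
apply: ler_pM => //; last exact: hle.
suff /rB : ball x r (z + (c * a) *: v) by apply.
split=> // i' j; rewrite ord1 /ball/= !mxE eqxx /=.
rewrite opprD addrA opprD addrA subrr add0r -opprD normrN.
apply: le_lt_trans hr.
case: (ltngtP j i) => ij.
- rewrite (_ : (j == i) = false) ?mulr0 ?addr0//; apply/eqP => ji; by rewrite ji ltnn in ij.
- rewrite (_ : (j == i) = false) ?mulr0 ?addr0 ?normr0//; apply/eqP => ji; by rewrite ji ltnn in ij.
- rewrite (_ : j = i) ?eqxx ?mulr1 ?add0r; last exact: val_inj.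
  rewrite normrM ger0_norm// (le_trans (_ : _ <= 1 * `|a|))//; first by rewrite ler_wpM2r.
  by rewrite mul1r hle.
Unshelve. all: by end_near.
Qed.

Lemma cvg_rV (T : Type) n (F : set_system T) {FF : Filter F} (f : T -> 'rV[R]_n) (l : 'rV[R]_n) :
  (forall i, f x ord0 i @[x --> F] --> l ord0 i) -> f @ F --> l.
Proof.
move=> h; apply/cvgrPdist_lt => e e0.
have : \forall y \near F, forall i, `|l ord0 i - f y ord0 i| < e.
  by apply: filter_forall => i; have /cvgrPdist_lt := h i; exact.
apply: filterS => y hy.
have : ball l e (f y) by split => // i j; rewrite (ord1 i); exact: hy.
by rewrite mx_norm_ball.
Qed.

Lemma cvg_sumr (T I : Type) (F : set_system T) {FF : Filter F} (r : seq I) (f : I -> T -> R) (l : I -> R) :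
  (forall i, f i x @[x --> F] --> l i) -> \sum_(i <- r) f i x @[x --> F] --> \sum_(i <- r) l i.
Proof.
move=> h; elim: r => [|i r IH].
  rewrite big_nil (_ : (fun x => _) = cst 0); first exact: cvg_cst.
  by apply/funext => x; rewrite big_nil.
rewrite big_cons (_ : (fun x => _) = f i \+ (fun x => \sum_(i <- r) f i x)).
  exact: cvgD.
by apply/funext => x; rewrite big_cons.
Qed.

(** The remainder in C1_increment is small against the increment of y, which is
    of the order of the step along v. *)
Lemma C1_chain (V : normedModType R) n (H : 'rV[R]_n -> R) (y : V -> 'rV[R]_n) x v :
  Ck 1 H -> (forall i, derivable (fun z => y z ord0 i) x v) ->
  derivable (H \o y) x v /\
  'D_v (H \o y) x = \sum_i 'D_v (fun z => y z ord0 i) x * 'D_(delta_mx ord0 i) H (y x).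
Proof.
move=> H1 dy; set l := \sum_i _.
pose w : 'rV[R]_n := \row_i 'D_v (fun z => y z ord0 i) x.
pose k h := y (h *: v + x) - y x.
have kwi i : (h^-1 *: k h) ord0 i @[h --> 0^'] --> w ord0 i.
  rewrite mxE; have /cvg_ex[l' hl'] := dy i.
  have := hl'; rewrite -(cvg_lim _ hl')// => hl2.
  rewrite (_ : (fun h : R => _) = (fun h : R => h^-1 *: (((fun z => y z ord0 i) \o shift x) (h *: v) - y x ord0 i))).
    exact: hl2.
  by apply/funext => h; rewrite !mxE.
have kw : (fun h : R => h^-1 *: k h) @ 0^' --> w by apply: cvg_rV => i; exact: kwi.
have k0 : k @ 0^' --> (0 : 'rV[R]_n).
  have h1 : (fun h : R => h *: (h^-1 *: k h)) @ 0^' --> (0 *: w : 'rV[R]_n).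
    by apply: cvgZ => //; exact: cvg_within.
  rewrite scale0r in h1; apply: cvg_trans h1; apply: near_eq_cvg.
  near=> h; rewrite scalerA divff ?scale1r//.
  by near: h; exact: nbhs_dnbhs_neq.
suff lim : (fun h : R => h^-1 *: (((H \o y) \o shift x) (h *: v) - (H \o y) x)) @ 0^' --> l.
  by split; [apply/cvg_ex; exists l|exact: cvg_lim lim].
pose S (h : R) := \sum_i (h^-1 *: k h) ord0 i * 'D_(delta_mx ord0 i) H (y x).
have Sl : S @ 0^' --> l.
  rewrite (_ : l = \sum_i w ord0 i * 'D_(delta_mx ord0 i) H (y x)); last first.
    by apply: eq_bigr => i _; rewrite mxE.
  have cs := @cvg_sumr R 'I_n (0^') _ (index_enum 'I_n) (fun i h => (h^-1 *: k h) ord0 i * 'D_(delta_mx ord0 i) H (y x))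
     (fun i => w ord0 i * 'D_(delta_mx ord0 i) H (y x)).
  apply: cs => i.
  by have h := @cvgMr_tmp R _ _ _ _ _ ('D_(delta_mx ord0 i) H (y x)) (kwi i); exact: h.
pose rem (h : R) := h^-1 * (H (y x + k h) - H (y x) - \sum_i k h ord0 i * 'D_(delta_mx ord0 i) H (y x)).
have rem0 : rem @ 0^' --> (0 : R).
  apply/cvgrPdist_le => e e0.
  have w0 : 0 < `|w| + 1 by rewrite ltr_wpDl.
  have e'0 : 0 < e / (`|w| + 1) by rewrite divr_gt0.
  have inc := k0 _ (@C1_increment _ H (y x) _ H1 e'0).
  near=> h.
  rewrite sub0r normrN normrM normfV.
  have hn0 : h != 0 by near: h; exact: nbhs_dnbhs_neq.
  have : `|H (y x + k h) - H (y x) - \sum_i k h ord0 i * 'D_(delta_mx ord0 i) H (y x)| <= e / (`|w| + 1) * `|k h|.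
    by near: h; exact: inc.
  move=> b; apply: (@le_trans _ _ (`|h|^-1 * (e / (`|w| + 1) * `|k h|))).
    by rewrite ler_wpM2l// invr_ge0.
  rewrite mulrCA -normfV -normrZ -mulrA ler_piMr ?(ltW e0)//.
  rewrite ler_pdivrMl// mulr1.
  have : `|w - h^-1 *: k h| < 1 by near: h; move/cvgrPdist_lt : kw; apply.
  move=> wk; rewrite -[_ *: _](subKr w) (le_trans (ler_normB _ _))// lerD2l ltW//.
have -> : (fun h : R => h^-1 *: (((H \o y) \o shift x) (h *: v) - (H \o y) x)) = S \+ rem.
  apply/funext => h; rewrite /S /rem /= /k -[h^-1 *: _]/(h^-1 * _) [y x + _]addrC subrK.
  rewrite [in RHS]mulrBr addrC mulr_sumr.
  set q := \sum_i _; set q' := \sum_i _.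
  have -> : q = q' by apply: eq_bigr => i _; rewrite [in LHS]mxE mulrA.
  by rewrite [RHS]addrC subrK.
rewrite -[l]addr0; exact: cvgD.
Unshelve. all: by end_near.
Qed.

Lemma derive_linear n (f : 'rV[R]_n -> R) x v : Ck 1 f ->
  'D_v f x = \sum_i v ord0 i * 'D_(delta_mx ord0 i) f x.
Proof.
move=> f1; have [_] := @C1_chain _ n f id x v f1 (fun i => (derive_coord x v i).1).
by move=> ->; apply: eq_bigr => i _; rewrite (derive_coord x v i).2.
Qed.

Lemma C1_comp m n (H : 'rV[R]_n -> R) (y : 'rV[R]_m -> 'rV[R]_n) : Ck 1 H ->
  (forall i, Ck 1 (fun x => y x ord0 i)) -> Ck 1 (H \o y).
Proof.
move=> H1 y1.
have cy : continuous y by move=> x; apply: continuous_rV => i; exact: (y1 i).1.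
have dy i v x : derivable (fun x => y x ord0 i) x v by exact: ((y1 i).2 v).1.
split=> [x|v]; first by apply: continuous_comp; [exact: cy|exact: H1.1].
split=> [x|]; first exact: (C1_chain H1 (fun i => dy i v x)).1.
rewrite (_ : 'D_v _ = (fun x => \sum_i 'D_v (fun z => y z ord0 i) x * 'D_(delta_mx ord0 i) H (y x))).
  move=> x; apply: continuous_sumr => i _.
  have c1 : {for x, continuous ('D_v (fun z => y z ord0 i))} := ((y1 i).2 v).2 x.
  have c2 : {for x, continuous (fun x => 'D_(delta_mx ord0 i) H (y x))}.
    apply: (@continuous_comp _ _ _ y ('D_(delta_mx ord0 i) H)); first exact: cy.
    exact: (H1.2 (delta_mx ord0 i)).2.
  exact: (continuousM c1 c2).
by apply/funext => x; exact: (C1_chain H1 (fun i => dy i v x)).2.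
Qed.

Lemma smooth_derive (V : normedModType R) (W : normedModType R) (G : V -> W) v :
  smooth_on setT G -> smooth_on setT ('D_v G).
Proof.
move=> sG vs x _; have := sG (vs ++ [:: v]) x I.
rewrite (_ : iter_derive (vs ++ [:: v]) G = iter_derive vs ('D_v G))//.
by elim: vs => //= w vs ->.
Qed.

End directional.

(** * The divergence theorem on a simplex *)

Lemma Rintegral_sum d (T : measurableType d) (R : realType) (mu : {measure set T -> \bar R})
    (D : set T) (mD : measurable D) (I : Type) (s : seq I) (f : I -> T -> R) :
  (forall i, mu.-integrable D (EFin \o f i)) ->
  \int[mu]_(x in D) (\sum_(i <- s) f i x) = \sum_(i <- s) \int[mu]_(x in D) f i x.
Proof.
move=> fi; elim: s => [|i s IH].
  rewrite big_nil; under eq_Rintegral do rewrite big_nil.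
  by rewrite Rintegral_cst// mul0r.
under eq_Rintegral do rewrite big_cons; rewrite big_cons RintegralD//.
  by rewrite IH.
rewrite (_ : EFin \o _ = fun x => (\sum_(j <- s) (EFin \o f j) x)%E); first exact: integrable_sum.
by apply/funext => x; rewrite /= sumEFin.
Qed.

Section reference_integrals.
Context {R : realType}.
Local Notation mu n := (@rV_lebesgue R n).
Local Notation lam := (@lebesgue_measure R).

Lemma coord_bounded n (A : set 'rV[R]_n) (M : R) :
  (forall x, A x -> forall i, `|x ord0 i| <= M) -> bounded_set A.
Proof.
move=> h; exists `|M|; split; first exact: num_real.
move=> N MN x Ax /=.
rewrite [leLHS]/Num.Def.normr /= mx_normrE.
apply: bigmax_le => [|[i j] _] /=; first exact: le_trans (normr_ge0 M) (ltW MN).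
rewrite (ord1 i); apply: le_trans (h x Ax j) _.
exact: le_trans (ler_norm M) (ltW MN).
Qed.

Lemma std_edges_unit m : edges (std_simplex m : 'M[R]_(m.+1, m)) \in unitmx.
Proof. by rewrite std_simplex_edges unitmx1. Qed.

Lemma bary_std m (t : 'rV[R]_m) : bary (std_simplex m) t = weights t.
Proof. by rewrite -[t in LHS](weights_std t) weights_mul bary_param// std_edges_unit. Qed.

Lemma open_std_simplexP m (t : 'rV[R]_m) :
  open_simplex (std_simplex m) t <-> forall i, 0 < weights t ord0 i.
Proof. by rewrite open_simplexP ?std_edges_unit// bary_std. Qed.

Lemma ref_simplexE m : @ref_simplex R m = closure (open_simplex (std_simplex m)) :> set 'rV[R]_m.
Proof.
rewrite closure_open_simplex ?std_edges_unit// predeqE => t.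
rewrite ref_simplexP subsimplexP ?std_edges_unit// bary_std.
by split => [h|[]//]; split=> // i; rewrite inE.
Qed.

Lemma open_simplex_param m (F : 'M[R]_(m.+1, m)) t : edges F \in unitmx ->
  open_simplex F (param F t) <-> open_simplex (std_simplex m) t.
Proof. by move=> uF; rewrite open_simplexP// bary_param// open_std_simplexP. Qed.

Lemma measurable_ref_simplex m : measurable (@ref_simplex R m).
Proof. by rewrite ref_simplexE; apply: closed_measurable_rV; exact: closed_closure. Qed.

Lemma measurable_open_simplex m (F : 'M[R]_(m.+1, m)) : edges F \in unitmx ->
  measurable (open_simplex F).
Proof. by move=> uF; apply: open_measurable_rV; exact: open_open_simplex. Qed.

Lemma bounded_ref_simplex m : bounded_set (@ref_simplex R m).
Proof.
apply: (@coord_bounded _ _ 1) => t [t0 t1] i; rewrite ger0_norm//.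
by apply: le_trans t1; rewrite (bigD1 i)//= lerDl sumr_ge0.
Qed.

Lemma bounded_open_simplex m n (F : 'M[R]_(m.+1, n)) : bounded_set (open_simplex F).
Proof.
apply: (@coord_bounded _ _ (\sum_j \sum_i `|F j i|)) => x [w [w0 w1 ->]] i.
rewrite mxE (le_trans (ler_norm_sum _ _ _))//; apply: ler_sum => j _.
rewrite normrM (bigD1 i)//= -[leLHS]addr0 lerD ?sumr_ge0//.
rewrite ler_piMl// gtr0_norm// -w1 (bigD1 j)//= lerDl sumr_ge0// => k _.
exact: ltW.
Qed.

Lemma Rintegral0 n (D : set 'rV[R]_n) : \int[mu n]_(x in D) (0 : R) = 0.
Proof. by rewrite /Rintegral integral0. Qed.

Lemma Rintegral_null_diff n (A B : set 'rV[R]_n) (f : 'rV[R]_n -> R) :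
  measurable A -> measurable B -> A `<=` B -> mu n (B `\` A) = 0%E ->
  (mu n).-integrable B (EFin \o f) ->
  \int[mu n]_(x in A) f x = \int[mu n]_(x in B) f x.
Proof.
move=> mA mB AB n0 fi; rewrite /Rintegral; congr fine.
rewrite [RHS](negligible_integral (N := B `\` A))//; last exact: measurableD.
by rewrite setDD setIC; rewrite (setIidl AB).
Qed.

Lemma Rintegral_ref_simplex m (f : 'rV[R]_m -> R) : continuous f ->
  \int[mu m]_(t in @ref_simplex R m) f t = \int[mu m]_(t in open_simplex (std_simplex m)) f t.
Proof.
move=> cf; apply/esym/Rintegral_null_diff.
- by apply: measurable_open_simplex; exact: std_edges_unit.
- exact: measurable_ref_simplex.
- by rewrite ref_simplexE; exact: subset_closure.
- by rewrite ref_simplexE null_simplex_boundary// std_edges_unit.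
- by apply: continuous_integrable => //; [exact: measurable_ref_simplex|exact: bounded_ref_simplex].
Qed.

Lemma continuous_param m n (F : 'M[R]_(m.+1, n)) : continuous (param F).
Proof. exact: continuous_affine. Qed.

Lemma continuous_comp_param m n (F : 'M[R]_(m.+1, n)) (f : 'rV[R]_n -> R) :
  continuous f -> continuous (f \o param F).
Proof.
by move=> cf t; apply: continuous_comp; [exact: continuous_param|exact: cf].
Qed.

Lemma integrable_patch n (A : set 'rV[R]_n) (f : 'rV[R]_n -> R) : measurable A ->
  (mu n).-integrable A (EFin \o f) -> (mu n).-integrable setT (EFin \o (f \_ A)).
Proof.
move=> mA; rewrite integrable_mkcond//; congr (is_true (_.-integrable _ _)).
by rewrite restrict_EFin.
Qed.

Lemma Rintegral_affine n (b : 'rV[R]_n) (M : 'M[R]_n) (f : 'rV[R]_n -> R) : M \in unitmx ->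
  (mu n).-integrable setT (EFin \o f) ->
  \int[mu n]_x f x = `|\det M| * \int[mu n]_x f (b + x *m M).
Proof.
move=> uM fi; rewrite /Rintegral (integral_affine b uM fi) fineM//.
exact: (integrable_fin_num measurableT (integrable_affine b uM fi)).
Qed.

(** The integral over the reference simplex of a function of the point with
    those coordinates; the area factor is left out. *)
Definition surf m n (F : 'M[R]_(m.+1, n)) (f : 'rV[R]_n -> R) : R :=
  \int[mu m]_(t in @ref_simplex R m) f (param F t).

Lemma integrable_ref_simplex m (f : 'rV[R]_m -> R) : continuous f ->
  (mu m).-integrable (@ref_simplex R m) (EFin \o f).
Proof.
by apply: continuous_integrable; [exact: measurable_ref_simplex|exact: bounded_ref_simplex].
Qed.

Lemma surf_row_perm m n (s : 'S_m.+1) (F : 'M[R]_(m.+1, n)) (f : 'rV[R]_n -> R) :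
  continuous f -> surf (row_perm s F) f = surf F f.
Proof.
move=> cf; rewrite /surf Rintegral_mkcond [RHS]Rintegral_mkcond.
have fi : (mu m).-integrable setT (EFin \o ((f \o param F) \_ (@ref_simplex R m))).
  apply: integrable_patch; first exact: measurable_ref_simplex.
  by apply: integrable_ref_simplex; exact: continuous_comp_param.
rewrite [RHS](Rintegral_affine (row ord0 (row_perm s (std_simplex m))) (perm_linear_unit s) fi).
rewrite perm_linear_det mul1r; apply: eq_Rintegral => t _.
rewrite /patch param_row_perm /=.
have -> : (t \in @ref_simplex R m) = (row ord0 (row_perm s (std_simplex m)) + t *m perm_linear s \in @ref_simplex R m).
  by apply/idP/idP => /set_mem h; apply/mem_set; apply/(ref_simplex_perm s t).
by [].
Qed.

Lemma line_FTC n (g : 'rV[R]_n -> R) (z v : 'rV[R]_n) (c : R) : Ck 1 g -> 0 < c ->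
  (\int[lam]_(a in `[0%R, c]) ('D_v g (z + a *: v))%:E = (g (z + c *: v) - g z)%:E)%E.
Proof.
move=> g1 c0.
have dl (s : R) : is_derive s 1 (fun s => g (z + s *: v)) ('D_v g (z + s *: v)).
  by apply: line_is_derive; exact: (g1.2 v).1.
have cl : continuous (fun s : R => z + s *: v).
  move=> s; have hs : {for s, continuous (fun r : R => r *: v)} by exact: scalel_continuous.
  exact: (@continuousD _ _ _ (cst z) (fun r : R => r *: v) s (@cst_continuous _ _ z s) hs).
have cg : continuous (fun s : R => g (z + s *: v)).
  by move=> s; apply: (@continuous_comp _ _ _ (fun s : R => z + s *: v) g); [exact: cl|exact: g1.1].
have cd : continuous (fun s : R => 'D_v g (z + s *: v)).
  move=> s; apply: (@continuous_comp _ _ _ (fun s : R => z + s *: v) ('D_v g)); first exact: cl.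
  exact: (g1.2 v).2.
rewrite (@continuous_FTC2 _ _ (fun s : R => g (z + s *: v)) 0 c)//.
- by rewrite scale0r addr0 EFinB.
- exact: continuous_subspaceT.
- split.
  + by move=> s _; exact: (@ex_derive _ _ _ _ _ _ _ (dl s)).
  + by apply: cvg_at_right_filter; exact: cg.
  + by apply: cvg_at_left_filter; exact: cg.
- by move=> s _; rewrite derive1E; exact: (@derive_val _ _ _ _ _ _ _ (dl s)).
Qed.

Lemma weights_cons m (a : R) (t : 'rV[R]_m) :
  weights (rV_cons (a, t) : 'rV[R]_m.+1) = rV_cons (1 - a - \sum_j t ord0 j, rV_cons (a, t)).
Proof.
congr (rV_cons (_, _)); rewrite big_ord_recl mxE unlift_none /= opprD addrA.
by congr (_ - _ - _); apply: eq_bigr => j _; rewrite mxE liftK.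
Qed.

Variable d : nat.
Implicit Type F : 'M[R]_(d.+2, d.+1).

Lemma param_entry m n (F : 'M[R]_(m.+1, n)) (t : 'rV[R]_m) k :
  param F t ord0 k = (1 - \sum_j t ord0 j) * F ord0 k + \sum_j t ord0 j * F (lift ord0 j) k.
Proof.
rewrite -weights_mul mxE big_ord_recl weights0; congr (_ + _).
by apply: eq_bigr => j _; rewrite weights_lift.
Qed.

Lemma param_cons_entry F a t k :
  param F (rV_cons (a, t)) ord0 k =
  (1 - (a + \sum_j t ord0 j)) * F ord0 k + (a * F (one_ord d) k
   + \sum_j t ord0 j * F (lift ord0 (lift ord0 j)) k).
Proof.
have cl j : (rV_cons (a, t) : 'rV[R]_d.+1) ord0 (lift ord0 j) = t ord0 j by rewrite mxE liftK.
have c0 : (rV_cons (a, t) : 'rV[R]_d.+1) ord0 ord0 = a by rewrite mxE unlift_none.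
rewrite param_entry !big_ord_recl !c0; congr ((1 - (_ + _)) * _ + (_ + _)).
  by apply: eq_bigr => j _; exact: cl.
by apply: eq_bigr => j _; rewrite cl.
Qed.

Lemma param_cons0 F t : param F (rV_cons (0, t)) = param (facet F (one_ord d)) t.
Proof.
apply/rowP => k; rewrite param_cons_entry param_entry mul0r !add0r !mxE.
congr (_ * F _ _ + _); first exact: ord_inj.
by apply: eq_bigr => j _; rewrite !mxE; congr (_ * F _ _); exact: ord_inj.
Qed.

Lemma param_cons1 F (t : 'rV[R]_d) :
  param F (rV_cons (1 - \sum_j t ord0 j, t)) = param (facet F ord0) t.
Proof.
apply/rowP => k; rewrite param_cons_entry param_entry subrK subrr mul0r add0r !mxE.
congr (_ + _); by apply: eq_bigr => j _; rewrite !mxE.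
Qed.

Lemma row0_edges F : row ord0 (edges F) = row (one_ord d) F - row ord0 F.
Proof. by apply/rowP => k; rewrite !mxE. Qed.

Lemma param_consE F a t : param F (rV_cons (a, t)) =
  param F (rV_cons (0, t)) + a *: row ord0 (edges F).
Proof.
rewrite /param -addrA; congr (_ + _).
apply/rowP => k; rewrite !mxE !big_ord_recl !mxE !unlift_none /= mul0r add0r addrC.
by congr (_ + _); apply: eq_bigr => j _; congr (_ * _); rewrite !mxE !liftK.
Qed.

Lemma open_simplex_cons (a : R) (t : 'rV[R]_d) :
  open_simplex (std_simplex d.+1) (rV_cons (a, t)) <->
  open_simplex (std_simplex d) t /\ 0 < a < 1 - \sum_j t ord0 j.
Proof.
rewrite !open_std_simplexP weights_cons; split=> [h|[h /andP[a0 a1]] i].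
  have h0 := h ord0; have h1 := h (lift ord0 ord0).
  rewrite mxE unlift_none /= in h0; rewrite mxE liftK /= mxE unlift_none /= in h1.
  have a1 : 0 < a < 1 - \sum_j t ord0 j by rewrite h1 -subr_gt0 addrAC.
  split=> // i; case: (unliftP ord0 i) => [j ->|->]; last first.
    by rewrite weights0; case/andP: a1 => a0 /(lt_trans a0).
  by rewrite weights_lift; have := h (lift ord0 (lift ord0 j)); rewrite mxE liftK /= mxE liftK.
case: (unliftP ord0 i) => [j ->|->]; last first.
  by rewrite mxE unlift_none /= addrAC subr_gt0.
rewrite mxE liftK /=; case: (unliftP ord0 j) => [l ->|->]; rewrite mxE ?liftK ?unlift_none //=.
by have := h (lift ord0 l); rewrite weights_lift.
Qed.

(** Fubini along the edge from vertex 0 to vertex 1: every segment of the simplex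
    in that direction runs between the two opposite facets. *)
Lemma edge_integral_one F (g : 'rV[R]_d.+1 -> R) : edges F \in unitmx -> Ck 1 g ->
  \int[mu d.+1]_(x in open_simplex F) 'D_(row (one_ord d) F - row ord0 F) g x =
  `|\det (edges F)| * (surf (facet F ord0) g - surf (facet F (one_ord d)) g).
Proof.
move=> uF g1; rewrite -row0_edges; set v := row ord0 (edges F).
have mK := measurable_open_simplex uF.
have Dc : continuous ('D_v g) by exact: (g1.2 v).2.
have gc : continuous g by exact: g1.1.
have Ki : (mu d.+1).-integrable setT (EFin \o ('D_v g \_ (open_simplex F))).
  by apply: integrable_patch => //; apply: continuous_integrable => //; exact: bounded_open_simplex.
rewrite Rintegral_mkcond (Rintegral_affine (row ord0 F) uF Ki); congr (_ * _).
have ci a : continuous (g \o param (facet F a)) by exact: continuous_comp_param.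
rewrite /surf (Rintegral_ref_simplex (ci ord0)) (Rintegral_ref_simplex (ci (one_ord d))).
have mO := measurable_open_simplex (std_edges_unit d).
have oi a : (mu d).-integrable (open_simplex (std_simplex d)) (EFin \o (g \o param (facet F a))).
  by apply: continuous_integrable => //; exact: bounded_open_simplex.
rewrite -RintegralB//.
rewrite [RHS]Rintegral_mkcond /Rintegral; congr fine.
rewrite (fubini_rV2 (f := fun x => (('D_v g \_ (open_simplex F)) (row ord0 F + x *m edges F))%:E)); last first.
  exact: (integrable_affine _ uF Ki).
apply: eq_integral => t _.
pose c := 1 - \sum_j t ord0 j.
pose G (a : R) := 'D_v g (param F (rV_cons (0, t)) + a *: v).
have patchE a : ('D_v g \_ (open_simplex F)) (row ord0 F + rV_cons (a, t) *m edges F) =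
    if `[< open_simplex (std_simplex d) t /\ 0 < a < c >] then G a else 0.
  rewrite -/(param F (rV_cons (a, t))) /patch.
  have -> : (param F (rV_cons (a, t)) \in open_simplex F) = `[< open_simplex (std_simplex d) t /\ 0 < a < c >].
    apply/idP/asboolP => [/set_mem/(open_simplex_param _ uF)/open_simplex_cons //|h].
    by apply/mem_set/(open_simplex_param _ uF)/open_simplex_cons.
  by case: ifP => // _; rewrite param_consE.
under eq_integral do rewrite patchE.
rewrite /patch; case: ifPn => [|] ht; last first.
  apply: integral0_eq => a _; case: asboolP => // -[ht' _].
  by rewrite mem_set in ht.
have {}ht := set_mem ht.
have c0 : 0 < c by move/open_std_simplexP : ht => /(_ ord0); rewrite weights0.
transitivity (\int[lam]_(a in `[0%R, c]) (G a)%:E)%E; last first.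
  rewrite line_FTC//=; congr (_ - _)%:E; last by rewrite param_cons0.
  by rewrite -param_consE param_cons1.
transitivity (\int[lam]_(a in `]0%R, c[) (G a)%:E)%E.
  rewrite [RHS]integral_mkcond; apply: eq_integral => a _.
  rewrite /patch; have -> : (a \in (`]0%R, c[%classic : set R)) = `[< open_simplex (std_simplex d) t /\ 0 < a < c >].
    apply/idP/asboolP => [/set_mem|[_ h]]; first by rewrite /= in_itv/=.
    by apply/mem_set; rewrite /= in_itv.
  by case: ifP.
apply/esym/integral_itv_bndoo.
apply/measurable_EFinP; apply: measurable_funTS; apply: continuous_measurable_fun.
move=> a; rewrite /G; apply: (@continuous_comp _ _ _ (fun s : R => _ + s *: v) ('D_v g)); last exact: Dc.
have hs : {for a, continuous (fun r : R => r *: v)} by exact: scalel_continuous.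
exact: (@continuousD _ _ _ (cst (param F (rV_cons (0, t)))) (fun r : R => r *: v) a (@cst_continuous _ _ _ a) hs).
Qed.

(** Renumbering reduces the edge from vertex 0 to any vertex to the previous case. *)
Lemma edge_integral F (g : 'rV[R]_d.+1 -> R) b : edges F \in unitmx -> Ck 1 g ->
  \int[mu d.+1]_(x in open_simplex F) 'D_(row b F - row ord0 F) g x =
  `|\det (edges F)| * (surf (facet F ord0) g - surf (facet F b) g).
Proof.
move=> uF g1; case: (unliftP ord0 b) => [b' ->|->]; last first.
  rewrite !subrr mulr0 -[RHS](Rintegral0 (open_simplex F)).
  apply: eq_Rintegral => x _; rewrite derive_linear// big1// => i _.
  by rewrite mxE mul0r.
pose s : 'S_d.+2 := lift_perm ord0 ord0 (lift_perm ord0 b' 1).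
have s0 : s ord0 = ord0 by rewrite /s lift_perm_id.
have s1 : s (one_ord d) = lift ord0 b' by rewrite /s /one_ord lift_perm_lift lift_perm_id.
pose G := row_perm s F.
have rG i : row i G = row (s i) F by apply/rowP => k; rewrite !mxE.
have uG : edges G \in unitmx by rewrite edges_row_perm_unit.
have := edge_integral_one uG g1; rewrite !rG s0 s1 det_edges_row_perm.
have -> : open_simplex G = open_simplex F by exact: open_simplex_row_perm.
have -> : facet G ord0 = row_perm (lift_perm ord0 b' 1) (facet F ord0).
  by apply/matrixP => i j; rewrite !mxE /s lift_perm_lift.
have -> : facet G (one_ord d) = facet F (lift ord0 b').
  apply/matrixP => i j; rewrite !mxE; congr (F _ _).
  case: (unliftP ord0 i) => [i' ->|->].
    have -> : lift (one_ord d) (lift ord0 i') = lift ord0 (lift ord0 i') by exact: ord_inj.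
    by rewrite /s !lift_perm_lift perm1; apply: ord_inj; rewrite /= /bump !leq0n !add1n ltnS addnS.
  have -> : lift (one_ord d) ord0 = ord0 by exact: ord_inj.
  by rewrite s0; exact: ord_inj.
by rewrite surf_row_perm//; exact: g1.1.
Qed.

End reference_integrals.

Section divergence.
Context {R : realType} {d : nat}.
Local Notation mu n := (@rV_lebesgue R n).
Implicit Types (F : 'M[R]_(d.+2, d.+1)) (Q : 'rV[R]_d.+1 -> 'rV[R]_d.+1).

Definition C1_field Q := forall i, Ck 1 (fun x => Q x ord0 i).

Lemma C1_dot Q (w : 'rV[R]_d.+1) : C1_field Q -> Ck 1 (fun x => dot (Q x) w).
Proof. by move=> Q1; apply: Ck_sum => i; apply: CkM => //; exact: Ck_cst. Qed.

Lemma derive_dot Q w v x : C1_field Q ->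
  'D_v (fun x => dot (Q x) w) x = \sum_i 'D_v (fun x => Q x ord0 i) x * w ord0 i.
Proof.
move=> Q1; pose l : 'rV[R]_d.+1 -> R := fun q => dot q w.
have lE : l = (fun q => \sum_i q ord0 i * w ord0 i) by [].
have l1 : Ck 1 l by apply: Ck_sum => i; apply: CkM; [exact: Ck_coord|exact: Ck_cst].
have dl i q : 'D_(delta_mx ord0 i) l q = w ord0 i.
  have e h : l (h *: delta_mx ord0 i + q) = h *: (w ord0 i) + l q.
    by rewrite /l dotDl dotZl /dot (bigD1 i)//= big1 ?addr0 ?mxE ?eqxx ?mul1r// => j ji; rewrite mxE (negbTE ji) andbF mul0r.
  have [-> _] := @derive_along R _ _ _ l (id : R -> R) q (delta_mx ord0 i) (w ord0 i) e.
  by rewrite derive_id.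
have [_ ->] := C1_chain (y := Q) (x := x) (v := v) l1 (fun i => ((Q1 i).2 v).1 x).
by apply: eq_bigr => i _; rewrite dl.
Qed.

Lemma C1_field_div_continuous Q : C1_field Q -> continuous (div Q).
Proof.
move=> Q1 x; apply: continuous_sumr => i _; exact: ((Q1 i).2 (delta_mx ord0 i)).2.
Qed.

Lemma surf_sum (I : finType) n m (G : 'M[R]_(m.+1, n)) (f : I -> 'rV[R]_n -> R) :
  (forall i, continuous (f i)) ->
  surf G (fun x => \sum_i f i x) = \sum_i surf G (f i).
Proof.
move=> cf; apply: Rintegral_sum => [|i]; first exact: measurable_ref_simplex.
by apply: integrable_ref_simplex; exact: (continuous_comp_param (cf i)).
Qed.

Lemma surfZ n m (G : 'M[R]_(m.+1, n)) c (f : 'rV[R]_n -> R) : continuous f ->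
  surf G (fun x => c * f x) = c * surf G f.
Proof.
move=> cf; rewrite /surf RintegralZl//; first exact: measurable_ref_simplex.
by apply: integrable_ref_simplex; exact: (continuous_comp_param cf).
Qed.

(** Expanding the field along the edges at vertex 0, with the barycentric
    gradients as the dual basis, turns the divergence into edge derivatives. *)
Lemma divergence_simplex F Q : edges F \in unitmx -> C1_field Q ->
  \int[mu d.+1]_(x in open_simplex F) div Q x =
  \sum_a facet_area F a * surf (facet F a) (fun x => dot (Q x) (outer_normal F a)).
Proof.
move=> uF Q1.
pose g b := fun x => dot (Q x) (bary_grad F b).
have g1 b : Ck 1 (g b) by exact: C1_dot.
have dual j k : \sum_b (row b F - row ord0 F) ord0 j * baryD F k b = (j == k)%:R.
  under eq_bigr do rewrite 4!mxE mulrBl.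
  rewrite sumrB -mulr_sumr baryD_sum// mulr0 subr0.
  have e : (baryD F *m F) k j = (1%:M : 'M[R]_d.+1) k j by rewrite baryD_mul.
  rewrite [LHS]mxE [RHS]mxE in e.
  by rewrite eq_sym -e; apply: eq_bigr => i _; rewrite mulrC.
have divE x : div Q x = \sum_b 'D_(row b F - row ord0 F) (g b) x.
  transitivity (\sum_b \sum_j \sum_k (row b F - row ord0 F) ord0 j * baryD F k b * 'D_(delta_mx ord0 j) (fun x => Q x ord0 k) x).
    rewrite exchange_big /=; apply: eq_bigr => j _.
    rewrite exchange_big /= (bigD1 j)//= -mulr_suml dual eqxx mul1r.
    by rewrite big1 ?addr0// => k kj; rewrite -mulr_suml dual eq_sym (negbTE kj) mul0r.
  apply: eq_bigr => b _; rewrite [RHS]derive_linear//; apply: eq_bigr => j _.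
  rewrite derive_dot// mulr_sumr; apply: eq_bigr => k _.
  by rewrite -mulrA; congr (_ * _); rewrite mulrC [bary_grad _ _ _ _]mxE [col _ _ _ _]mxE.
have mK := measurable_open_simplex uF.
have gi b : (mu d.+1).-integrable (open_simplex F) (EFin \o 'D_(row b F - row ord0 F) (g b)).
  by apply: continuous_integrable => //; [exact: bounded_open_simplex|exact: ((g1 b).2 _).2].
transitivity (\sum_b \int[mu d.+1]_(x in open_simplex F) 'D_(row b F - row ord0 F) (g b) x).
  under eq_Rintegral do rewrite divE.
  by apply: Rintegral_sum.
under eq_bigr do rewrite edge_integral//.
rewrite -mulr_sumr sumrB.
have -> : \sum_b surf (facet F ord0) (g b) = 0.
  rewrite -surf_sum; last by move=> b; exact: (g1 b).1.
  rewrite -[RHS](Rintegral0 (@ref_simplex R d)); apply: eq_Rintegral => t _.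
  rewrite /g /dot exchange_big /= big1// => k _; rewrite -mulr_sumr.
  under eq_bigr do rewrite [bary_grad _ _ _ _]mxE [col _ _ _ _]mxE.
  by rewrite baryD_sum// mulr0.
rewrite sub0r mulrN -mulNr mulr_sumr; apply: eq_bigr => b _.
rewrite -surfZ; last exact: (g1 b).1.
rewrite -surfZ; last exact: (C1_dot _ Q1).1.
by apply: eq_Rintegral => t _; rewrite -!dotZr facet_area_normal.
Qed.

End divergence.

(** * Poincare and trace inequalities *)

Section cauchy_schwarz.
Context d (T : measurableType d) (R : realType) (mu : {measure set T -> \bar R}).
Variables (D : set T) (f g : T -> R).
Hypotheses (mD : measurable D) (mf : measurable_fun D f) (mg : measurable_fun D g).
Hypotheses (f2 : mu.-integrable D (EFin \o (fun x => f x ^+ 2))).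
Hypotheses (g2 : mu.-integrable D (EFin \o (fun x => g x ^+ 2))).

Lemma integrable_mul_sqr : mu.-integrable D (EFin \o (fun x => f x * g x)).
Proof.
apply: (le_integrable mD (g := (EFin \o (fun x => f x ^+ 2)%R) \+ (EFin \o (fun x => g x ^+ 2)%R))%E).
- by apply/measurable_EFinP; exact: measurable_funM.
- move=> x Dx /=; rewrite lee_fin normrM [leRHS]ger0_norm ?addr_ge0 ?sqr_ge0//.
  rewrite -(real_normK (num_real (f x))) -(real_normK (num_real (g x))).
  have := sqr_ge0 (`|f x| - `|g x|).
  have := mulr_ge0 (normr_ge0 (f x)) (normr_ge0 (g x)).
  by nra.
- exact: integrableD.
Qed.

Lemma Rintegral_cauchy_schwarz :
  `|\int[mu]_(x in D) (f x * g x)| <=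
  Num.sqrt (\int[mu]_(x in D) (f x ^+ 2)) * Num.sqrt (\int[mu]_(x in D) (g x ^+ 2)).
Proof.
set A := \int[mu]_(x in D) (f x ^+ 2); set B := \int[mu]_(x in D) (f x * g x).
set C := \int[mu]_(x in D) (g x ^+ 2).
have fg := integrable_mul_sqr.
(* the integral of (f + l g)^2 *)
have quad (l : R) : 0 <= A + 2 * l * B + l ^+ 2 * C.
  have ifg : mu.-integrable D (EFin \o (fun x => 2 * l * (f x * g x))).
    by have := integrableZl mD (2 * l) fg; apply: eq_integrable.
  have ig : mu.-integrable D (EFin \o (fun x => l ^+ 2 * g x ^+ 2)).
    by have := integrableZl mD (l ^+ 2) g2; apply: eq_integrable.
  have : 0 <= \int[mu]_(x in D) (f x ^+ 2 + 2 * l * (f x * g x) + l ^+ 2 * g x ^+ 2).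
    apply: Rintegral_ge0 => x _; rewrite (_ : _ + _ = (f x + l * g x) ^+ 2) ?sqr_ge0//.
    by ring.
  rewrite RintegralD//; last first.
    by have := integrableD mD f2 ifg; apply: eq_integrable => // x _ /=.
  by rewrite RintegralD// RintegralZl// RintegralZl.
have A0 : 0 <= A by apply: Rintegral_ge0 => x _; exact: sqr_ge0.
have C0 : 0 <= C by apply: Rintegral_ge0 => x _; exact: sqr_ge0.
rewrite -sqrtrM// -(sqrtr_sqr B) ler_sqrt ?mulr_ge0//.
have [C00|Cn] := eqVneq C 0.
  rewrite C00 mulr0; suff -> : B = 0 by rewrite expr0n.
  (* an affine function of l that is bounded below is constant *)
  apply/eqP; apply: contraT => B0.
  have := quad (- (A + 1) / (2 * B)); rewrite C00 mulr0 addr0.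
  rewrite (_ : 2 * _ * B = - (A + 1)); last by field; rewrite B0.
  by rewrite opprD addrA subrr add0r lerNr oppr0 ler10.
have Cp : 0 < C by rewrite lt_neqAle eq_sym Cn.
(* the minimum of the quadratic *)
have := quad (- B / C).
have -> : A + 2 * (- B / C) * B + (- B / C) ^+ 2 * C = A - B ^+ 2 / C by field.
by rewrite subr_ge0 ler_pdivrMr.
Qed.

End cauchy_schwarz.

Section euclidean.
Context {R : realType}.

Lemma dot_cauchy_schwarz n (x y : 'rV[R]_n) : `|dot x y| <= enorm x * enorm y.
Proof.
have [y0|y0] := eqVneq (dot y y) 0.
  rewrite (dot_eq0 y0) /dot big1 ?normr0 ?mulr_ge0 ?enorm_ge0// => i _.
  by rewrite mxE mulr0.
have yp : 0 < dot y y by rewrite lt_neqAle eq_sym y0 dot_ge0.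
rewrite /enorm -sqrtrM ?dot_ge0// -sqrtr_sqr ler_sqrt ?mulr_ge0 ?dot_ge0//.
have := dot_ge0 (x - (dot x y / dot y y) *: y).
rewrite dotDl !dotDr !dotNl !dotNr !dotZl !dotZr (dotC y x).
have -> : dot x x - dot x y / dot y y * dot x y + (- (dot x y / dot y y * dot x y) - - (dot x y / dot y y * (dot x y / dot y y * dot y y))) = dot x x - dot x y ^+ 2 / dot y y.
  by field.
by rewrite subr_ge0 ler_pdivrMr.
Qed.

Lemma derive_grad n (f : 'rV[R]_n -> R) x v : Ck 1 f -> 'D_v f x = dot (grad f x) v.
Proof. by move=> f1; rewrite derive_linear//; apply: eq_bigr => i _; rewrite mxE mulrC. Qed.

Lemma continuous_enorm n (q : 'rV[R]_n -> 'rV[R]_n) : (forall i, continuous (fun x => q x ord0 i)) ->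
  continuous (fun x => enorm (q x)).
Proof.
move=> cq x.
have cd : {for x, continuous (fun x => dot (q x) (q x))}.
  by apply: continuous_sumr => i _; exact: (continuousM (cq i x) (cq i x)).
apply: (@continuous_comp _ _ _ (fun x => dot (q x) (q x)) (@Num.sqrt R)) => //.
exact: sqrt_continuous.
Qed.

Lemma continuous_enorm_grad n (f : 'rV[R]_n -> R) : Ck 1 f -> continuous (fun x => enorm (grad f x)).
Proof.
move=> f1; apply: continuous_enorm => i.
rewrite (_ : (fun x => _) = 'D_(delta_mx ord0 i) f); first exact: (f1.2 _).2.
by apply/funext => x; rewrite mxE.
Qed.

Lemma enorm_delta n (i : 'I_n) : enorm (delta_mx ord0 i : 'rV[R]_n) = 1.
Proof.
rewrite /enorm /dot (bigD1 i)//= big1 ?addr0 ?mxE ?eqxx ?mulr1 ?sqrtr1// => j ji.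
by rewrite mxE (negbTE ji) andbF mulr0.
Qed.

End euclidean.

Section slices.
Context {R : realType} {d : nat}.
Local Notation mu n := (@rV_lebesgue R n).
Local Notation lam := (@lebesgue_measure R).

Lemma rV_cons_mul_col (nu : 'rV[R]_d.+1) (E : 'M[R]_(d, d.+1)) (s : R) (t : 'rV[R]_d) :
  rV_cons (s, t) *m (col_mx nu E : 'M[R]_d.+1) = s *: nu + t *m E.
Proof. by rewrite rV_consE (@mul_row_col _ 1 1 d) mul_scalar_mx. Qed.

(** A compactly supported function is at each point the integral of its
    derivative over a half line. *)
Lemma line_integral_ge (h : 'rV[R]_d.+1 -> R) (nu z : 'rV[R]_d.+1) (N : R) : Ck 1 h ->
  (forall x, h x != 0 -> forall i, `|x ord0 i| <= N) -> nu != 0 ->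
  ((h z)%:E <= \int[lam]_s (`|'D_nu h (z + s *: nu)|)%:E)%E.
Proof.
move=> h1 hN nu0.
have [i nui] : exists i, nu ord0 i != 0.
  apply/existsP; apply: contraT; rewrite negb_exists => /forallP k.
  case/negP: nu0; apply/eqP/rowP => i; rewrite mxE; apply/eqP.
  by have := k i; rewrite negbK.
pose c := (`|N| + `|z ord0 i| + 1) / `|nu ord0 i|.
have nup : 0 < `|nu ord0 i| by rewrite normr_gt0.
have c0 : 0 < c by rewrite divr_gt0// ltr_wpDl// addr_ge0.
(* c is large enough for the coordinate i to leave the cube *)
have hz : h (z - c *: nu) = 0.
  apply/eqP; apply: contraT => /hN/(_ i); rewrite !mxE leNgt; case/negP.
  apply: le_lt_trans (ler_norm N) _.
  rewrite distrC; apply: (@lt_le_trans _ _ (`|c * nu ord0 i| - `|z ord0 i|)); last exact: lerB_dist.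
  rewrite normrM gtr0_norm// /c divfK ?gt_eqF//.
  by rewrite addrAC addrK ltrDl.
have := line_FTC (z - c *: nu) nu h1 c0; rewrite subrK hz subr0 => <-.
have Dm : measurable_fun setT (fun s : measurableTypeR R => 'D_nu h (z + s *: nu)).
  apply: continuous_measurable_fun => s.
  apply: (@continuous_comp _ _ _ (fun s : R => z + s *: nu) ('D_nu h)); last exact: (h1.2 nu).2.
  have hs : {for s, continuous (fun r : R => r *: nu)} by exact: scalel_continuous.
  exact: (@continuousD _ _ _ (cst z) (fun r : R => r *: nu) s (@cst_continuous _ _ z s) hs).
have Dmc : measurable_fun setT (fun s : measurableTypeR R => 'D_nu h (z - c *: nu + s *: nu)).
  apply: continuous_measurable_fun => s.
  apply: (@continuous_comp _ _ _ (fun s : R => z - c *: nu + s *: nu) ('D_nu h)); last exact: (h1.2 nu).2.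
  have hs : {for s, continuous (fun r : R => r *: nu)} by exact: scalel_continuous.
  exact: (@continuousD _ _ _ (cst (z - c *: nu)) (fun r : R => r *: nu) s (@cst_continuous _ _ _ s) hs).
apply: (@le_trans _ _ (\int[lam]_(s in `[0%R, c]) (`|'D_nu h (z - c *: nu + s *: nu)|)%:E)%E).
  apply: (le_trans (lee_abs _)); apply: (le_trans (le_abse_integral lam _ _)) => //.
  by apply/measurable_EFinP; apply: measurable_funTS.
apply: (@le_trans _ _ (\int[lam]_s (`|'D_nu h (z - c *: nu + s *: nu)|)%:E)%E).
  apply: ge0_subset_integral => //.
  by apply/measurable_EFinP; exact: measurableT_comp.
pose k (s : measurableTypeR R) := (`|'D_nu h (z + s *: nu)|)%:E.
have mk : measurable_fun setT k by apply/measurable_EFinP; exact: measurableT_comp.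
have k0 s : (0 <= k s)%E by rewrite lee_fin.
have e := @ge0_integral_lebesgue_affine R 1 (- c) k (oner_neq0 _) mk k0.
rewrite normr1 invr1 mul1e in e.
rewrite -[X in (_ <= X)%E]/(\int[lam]_s k s)%E -e.
rewrite le_eqVlt; apply/orP; left; apply/eqP; apply: eq_integral => s _.
by rewrite /k mul1r scalerBl [s *: nu - _]addrC addrA.
Qed.

(** Fubini in the coordinates (s, t) |-> b + s nu + t E: on each line in the
    direction nu the value at s = 0 is bounded by the integral. *)
Lemma slice_le (h : 'rV[R]_d.+1 -> R) (nu b : 'rV[R]_d.+1) (E : 'M[R]_(d, d.+1)) (N : R) :
  Ck 1 h -> (forall x, 0 <= h x) ->
  (forall x, h x != 0 -> forall i, `|x ord0 i| <= N) ->
  (col_mx nu E : 'M[R]_d.+1) \in unitmx ->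
  ((`|\det (col_mx nu E : 'M[R]_d.+1)|)%:E * \int[mu d]_t (h (b + t *m E))%:E <=
   \int[mu d.+1]_x (`|'D_nu h x|)%:E)%E.
Proof.
move=> h1 h0 hN uM; set M := (col_mx nu E : 'M[R]_d.+1).
have nu0 : nu != 0.
  apply: contraTneq uM => nu0; rewrite unitmxE (_ : \det _ = 0) ?unitr0//.
  rewrite (expand_det_row _ ord0) big1// => j _.
  by rewrite (_ : _ ord0 j = 0) ?mul0r// nu0 mxE; case: splitP => k; rewrite ?mxE.
have mD : measurable_fun setT (fun x => (`|'D_nu h x|)%:E).
  apply/measurable_EFinP; apply: measurableT_comp => //.
  by apply: continuous_measurable_rV; exact: (h1.2 nu).2.
rewrite (affine_rV_unit b uM mD)//.
rewrite lee_wpmul2l ?lee_fin//.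
have mDM : measurable_fun setT (fun x : 'rV[R]_d.+1 => (`|'D_nu h (b + x *m M)|)%:E).
  exact: (measurable_comp_affine b M mD).
rewrite (tonelli_rV2 mDM)//.
apply: ge0_le_integral => //.
- by move=> t _; rewrite lee_fin.
- apply/measurable_EFinP; apply: continuous_measurable_rV => t.
  apply: (@continuous_comp _ _ _ (fun t : 'rV[R]_d => b + t *m E) h); last exact: h1.1.
  exact: continuous_affine.
- exact: (measurable_tonelli_rV2 mDM).
move=> t _; under eq_integral do rewrite rV_cons_mul_col [_ *: nu + _]addrC addrA.
exact: (line_integral_ge _ h1 hN nu0).
Qed.

End slices.

Section trace_and_poincare.
Context {R : realType} {d : nat}.
Local Notation mu n := (@rV_lebesgue R n).
Variables (Omega : set 'rV[R]_d.+1) (psi : 'rV[R]_d.+1 -> R) (N : R).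
Hypotheses (mO : measurable Omega) (N0 : 0 < N).
Hypothesis ON : forall x, Omega x -> forall i, `|x ord0 i| <= N.
Hypotheses (psi1 : Ck 1 psi) (psiO : forall x, ~ Omega x -> psi x = 0).

Let bO : bounded_set Omega. Proof. exact: (@coord_bounded _ _ _ N). Qed.

Let sq := fun x => psi x * psi x.
Let sq1 : Ck 1 sq. Proof. exact: CkM. Qed.

Let sqN x : sq x != 0 -> forall i, `|x ord0 i| <= N.
Proof.
move=> h; apply: ON; apply: contrapT => /psiO p0.
by rewrite /sq p0 mulr0 eqxx in h.
Qed.

Let I := \int[mu d.+1]_(x in Omega) (`|psi x| * enorm (grad psi x)).

Let Ii : (mu d.+1).-integrable Omega (EFin \o (fun x => `|psi x| * enorm (grad psi x))).
Proof.
apply: continuous_integrable => // x.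
have c1 : {for x, continuous (fun x => `|psi x|)}.
  by apply: (@continuous_comp _ _ _ psi (fun r : R => `|r|)); [exact: psi1.1|exact: norm_continuous].
exact: (continuousM c1 (@continuous_enorm_grad _ _ _ psi1 x)).
Qed.

Lemma integral_derive_sqr (nu : 'rV[R]_d.+1) : enorm nu = 1 ->
  (\int[mu d.+1]_x (`|'D_nu sq x|)%:E <= (2 * I)%:E)%E.
Proof.
move=> nu1.
have E x : 'D_nu sq x = 2 * (psi x * 'D_nu psi x).
  have dp := (psi1.2 nu).1 x.
  transitivity (psi x * 'D_nu psi x + psi x * 'D_nu psi x); first exact: (deriveM dp dp).
  by ring.
rewrite (_ : (\int[mu d.+1]_x (`|'D_nu sq x|)%:E)%E = (\int[mu d.+1]_(x in Omega) (`|'D_nu sq x|)%:E)%E); last first.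
  rewrite [RHS]integral_mkcond; apply: eq_integral => x _; rewrite /patch.
  case: ifPn => // /negP xO'; have xO : ~ Omega x by move=> /mem_set.
  by rewrite E psiO// mul0r mulr0 normr0.
have -> : (2 * I)%:E = (\int[mu d.+1]_(x in Omega) (2 * (`|psi x| * enorm (grad psi x)))%:E)%E.
  rewrite /I -RintegralZl// /Rintegral fineK//.
  apply: integrable_fin_num => //.
  by have := integrableZl mO 2 Ii; apply: eq_integrable.
apply: ge0_le_integral => //.
- apply/measurable_EFinP; apply: measurable_funTS; apply: measurableT_comp => //.
  by apply: continuous_measurable_rV; exact: (sq1.2 nu).2.
- have := measurable_int _ Ii => /measurable_EFinP h.
  by apply/measurable_EFinP; apply: measurable_funM.
move=> x _; rewrite lee_fin E normrM normr_nat ler_wpM2l// normrM ler_wpM2l//.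
by rewrite derive_grad// (le_trans (dot_cauchy_schwarz _ _))// nu1 mulr1.
Qed.

(** Squares are controlled on the slices orthogonal to the first axis, and only
    an interval of length 2 N of slices meets the set. *)
Lemma poincare : \int[mu d.+1]_(x in Omega) (psi x ^+ 2) <= 4 * N * I.
Proof.
have ps2 : (mu d.+1).-integrable Omega (EFin \o (fun x => psi x ^+ 2)).
  by apply: continuous_integrable => //; exact: sq1.1.
suff : (\int[mu d.+1]_(x in Omega) (psi x ^+ 2)%:E <= (4 * N * I)%:E)%E.
  by move=> h; rewrite -lee_fin /Rintegral fineK//; exact: integrable_fin_num.
have -> : (\int[mu d.+1]_(x in Omega) (psi x ^+ 2)%:E)%E = (\int[mu d.+1]_x (sq x)%:E)%E.
  rewrite integral_mkcond; apply: eq_integral => x _; rewrite /patch.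
  case: ifPn => // /negP xO'; have xO : ~ Omega x by move=> /mem_set.
  by rewrite /sq psiO// mul0r.
have sq0 x : 0 <= sq x by rewrite /sq -expr2 sqr_ge0.
have msq : measurable_fun setT (fun x => (sq x)%:E).
  by apply/measurable_EFinP; apply: continuous_measurable_rV; exact: sq1.1.
rewrite (tonelli_rV1 msq)//.
pose e0 : 'rV[R]_d.+1 := delta_mx ord0 ord0.
pose E0 : 'M[R]_(d, d.+1) := @row_mx R d 1 d 0 1%:M.
have M1 : (col_mx e0 E0 : 'M[R]_d.+1) = 1%:M.
  rewrite (_ : e0 = @row_mx R 1 1 d 1%:M 0); first exact: (esym (@scalar_mx_block R 1 d 1)).
  apply/rowP => j; rewrite !mxE eqxx /=; case: splitP => k jk; rewrite !mxE.
    by rewrite !ord1 eqxx (_ : j = ord0) ?eqxx//; apply: ord_inj; rewrite jk ord1.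
  by rewrite (_ : (j == ord0) = false)//; apply/eqP => j0; rewrite j0 in jk.
have slice a : (\int[mu d]_y (sq (rV_cons (a, y)))%:E <= (2 * I)%:E * (\1_(`[- N, N]%classic : set R) a)%:E)%E.
  rewrite indicE; have [aN|aN] := boolP (a \in (`[- N, N]%classic : set R)); last first.
    rewrite mule0 integral0_eq// => y _; apply/congr1/eqP; apply: contraT => /sqN/(_ ord0).
    rewrite mxE unlift_none /= ler_norml => h; case/negP: aN; apply/mem_set.
    by rewrite /= in_itv.
  rewrite mule1.
  have uM : (col_mx e0 E0 : 'M[R]_d.+1) \in unitmx by rewrite M1 unitmx1.
  have := slice_le (a *: e0) sq1 sq0 sqN uM.
  rewrite M1 det1 normr1 mul1e.
  under eq_integral do rewrite -rV_cons_mul_col M1 mulmx1.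
  by move=> h; apply: le_trans h _; exact: integral_derive_sqr (enorm_delta _).
apply: (@le_trans _ _ (\int[lebesgue_measure]_a ((2 * I)%:E * (\1_(`[(- N)%R, N]%classic : set R) a)%:E))%E).
  apply: ge0_le_integral => //.
  - by move=> a _; apply: integral_ge0 => y _; rewrite lee_fin.
  - exact: (measurable_tonelli_rV1 msq).
  - by apply: emeasurable_funM => //; apply/measurable_EFinP; exact: measurable_indic.
rewrite ge0_integralZl//; last 2 first.
- by apply/measurable_EFinP; exact: measurable_indic.
- rewrite lee_fin mulr_ge0//; apply: Rintegral_ge0 => x _.
  by rewrite mulr_ge0// enorm_ge0.
rewrite integral_indic// setIT [X in (_ * X)%E](lebesgue_measure_itv `[- N, N])/= lte_fin.
rewrite (lt_trans _ N0) ?oppr_lt0// -EFinB -EFinM lee_fin.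
by rewrite opprK le_eqVlt; apply/orP; left; apply/eqP; ring.
Qed.

(** The facet is extended to its hyperplane, and the function integrated along
    the normal: the size of the simplex does not enter. *)
Lemma facet_trace (F : 'M[R]_(d.+2, d.+1)) a : edges F \in unitmx ->
  facet_area F a * surf (facet F a) (fun x => psi x ^+ 2) <= 2 * I.
Proof.
move=> uF; set nu := outer_normal F a; set E := edges (facet F a).
pose M := (col_mx nu E : 'M[R]_d.+1).
have nuE : E *m nu^T = 0.
  apply/matrixP => i j; rewrite ord1 [RHS]mxE.
  have -> : (E *m nu^T) i 0 = dot nu (row (lift a (lift ord0 i)) F - row (lift a ord0) F).
    by rewrite mxE; apply: eq_bigr => k _; rewrite !mxE mulrC.
  rewrite /nu outer_normalE// dotZl bary_grad_row// !(negbTE (neq_lift _ _)) subrr mulr0//.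
have nu1 : nu *m nu^T = 1%:M.
  by rewrite [LHS]mx11_scalar -dotE -enorm_sqr enorm_outer_normal// expr1n.
have MM : M *m M^T = block_mx (1%:M : 'M[R]_1) 0 0 (E *m E^T) :> 'M[R]_d.+1.
  rewrite /M (tr_col_mx nu E) (@mul_col_row _ 1 d d.+1 1 d) nu1 nuE.
  by rewrite -[nu *m E^T]trmxK trmx_mul trmxK nuE trmx0.
have detM : `|\det M| = facet_area F a.
  apply/eqP; rewrite /facet_area -(sqrtr_sqr (\det M)); apply/eqP; congr Num.sqrt.
  rewrite expr2 -{2}(det_tr M) -det_mulmx MM (@det_ublock _ 1 d) det1 mul1r //.
have uM : M \in unitmx.
  by rewrite unitmxE unitfE -normr_eq0 detM gt_eqF// gram_facet_gt0.
have sq0 x : 0 <= sq x by rewrite /sq -expr2 sqr_ge0.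
have := slice_le (row ord0 (facet F a)) sq1 sq0 sqN uM; rewrite -/M detM => h.
have {h} := le_trans h (integral_derive_sqr (enorm_outer_normal a uF)) => h.
rewrite -lee_fin; apply: le_trans h; rewrite EFinM lee_wpmul2l ?lee_fin ?sqrtr_ge0//.
have cc : continuous (fun t : 'rV[R]_d => psi (param (facet F a) t) ^+ 2).
  rewrite (_ : (fun t : 'rV[R]_d => _) = sq \o param (facet F a)); last by apply/funext => t; rewrite /sq expr2.
  by apply: continuous_comp_param; exact: sq1.1.
rewrite /surf /Rintegral fineK; last first.
  apply: integrable_fin_num; first exact: measurable_ref_simplex.
  exact: (integrable_ref_simplex cc).
apply: ge0_subset_integral => //.
- exact: measurable_ref_simplex.
- by apply/measurable_EFinP; apply: continuous_measurable_rV; exact: cc.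
- by move=> t _; rewrite lee_fin sqr_ge0.
Qed.

End trace_and_poincare.

(** * Interfaces of a conforming mesh *)

Section shared_facets.
Context {R : realType} {d : nat}.
Implicit Types F G : 'M[R]_(d.+2, d.+1).

Definition facet_rows F a := [seq row b (facet F a) | b : 'I_d.+1].

Lemma row_facet F a b : row b (facet F a) = row (lift a b) F.
Proof. by apply/rowP => k; rewrite !mxE. Qed.

Lemma facet_rowsP F a x : reflect (exists2 v, v != a & x = row v F) (x \in facet_rows F a).
Proof.
apply: (iffP mapP) => [[b _ ->]|[v va ->]].
  by exists (lift a b); rewrite ?row_facet// eq_sym neq_lift.
case: (unliftP a v) va => [b ->|->]; last by rewrite eqxx.
by move=> _; exists b; rewrite ?mem_enum ?row_facet.
Qed.

Lemma facet_rows_uniq F a : edges F \in unitmx -> uniq (facet_rows F a).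
Proof.
move=> uF; rewrite map_inj_uniq ?enum_uniq// => b c; rewrite !row_facet.
by move=> /(vertex_inj uF)/lift_inj.
Qed.

Lemma facet_rows_perm F a G b : perm_eq (facet_rows F a) (facet_rows G b) ->
  exists s : 'S_d.+1, facet F a = row_perm s (facet G b).
Proof.
move=> h.
pose tF := [tuple row c (facet F a) | c < d.+1]; pose tG := [tuple row c (facet G b) | c < d.+1].
have : perm_eq tF tG by [].
move=> /tuple_permP[s e]; exists s; apply/row_matrixP => c.
have := congr1 (fun l => nth 0 l c) e.
rewrite -tnth_nth tnth_mktuple => ->.
rewrite (nth_map ord0) ?size_enum_ord// nth_ord_enum tnth_mktuple.
by apply/rowP => k; rewrite !mxE.
Qed.

Lemma row_perm_vertices F G : edges F \in unitmx -> edges G \in unitmx ->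
  (forall v, exists v', row v F = row v' G) -> exists s : 'S_d.+2, F = row_perm s G.
Proof.
move=> uF uG h.
have [f hf] := choice h.
have fi : injective f.
  by move=> v w e; apply: (vertex_inj uF); rewrite /= !hf e.
exists (perm fi); apply/row_matrixP => v; rewrite hf.
by apply/rowP => k; rewrite !mxE permE.
Qed.

(** The coordinate of a grows along v, and the others stay positive for a short
    while. *)
Lemma inward_near F a x v : edges F \in unitmx ->
  bary F x ord0 a = 0 -> (forall b, b != a -> 0 < bary F x ord0 b) ->
  0 < dot v (bary_grad F a) ->
  \forall t \near (0 : R)^'+, open_simplex F (x + t *: v).
Proof.
move=> uF xa xb va.
have near_b : \forall t \near (0 : R)^'+, forall b, 0 < bary F (x + t *: v) ord0 b.
  apply: (@filter_forall _ _ _ ((0:R)^'+)) => b.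
  have [->|ba] := eqVneq b a.
    near=> t; rewrite bary_shift// xa add0r dotZl mulr_gt0//; near: t; exact: nbhs_right_gt.
  pose e := bary F x ord0 b / (`|dot v (bary_grad F b)| + 1).
  have n0 : 0 < `|dot v (bary_grad F b)| + 1 by rewrite ltr_wpDl.
  have e0 : 0 < e by rewrite divr_gt0// xb.
  near=> t.
  have t0 : 0 < t by near: t; exact: nbhs_right_gt.
  have te : t < e by near: t; exact: nbhs_right_lt.
  rewrite bary_shift// dotZl -ltrBlDl sub0r.
  have h1 : - (t * dot v (bary_grad F b)) <= t * `|dot v (bary_grad F b)|.
    by rewrite -mulrN ler_wpM2l ?(ltW t0)// (le_trans (ler_norm _))// normrN.
  rewrite ltrNl; apply: (le_lt_trans h1); move: te; rewrite /e ltr_pdivlMr// => te.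
  by apply: lt_trans te; rewrite ltr_pM2l// ltrDl.
by apply: filterS near_b => t h; apply/open_simplexP.
Unshelve. all: by end_near.
Qed.

Definition facet_center F a : 'rV[R]_d.+1 := const_mx (d.+1%:R^-1) *m facet F a.

Lemma facet_center_bary F a : edges F \in unitmx ->
  bary F (facet_center F a) ord0 a = 0 /\ forall b, b != a -> 0 < bary F (facet_center F a) ord0 b.
Proof.
move=> uF.
have w1 : \sum_i (const_mx (d.+1%:R^-1) : 'rV[R]_d.+1) ord0 i = 1.
  by under eq_bigr do rewrite mxE; rewrite sumr_const card_ord -[_ *+ _]mulr_natr mulVf// pnatr_eq0.
have E b : bary F (facet_center F a) ord0 b = \sum_c d.+1%:R^-1 * (lift a c == b)%:R.
  rewrite bary_convex//; apply: eq_bigr => c _; rewrite [in LHS]mxE; congr (_ * _).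
  by rewrite row_facet bary_row// mxE eqxx eq_sym.
split=> [|b ba].
  by rewrite E big1// => c _; rewrite eq_sym (negbTE (neq_lift _ _)) mulr0.
case: (unliftP a b) ba => [c ->|->]; last by rewrite eqxx.
move=> _; rewrite E (bigD1 c)//= eqxx mulr1 ltr_wpDr// ?invr_gt0//.
by apply: sumr_ge0 => k _; rewrite mulr_ge0 ?invr_ge0.
Qed.

(** The centre of the facet, moved a little inwards, lies in both simplices. *)
Lemma same_side_overlap F a G b c : edges F \in unitmx -> edges G \in unitmx ->
  perm_eq (facet_rows F a) (facet_rows G b) ->
  bary_grad G b = c *: bary_grad F a -> 0 < c ->
  exists x, open_simplex F x /\ open_simplex G x.
Proof.
move=> uF uG h gc c0; set v := bary_grad F a.
have [s fs] := facet_rows_perm h.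
have pe : facet_center F a = facet_center G b.
  rewrite /facet_center fs row_permE mulmxA; congr (_ *m _).
  have -> : const_mx d.+1%:R^-1 *m perm_mx s = col_perm s^-1 (const_mx d.+1%:R^-1 : 'rV[R]_d.+1) by rewrite col_permE invgK.
  by apply/rowP => k; rewrite !mxE.
have vv : 0 < dot v v.
  by rewrite -enorm_sqr exprn_gt0// enorm_gt0 bary_grad_neq0.
have [a0 a1] := facet_center_bary a uF; have [b0 b1] := facet_center_bary b uG.
have n1 := inward_near uF a0 a1 vv.
have n2 := @inward_near G b _ v uG b0 b1.
have vg : 0 < dot v (bary_grad G b) by rewrite gc dotZr mulr_gt0.
have {n2}n2 := n2 vg.
rewrite pe in n1.
have [t [t1 t2]] := filter_ex (filterI n1 n2).
by exists (facet_center G b + t *: v).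
Qed.

(** Both gradients are normal to the common facet. *)
Lemma shared_facet_grad F a G b : edges F \in unitmx -> edges G \in unitmx ->
  perm_eq (facet_rows F a) (facet_rows G b) ->
  exists2 c, c != 0 & bary_grad G b = c *: bary_grad F a.
Proof.
move=> uF uG h.
have [c gc] : exists al, bary_grad G b = al *: bary_grad F a.
  apply: normal_unique => // v w va wa.
  have /facet_rowsP[v' v'b ->] : row v F \in facet_rows G b.
    by rewrite -(perm_mem h); apply/facet_rowsP; exists v.
  have /facet_rowsP[w' w'b ->] : row w F \in facet_rows G b.
    by rewrite -(perm_mem h); apply/facet_rowsP; exists w.
  by rewrite bary_grad_row// eq_sym (negbTE v'b) eq_sym (negbTE w'b) subrr.
exists c => //; apply: contraTneq (bary_grad_neq0 b uG) => c0.
by rewrite gc c0 scale0r eqxx.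
Qed.

Lemma facet_rows_inj F a b : edges F \in unitmx ->
  perm_eq (facet_rows F a) (facet_rows F b) -> a = b.
Proof.
move=> uF h; apply/eqP; apply: contraT => ab.
have : row b F \in facet_rows F a by apply/facet_rowsP; exists b; rewrite // eq_sym.
rewrite (perm_mem h) => /facet_rowsP[v vb /(vertex_inj uF) bv].
by rewrite -bv eqxx in vb.
Qed.

End shared_facets.

Section conforming.
Context {R : realType} {d : nat}.
Variables (Omega : set 'rV[R]_d.+1) (T : mesh R d).
Hypotheses (oO : open Omega) (tT : triangulation Omega T).

Lemma elt_unit (i : 'I_(nelt T)) : edges (vertices i) \in unitmx.
Proof. by case: tT => h _ _ _ _; rewrite -row_free_unit. Qed.

(** Overlapping elements would share a full simplex, hence have the same
    vertices. *)
Lemma elt_disjoint (i j : 'I_(nelt T)) x : elt i x -> elt j x -> i = j.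
Proof.
move=> xi xj; apply/eqP; apply: contraT => ij.
case: tT => _ _ einj /(_ i j ij)[S [S' [eS eS']]] _.
have sub (k : 'I_(nelt T)) y (Sk : {set 'I_d.+2}) : elt k y -> subsimplex (vertices k) Sk y -> Sk = [set: 'I_d.+2]%SET.
  move=> /(open_simplexP (elt_unit k)) h /(subsimplexP (elt_unit k))[_ h0].
  apply/setP => v; rewrite inE; apply: contraT => vS.
  by have := h v; rewrite h0// ltxx.
have xx : (closure (elt i) `&` closure (elt j)) x by split; exact: subset_closure.
have ST : S = [set: 'I_d.+2]%SET by apply: (sub i x) => //; rewrite -eS.
have ST' : S' = [set: 'I_d.+2]%SET by apply: (sub j x) => //; rewrite -eS'.
have e : subsimplex (vertices i) [set: 'I_d.+2] = subsimplex (vertices j) [set: 'I_d.+2].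
  by rewrite -{1}ST -ST' -eS -eS'.
have [s es] : exists s : 'S_d.+2, vertices i = row_perm s (vertices j).
  apply: row_perm_vertices; [exact: elt_unit|exact: elt_unit|] => v.
  have [|v' _ ev] := subsimplex_vertex (v := v) (elt_unit i) (elt_unit j) e; first by rewrite inE.
  by exists v'.
have : elt i = elt j by rewrite /elt es open_simplex_row_perm// elt_unit.
by move/einj => eij; rewrite eij eqxx in ij.
Qed.

Definition adjacent (s s' : side T) :=
  (s.1 != s'.1) && perm_eq (facet_rows (vertices s.1) s.2) (facet_rows (vertices s'.1) s'.2).

Lemma adjacentE s s' : adjacent s s' = interface (s, s') || interface (s', s).
Proof.
rewrite /adjacent /interface /= -/(facet_rows _ _) -/(facet_rows _ _).
rewrite [perm_eq (facet_rows (vertices s'.1) _) _]perm_sym -andb_orl; congr (_ && _).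
by rewrite -neq_ltn.
Qed.

(** If there were three elements at one facet, two of them would be on the same side. *)
Lemma adjacent_unique s s1 s2 : adjacent s s1 -> adjacent s s2 -> s1 = s2.
Proof.
case: s s1 s2 => [i a] [j b] [k c] /andP[/= ij hj] /andP[/= ik hk].
have ui := elt_unit i; have uj := elt_unit j; have uk := elt_unit k.
have [cj cj0 gj] := shared_facet_grad ui uj hj.
have [ck ck0 gk] := shared_facet_grad ui uk hk.
have neg l e (z : R) : i != l -> perm_eq (facet_rows (vertices i) a) (facet_rows (vertices l) e) ->
    bary_grad (vertices l) e = z *: bary_grad (vertices i) a -> z != 0 -> z < 0.
  move=> il hl gl z0; rewrite lt_neqAle z0 leNgt; apply/negP => zp.
  have [x [x1 x2]] := same_side_overlap ui (elt_unit l) hl gl zp.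
  by have := elt_disjoint x1 x2; move/eqP: il.
have cjn := neg _ _ _ ij hj gj cj0.
have ckn := neg _ _ _ ik hk gk ck0.
have hjk : perm_eq (facet_rows (vertices j) b) (facet_rows (vertices k) c).
  by rewrite perm_sym in hj; exact: perm_trans hj hk.
have gjk : bary_grad (vertices k) c = (ck / cj) *: bary_grad (vertices j) b.
  by rewrite gj scalerA divfK.
have cc : 0 < ck / cj by rewrite nmulr_rgt0 ?invr_lt0.
have [x [x1 x2]] := same_side_overlap uj uk hjk gjk cc.
have jk := elt_disjoint x1 x2.
by move: hjk; rewrite -jk => /(facet_rows_inj uj) ->.
Qed.

(** Just across the facet the domain is covered by other elements; by
    conformity such an element shares the whole facet. *)
Lemma facet_neighbour i a x : Omega x ->
  bary (vertices i) x ord0 a = 0 -> (forall b, b != a -> 0 < bary (vertices i) x ord0 b) ->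
  exists s', adjacent (i, a) s'.
Proof.
move=> Ox xa xb; have ui := elt_unit i.
pose g := bary_grad (vertices i) a.
have gg : 0 < dot g g by rewrite -enorm_sqr exprn_gt0// enorm_gt0 bary_grad_neq0.
pose C := \bigcup_(j in [set j | j != i]) closure (@elt R d T j).
have cC : closed C.
  apply: closed_bigcup => [|j _]; last exact: closed_closure.
  exact: finite_finset.
have cy : continuous (fun t : R => x - t *: g).
  move=> t; have hs : {for t, continuous (fun r : R => r *: g)} by exact: scalel_continuous.
  have hn : {for t, continuous (fun r : R => - (r *: g))} by exact: (continuousN hs).
  exact: (@continuousD _ _ _ (cst x) (fun r : R => - (r *: g)) t (@cst_continuous _ _ x t) hn).
(* the points x - t g leave the element i across the facet *)
have xC : C x.
  rewrite ((closure_id C).1 cC).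
  have x0 : x = x - (0 : R) *: g by rewrite scale0r subr0.
  move=> B nB; rewrite x0 in nB.
  have n1 : \forall t \near (0 : R)^'+, B (x - t *: g) by exact: (cvg_at_right_filter (cy 0)).
  have n2 : \forall t \near (0 : R)^'+, Omega (x - t *: g).
    have : nbhs (x - (0 : R) *: g) Omega by rewrite -x0; exact: open_nbhs_nbhs.
    exact: (cvg_at_right_filter (cy 0)).
  have n3 : \forall t \near (0 : R)^'+, 0 < t by exact: nbhs_right_gt.
  have [t [[t1 t2] t3]] := filter_ex (filterI (filterI n1 n2) n3).
  exists (x - t *: g); split=> //.
  case: tT => _ _ _ _ cov; have [j _ hj] := cov _ (subset_closure t2).
  exists j => //=; apply/eqP => ji; move: hj; rewrite ji closure_open_simplex//.
  move=> /(subsimplexP ui)[/(_ a)]; rewrite -scaleNr bary_shift xa add0r dotZl mulNr oppr_ge0.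
  by rewrite leNgt mulr_gt0.
case: xC => j /= ji xj; have uj := elt_unit j.
have ij : i != j by rewrite eq_sym.
case: tT => _ _ _ /(_ i j ij)[S [S' [eS eS']]] _.
have xi : closure (elt i) x.
  rewrite closure_open_simplex//; apply/subsimplexP => //; split=> b; last by rewrite inE.
  by have [->|/xb/ltW//] := eqVneq b a; rewrite xa.
have xS : subsimplex (vertices i) S x by rewrite -eS.
have SP b : b != a -> b \in S.
  move=> ba; apply: contraT => bS; move/(subsimplexP ui): xS => [_ /(_ b bS) b0].
  by have := xb b ba; rewrite b0 ltxx.
(* otherwise the elements i and j would overlap *)
have aS : a \notin S.
  apply/negP => aS.
  have ST : S = [set: 'I_d.+2]%SET.
    by apply/setP => b; rewrite inE; have [->//|/SP] := eqVneq b a.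
  have [y yi] := open_simplex_nonempty ui.
  have : closure (elt j) y.
    have : (closure (elt i) `&` closure (elt j)) y.
      by rewrite eS ST -closure_open_simplex//; exact: subset_closure.
    by case.
  move=> /(_ (elt i)) h.
  have [|z [zj zi]] := h _.
    by apply: open_nbhs_nbhs; split=> //; exact: open_open_simplex.
  by have jie := elt_disjoint zj zi; rewrite jie eqxx in ji.
have SE : S = [set~ a]%SET.
  apply/setP => b; rewrite !inE; have [->|ba] := eqVneq b a; first by rewrite (negbTE aS).
  by rewrite SP.
have e : subsimplex (vertices i) S = subsimplex (vertices j) S' by rewrite -eS -eS'.
have le (F G : 'M[R]_(d.+2, d.+1)) (P Q : {set 'I_d.+2}) : edges F \in unitmx -> edges G \in unitmx ->
    subsimplex F P = subsimplex G Q -> (#|P| <= #|Q|)%N.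
  move=> uF uG ePQ.
  have [f hf] : {f : 'I_d.+2 -> 'I_d.+2 & forall v, v \in P -> f v \in Q /\ row v F = row (f v) G}.
    apply: (@choice _ _ (fun v w => v \in P -> w \in Q /\ row v F = row w G)) => v.
    have [vP|vP] := boolP (v \in P); last by exists v.
    by have [w wQ ew] := subsimplex_vertex uF uG ePQ vP; exists w.
  rewrite -(card_in_imset (f := f)); last first.
    move=> v w vP wP fvw; apply: (vertex_inj uF) => /=.
    by rewrite (hf v vP).2 (hf w wP).2 fvw.
  by apply: subset_leq_card; apply/fintype.subsetP => _ /imsetP[v vP ->]; exact: (hf v vP).1.
have cS' : #|S'| = d.+1.
  have -> : #|S'| = #|S| by apply/eqP; rewrite eqn_leq (le _ _ _ _ uj ui (esym e)) (le _ _ _ _ ui uj e).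
  by rewrite SE cardsC1 card_ord.
have [b S'E] : exists b, S' = [set~ b]%SET.
  have /cards1P[b eb] : #|~: S'| == 1%N by rewrite cardsCs finset.setCK cS' card_ord subSnn.
  by exists b; rewrite -eb finset.setCK.
exists (j, b); rewrite /adjacent /= eq_sym ji /=.
apply: uniq_perm; [exact: facet_rows_uniq|exact: facet_rows_uniq|] => r.
apply/facet_rowsP/facet_rowsP => -[v va ->].
  have [|w wS' ew] := subsimplex_vertex (v := v) ui uj e; first by rewrite SE !inE.
  by exists w => //; rewrite S'E !inE in wS'.
have [|w wS ew] := subsimplex_vertex (v := v) uj ui (esym e); first by rewrite S'E !inE.
by exists w => //; rewrite SE !inE in wS.
Qed.

(** A side has at most one neighbour, hence belongs to at most one interface. *)
Lemma sum_sides (B : side T -> R) :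
  (forall s, (forall s', ~~ adjacent s s') -> B s = 0) ->
  \sum_s B s = \sum_(e : side T * side T | interface e) (B e.1 + B e.2).
Proof.
move=> B0; rewrite big_split /=.
have e1 : \sum_(e : side T * side T | interface e) B e.1 = \sum_s \sum_(s' | interface (s, s')) B s.
  by rewrite pair_big_dep /=; apply: eq_bigl => -[].
have e2 : \sum_(e : side T * side T | interface e) B e.2 = \sum_s \sum_(s' | interface (s', s)) B s.
  rewrite (exchange_big_dep xpredT)//= pair_big_dep /=; apply: eq_bigl => -[] //.
rewrite e1 e2 -big_split /=; apply: eq_bigr => s _.
have -> : \sum_(s' | interface (s, s')) B s + \sum_(s' | interface (s', s)) B s = \sum_(s' | adjacent s s') B s.
  rewrite [RHS](bigID (fun s' => interface (s, s'))) /=; congr (_ + _); apply: eq_bigl => s'.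
    by rewrite adjacentE; case: (boolP (interface (s, s'))) => //= _; rewrite andbF.
  rewrite adjacentE; have [h|] := boolP (interface (s, s')); last by rewrite andbT.
  rewrite andbF; apply/negbTE/negP => h'; move: h h'; rewrite /interface /= => /andP[h _] /andP[h' _].
  by have := ltn_trans h h'; rewrite ltnn.
case: (pickP (adjacent s)) => [s1 a1|h]; last by rewrite big_pred0// B0// => s'; rewrite h.
rewrite (big_pred1 s1)// => s' /=; apply/idP/eqP => [a'|->//].
exact: adjacent_unique a' a1.
Qed.

End conforming.

(** * Regularity of the conservation law *)

Section smooth_composites.
Context {R : realType}.

(** The analogue of Ck 1 for maps between normed spaces, as needed for functions
    of several groups of variables. *)
Definition C1on (V W : normedModType R) (G : V -> W) :=
  continuous G /\ forall v, (forall x, derivable G x v) /\ continuous ('D_v G).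

Lemma smooth_C1on (V W : normedModType R) (G : V -> W) : smooth_on setT G -> C1on G.
Proof.
move=> sG; split=> [x|v]; first exact: (sG [::] x I).1.
by split=> x; [exact: ((sG [::] x I).2 v)|exact: (sG [:: v] x I).1].
Qed.

Lemma C1on_coord (V : normedModType R) n (G : V -> 'rV[R]_n) i :
  C1on G -> C1on (fun z => G z ord0 i).
Proof.
move=> [cG dG]; split=> [x|v].
  by have h := @continuous_coord _ _ _ G x i (cG x); exact: h.
have [dG1 dG2] := dG v; split=> [x|].
  exact: ((derivable_mxP G x v).1 (dG1 x)).
rewrite (_ : 'D_v _ = fun z => ('D_v G z) ord0 i).
  by move=> x; have h := @continuous_coord _ _ _ ('D_v G) x i (dG2 x); exact: h.
by apply/funext => z; rewrite derive_mx// mxE.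
Qed.

(** Only directional derivatives are involved, which an affine substitution maps
    to directional derivatives. *)
Lemma C1on_affine (V : normedModType R) n (G : V -> R) (a a' : 'rV[R]_n -> V) :
  C1on G -> continuous a ->
  (forall h x v, a (h *: v + x) = h *: a' v + a x) -> Ck 1 (G \o a).
Proof.
move=> [cG dG] ca ha; split=> [x|v].
  by apply: continuous_comp; [exact: ca|exact: cG].
have E x := @derive_along _ _ _ _ a G x v (a' v) (fun h => ha h x v).
split=> [x|]; first by apply: (E x).2; exact: (dG (a' v)).1.
rewrite (_ : 'D_v _ = 'D_(a' v) G \o a); last by apply/funext => x; exact: (E x).1.
by move=> x; apply: continuous_comp; [exact: ca|exact: (dG (a' v)).2].
Qed.

Lemma smooth_C1 n (f : 'rV[R]_n -> R) : smooth_on setT f -> Ck 1 f.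
Proof.
move=> /smooth_C1on sf; have := @C1on_affine _ n f id id sf.
by apply => // x; exact: cvg_id.
Qed.

End smooth_composites.

(** The algebraic shape of a component of the conservation law. *)
Lemma Ck_noether {R : realType} n k (a b c e : 'rV[R]_n -> R) (g h : 'I_n -> 'rV[R]_n -> R) :
  Ck k a -> Ck k b -> Ck k c -> Ck k e -> (forall i, Ck k (g i)) -> (forall i, Ck k (h i)) ->
  Ck k (fun x => - (a x * b x + (c x - \sum_i (g i x * h i x)) * e x)).
Proof.
move=> ha hb hc he hg hh.
have ab : Ck k (fun x => a x * b x) by exact: CkM.
have gh : Ck k (fun x => - \sum_i (g i x * h i x)).
  by apply: CkN; apply: Ck_sum => i; exact: CkM.
have ce := CkM (CkD hc gh) he.
exact: CkN (CkD ab ce).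
Qed.

Section conservation.
Context {R : realType} {n : nat}.
Variables (L : 'rV[R]_n -> R -> 'rV[R]_n -> R)
    (Xi : 'rV[R]_n -> R -> R -> 'rV[R]_n) (Phi : 'rV[R]_n -> R -> R -> R)
    (xi : 'rV[R]_n -> R -> 'rV[R]_n) (phi : 'rV[R]_n -> R -> R).
Hypotheses (hL : smooth_lagrangian L) (hgroup : one_parameter_group Xi Phi)
  (hinf : infinitesimals Xi Phi xi phi).

Let LL := fun z : 'rV[R]_n * R * 'rV[R]_n => L z.1.1 z.1.2 z.2.
Let XX := fun z : 'rV[R]_n * R * R => Xi z.1.1 z.1.2 z.2.
Let PP := fun z : 'rV[R]_n * R * R => Phi z.1.1 z.1.2 z.2.
Let e1 : 'rV[R]_n * R * R := ((0, 0), 1).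

(** An infinitesimal is the limit of the derivatives in the group parameter; as
    these are continuous, it is a directional derivative of a smooth map. *)
Lemma generator_derive (V : normedModType R) (Z : 'rV[R]_n -> R -> R -> V) (z : V) x u :
  smooth_on setT (fun w : 'rV[R]_n * R * R => Z w.1.1 w.1.2 w.2) ->
  derive1 (Z x u) @ 0^' --> z ->
  z = 'D_e1 (fun w : 'rV[R]_n * R * R => Z w.1.1 w.1.2 w.2) (x, u, 0).
Proof.
move=> sZ hz.
set ZZ := (fun w : 'rV[R]_n * R * R => Z w.1.1 w.1.2 w.2).
have E (t : R) : derive1 (Z x u) t = 'D_e1 ZZ (x, u, t).
  rewrite derive1E; have [|<- _] := @derive_along _ _ _ _ (fun t : R => (x, u, t)) ZZ t 1 e1.
    move=> h; congr ((_, _), _); rewrite /= ?scaler0 ?mulr0 ?add0r//.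
  by [].
have ct : {for (0 : R), continuous (fun t : R => (x, u, t))}.
  have h := @cvg_pair _ _ _ _ _ _ _ _ _ _ _ (@cvg_cst _ (x, u) R (nbhs 0) _) (@cvg_id _ (nbhs (0 : R))).
  exact: h.
have cd : {for (x, u, 0 : R), continuous ('D_e1 ZZ)} by exact: (sZ [:: e1] _ I).1.
have c0 : 'D_e1 ZZ (x, u, t) @[t --> 0^'] --> 'D_e1 ZZ (x, u, 0 : R).
  apply: cvg_within_filter.
  exact: (@continuous_comp _ _ _ (fun t : R => (x, u, t)) ('D_e1 ZZ) 0 ct cd).
apply: (@norm_cvg_unique _ _ ((derive1 (Z x u)) @ 0^') _) => //.
by rewrite (_ : derive1 (Z x u) = fun t => 'D_e1 ZZ (x, u, t))//; apply/funext.
Qed.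

Lemma xiE x u : xi x u = 'D_e1 XX (x, u, 0).
Proof. by case: hgroup => sX _ _ _ _; exact: (generator_derive sX (hinf x u).1). Qed.

Lemma phiE x u : phi x u = 'D_e1 PP (x, u, 0).
Proof. by case: hgroup => _ sP _ _ _; exact: (generator_derive sP (hinf x u).2). Qed.

Let N := (n + 1 + n)%N.
Let px (y : 'rV[R]_N) : 'rV[R]_n := lsubmx (lsubmx y).
Let pu (y : 'rV[R]_N) : R := (rsubmx (lsubmx y)) ord0 ord0.
Let pp (y : 'rV[R]_N) : 'rV[R]_n := rsubmx y.

Let pxc : continuous px.
Proof.
move=> y; apply: continuous_rV => i.
rewrite (_ : (fun y => _) = (fun y : 'rV[R]_N => y ord0 (lshift n (lshift 1 i)))); first exact: coord_continuous.
by apply/funext => z; rewrite !mxE.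
Qed.
Let puc : continuous pu.
Proof.
rewrite (_ : pu = (fun y : 'rV[R]_N => y ord0 (lshift n (rshift n ord0)))).
  by move=> y; exact: coord_continuous.
by apply/funext => z; rewrite /pu !mxE.
Qed.
Let ppc : continuous pp.
Proof.
move=> y; apply: continuous_rV => i.
rewrite (_ : (fun y => _) = (fun y : 'rV[R]_N => y ord0 (rshift (n + 1) i))); first exact: coord_continuous.
by apply/funext => z; rewrite !mxE.
Qed.

Let aL y := (px y, pu y, pp y).
Let aX y := (px y, pu y, 0 : R).

Let continuous_pair (U V W : topologicalType) (f : U -> V) (g : U -> W) x :
  {for x, continuous f} -> {for x, continuous g} ->
  {for x, continuous (fun y => (f y, g y))}.
Proof. by move=> cf cg; have h := @cvg_pair _ _ _ _ _ _ _ _ _ _ _ cf cg; exact: h. Qed.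

Let aLc : continuous aL.
Proof. by move=> y; apply: continuous_pair; [apply: continuous_pair; [exact: pxc|exact: puc]|exact: ppc]. Qed.
Let aXc : continuous aX.
Proof. by move=> y; apply: continuous_pair; [apply: continuous_pair; [exact: pxc|exact: puc]|exact: cst_continuous]. Qed.
Let pxl (h : R) x v : px (h *: v + x) = h *: px v + px x.
Proof. by apply/rowP => i; rewrite !mxE. Qed.
Let pul (h : R) x v : pu (h *: v + x) = h * pu v + pu x.
Proof. by rewrite /pu !mxE. Qed.
Let ppl (h : R) x v : pp (h *: v + x) = h *: pp v + pp x.
Proof. by apply/rowP => i; rewrite !mxE. Qed.
Let aLl (h : R) x v : aL (h *: v + x) = h *: aL v + aL x.
Proof. by rewrite /aL pxl pul ppl. Qed.
Let aXl (h : R) x v : aX (h *: v + x) = h *: aX v + aX x.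
Proof.
rewrite /aX pxl pul; rewrite [RHS](_ : _ = ((h *: px v + px x, h * pu v + pu x), h * 0 + 0))//.
by rewrite mulr0 addr0.
Qed.

(** The jet is one vector, as C1_comp composes with vector valued maps. *)
Let jet (p : 'rV[R]_n -> R) x : 'rV[R]_N := row_mx (row_mx x ((p x)%:M : 'M[R]_1)) (grad p x).

Let jet_x p x : px (jet p x) = x. Proof. by rewrite /px /jet !row_mxKl. Qed.
Let jet_u p x : pu (jet p x) = p x. Proof. by rewrite /pu /jet row_mxKl row_mxKr mxE eqxx. Qed.
Let jet_p p x : pp (jet p x) = grad p x. Proof. by rewrite /pp /jet row_mxKr. Qed.

Let jet_C1 p i : Ck 2 p -> Ck 1 (fun x => jet p x ord0 i).
Proof.
move=> p2; rewrite /jet; case: (split_ordP i) => j ->.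
  case: (split_ordP j) => k ->.
    rewrite (_ : (fun x => _) = (fun x : 'rV[R]_n => x ord0 k)); first exact: Ck_coord.
    by apply/funext => x; rewrite !row_mxEl.
  rewrite (_ : (fun x => _) = p); first exact: CkS.
  by apply/funext => x; rewrite row_mxEl row_mxEr mxE !ord1 mulr1n.
rewrite (_ : (fun x => _) = 'D_(delta_mx ord0 j) p); first exact: (p2.2 _).2.
by apply/funext => x; rewrite row_mxEr mxE.
Qed.

Let compose_L (G : 'rV[R]_n * R * 'rV[R]_n -> R) p : C1on G -> Ck 2 p ->
  Ck 1 (fun x => G (x, p x, grad p x)).
Proof.
move=> G1 p2.
have := C1_comp (C1on_affine G1 aLc aLl) (fun i => jet_C1 i p2).
rewrite (_ : (G \o aL) \o jet p = (fun x => G (x, p x, grad p x)))//.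
by apply/funext => x; rewrite /= /aL jet_x jet_u jet_p.
Qed.

Let compose_X (G : 'rV[R]_n * R * R -> R) p : C1on G -> Ck 2 p ->
  Ck 1 (fun x => G (x, p x, 0)).
Proof.
move=> G1 p2.
have := C1_comp (C1on_affine G1 aXc aXl) (fun i => jet_C1 i p2).
rewrite (_ : (G \o aX) \o jet p = (fun x => G (x, p x, 0)))//.
by apply/funext => x; rewrite /= /aX jet_x jet_u.
Qed.

(** The law is a smooth function of (x, p, grad p), and grad p is C1. *)
Lemma conservation_law_C1 p : Ck 2 p ->
  forall i, Ck 1 (fun x => conservation_law L xi phi p x ord0 i).
Proof.
move=> p2 i.
have [sX sP _ _ _] := hgroup.
pose el i : 'rV[R]_n * R * 'rV[R]_n := ((0, 0), delta_mx ord0 i).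
have gL x u q : grad (L x u) q ord0 i = 'D_(el i) LL (x, u, q).
  rewrite mxE; have [|<- _] := @derive_along _ _ _ _ (fun q : 'rV[R]_n => (x, u, q)) LL q (delta_mx ord0 i) (el i).
    by move=> h; congr ((_, _), _); rewrite /= ?scaler0 ?mulr0 ?add0r.
  by [].
have cL : Ck 1 (fun x => LL (x, p x, grad p x)) by apply: compose_L => //; exact: smooth_C1on.
have cDL : Ck 1 (fun x => 'D_(el i) LL (x, p x, grad p x)).
  apply: (compose_L (G := 'D_(el i) LL)) => //.
  apply: smooth_C1on; exact: smooth_derive.
have cxi k : Ck 1 (fun x => xi x (p x) ord0 k).
  rewrite (_ : (fun x => _) = (fun x => ('D_e1 XX (x, p x, 0)) ord0 k)).
    apply: (compose_X (G := fun z => ('D_e1 XX z) ord0 k)) => //.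
    by apply: C1on_coord; apply: smooth_C1on; exact: smooth_derive.
  by apply/funext => x; rewrite xiE.
have cphi : Ck 1 (fun x => phi x (p x)).
  rewrite (_ : (fun x => _) = (fun x => 'D_e1 PP (x, p x, 0))).
    by apply: (compose_X (G := 'D_e1 PP)) => //; apply: smooth_C1on; exact: smooth_derive.
  by apply/funext => x; rewrite phiE.
have := Ck_noether cL (cxi i) cphi cDL cxi (fun k => (p2.2 (delta_mx ord0 k)).2).
rewrite (_ : (fun x => - _) = (fun x => conservation_law L xi phi p x ord0 i))//.
apply/funext => x; rewrite /conservation_law /=.
rewrite [RHS]mxE [in RHS]mxE; congr (- (_ + _)); first by rewrite mxE.
rewrite [RHS]mxE gL; congr (_ * _); congr (_ - _); apply: eq_bigr => k _.
by rewrite [grad p x _ _]mxE.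
Qed.

Lemma conservation_law_local (K : set 'rV[R]_n) (w p : 'rV[R]_n -> R) x : open K ->
  (forall x, K x -> w x = p x) -> K x ->
  conservation_law L xi phi w x = conservation_law L xi phi p x.
Proof.
move=> oK wp Kx; have g : grad w x = grad p x.
  apply/rowP => i; rewrite !mxE; apply: near_eq_derive.
  by apply: filterS (open_nbhs_nbhs (conj oK Kx)) => y; exact: wp.
by rewrite /conservation_law g wp.
Qed.

Lemma div_local (K : set 'rV[R]_n) (q q' : 'rV[R]_n -> 'rV[R]_n) x : open K ->
  (forall x, K x -> q x = q' x) -> K x -> div q x = div q' x.
Proof.
move=> oK qq Kx; apply: eq_bigr => i _; apply: near_eq_derive.
by apply: filterS (open_nbhs_nbhs (conj oK Kx)) => y /qq ->.
Qed.

Lemma trace_from_continuous (K : set 'rV[R]_n) (q q' : 'rV[R]_n -> 'rV[R]_n) x :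
  (forall x, K x -> q x = q' x) -> continuous q' -> closure K x ->
  trace_from K q x = q' x.
Proof.
move=> qq cq' Kx; rewrite /trace_from.
have FF : ProperFilter (within K (nbhs x)).
  apply: within_nbhs_proper => //.
apply: cvg_lim => //.
have c1 : q' @ within K (nbhs x) --> q' x by apply: cvg_within_filter; exact: cq'.
apply: cvg_trans c1; apply: near_eq_cvg.
apply: (filterS (P := K)); first by move=> y /qq ->.
exact: withinT.
Qed.

End conservation.

(** * Null sets and L2 norms *)

Section null_modification.
Context {d} {T : measurableType d} {R : realType} (mu : {measure set T -> \bar R}).
Local Open Scope ereal_scope.
Import HBNNSimple.

Lemma nnintegral_le_off_null (N : set T) (f g : T -> \bar R) :
  measurable N -> mu N = 0 -> (forall x, 0 <= g x) -> (forall x, ~ N x -> f x = g x) ->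
  ereal_sup [set sintegral mu h | h in [set h : {nnsfun T >-> R} | forall x, (h x)%:E <= f x]] <=
  ereal_sup [set sintegral mu h | h in [set h : {nnsfun T >-> R} | forall x, (h x)%:E <= g x]].
Proof.
move=> mN N0 g0 fg; apply: ge_ereal_sup => _ [h hf <-].
have mNc : measurable (~` N) by exact: measurableC.
pose h' := proj_nnsfun h mNc.
have h'E x : h' x = (\1_(~` N) x * h x)%R by rewrite /h' /= mulrC.
have -> : sintegral mu h = sintegral mu h'.
  rewrite -!integralT_nnsfun; apply: ae_eq_integral => //.
  - by apply/measurable_EFinP.
  - by apply/measurable_EFinP.
  exists N; split=> // x /= hx; apply: contrapT => Nx; apply: hx => _.
  by rewrite mindicE mem_set// mulr1.
apply: ereal_sup_ubound; exists h' => // x.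
rewrite h'E indicE; have [Nx|Nx] := pselect (N x).
  by rewrite memNset ?mul0r ?g0//; exact.
by rewrite mem_set// mul1r -fg.
Qed.

(** The integral of an arbitrary function is a difference of suprema over simple
    functions, and these can be cut off on a null set. *)
Lemma integral_off_null (N D E : set T) (f g : T -> \bar R) :
  measurable N -> mu N = 0 -> (forall x, ~ N x -> (f \_ D) x = (g \_ E) x) ->
  \int[mu]_(x in D) f x = \int[mu]_(x in E) g x.
Proof.
move=> mN N0 fg; have fp x : ~ N x -> (f \_ D)^\+ x = (g \_ E)^\+ x by move=> Nx; rewrite !funeposE fg.
have fn x : ~ N x -> (f \_ D)^\- x = (g \_ E)^\- x by move=> Nx; rewrite !funenegE fg.
rewrite /integral; congr (_ - _); apply/eqP; rewrite eq_le.
  by apply/andP; split; apply: (nnintegral_le_off_null mN N0) => // x Nx; exact/esym/fp.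
by apply/andP; split; apply: (nnintegral_le_off_null mN N0) => // x Nx; exact/esym/fn.
Qed.

End null_modification.

Section sqrt_integrals.
Context {d} {T : measurableType d} {R : realType} (mu : {measure set T -> \bar R}).
Variable D : set T.
Hypothesis mD : measurable D.

(** Minkowski's inequality for two nonnegative functions, in the form of a
    triangle inequality for a third one below their sum. *)
Lemma sqrt_integral_triangle (f g h : T -> R) :
  measurable_fun D g -> measurable_fun D h ->
  (forall x, D x -> 0 <= f x) -> (forall x, D x -> f x <= g x + h x) ->
  mu.-integrable D (EFin \o (fun x => f x ^+ 2)) ->
  mu.-integrable D (EFin \o (fun x => g x ^+ 2)) ->
  mu.-integrable D (EFin \o (fun x => h x ^+ 2)) ->
  Num.sqrt (\int[mu]_(x in D) (f x ^+ 2)) <=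
  Num.sqrt (\int[mu]_(x in D) (g x ^+ 2)) + Num.sqrt (\int[mu]_(x in D) (h x ^+ 2)).
Proof.
move=> mg mh f0 fgh f2 g2 h2.
have gh := integrable_mul_sqr mD mg mh g2 h2.
have gh2 : mu.-integrable D (EFin \o (fun x => 2 * (g x * h x))).
  by have := integrableZl mD 2 gh; apply: eq_integrable.
have s2 : mu.-integrable D (EFin \o (fun x => g x ^+ 2 + h x ^+ 2)).
  by have := integrableD mD g2 h2; apply: eq_integrable.
have s3 : mu.-integrable D (EFin \o (fun x => (g x ^+ 2 + h x ^+ 2) + 2 * (g x * h x))).
  by have := integrableD mD s2 gh2; apply: eq_integrable.
have le1 : \int[mu]_(x in D) (f x ^+ 2) <=
    \int[mu]_(x in D) (g x ^+ 2) + \int[mu]_(x in D) (h x ^+ 2) + 2 * \int[mu]_(x in D) (g x * h x).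
  rewrite -RintegralD// -RintegralZl// -RintegralD//; apply: le_Rintegral => // x Dx.
  rewrite (_ : _ + _ = (g x + h x) ^+ 2); last by ring.
  by rewrite lerXn2r ?nnegrE ?f0 ?fgh//; exact: le_trans (f0 x Dx) (fgh x Dx).
have cs := Rintegral_cauchy_schwarz mD mg mh g2 h2.
have gg : 0 <= \int[mu]_(x in D) (g x ^+ 2) by apply: Rintegral_ge0 => x _; exact: sqr_ge0.
have hh : 0 <= \int[mu]_(x in D) (h x ^+ 2) by apply: Rintegral_ge0 => x _; exact: sqr_ge0.
have ff : 0 <= \int[mu]_(x in D) (f x ^+ 2) by apply: Rintegral_ge0 => x _; exact: sqr_ge0.
rewrite -(@ler_pXn2r _ 2)// ?nnegrE ?addr_ge0 ?sqrtr_ge0// sqr_sqrtr// sqrrD !sqr_sqrtr//.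
by apply: (le_trans le1); have := le_trans (ler_norm _) cs; lra.
Qed.

End sqrt_integrals.

Section norms.
Context {R : realType} {n : nat}.
Implicit Types (D : set 'rV[R]_n) (f : 'rV[R]_n -> R).
Local Notation mu := (rV_lebesgue n).

Lemma L2norm_powE D f : L2norm D f = ((\int[mu]_(x in D) (f x ^+ 2)%:E) `^ 2^-1)%E.
Proof.
rewrite /L2norm unlock; congr (_ `^ _)%E; rewrite [RHS]integral_mkcond.
apply: eq_integral => x _; rewrite /patch; case: ifP => _ /=.
  by rewrite powR_mulrn// ?real_normK ?num_real.
by rewrite normr0 powR0.
Qed.

Lemma L2normE D f : measurable D -> mu.-integrable D (EFin \o (fun x => f x ^+ 2)) ->
  L2norm D f = (Num.sqrt (\int[mu]_(x in D) (f x ^+ 2)))%:E.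
Proof.
move=> mD f2; rewrite L2norm_powE -powR12_sqrt; last by apply: Rintegral_ge0 => x _; exact: sqr_ge0.
by rewrite -poweR_EFin /Rintegral fineK//; exact: integrable_fin_num.
Qed.

Lemma eq_L2norm D f g : (forall x, D x -> f x = g x) -> L2norm D f = L2norm D g.
Proof.
move=> fg; rewrite !L2norm_powE; congr (_ `^ _)%E; apply: eq_integral => x /set_mem Dx.
by rewrite fg.
Qed.

Lemma L2norm_ge0 D f : (0 <= L2norm D f)%E.
Proof. by rewrite L2norm_powE poweR_ge0. Qed.

Lemma L2_integrable D f : measurable D -> L2 D f ->
  measurable_fun D f /\ mu.-integrable D (EFin \o (fun x => f x ^+ 2)).
Proof.
move=> mD [mf f2]; split=> //; apply/integrableP; split.
  by apply/measurable_EFinP; exact: measurable_funX.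
rewrite (_ : (\int[mu]_(x in D) `|_|)%E = (\int[mu]_(x in D) (f x ^+ 2)%:E)%E); last first.
  by apply: eq_integral => x _ /=; rewrite ger0_norm ?sqr_ge0.
rewrite ltey; apply/eqP => foo; move: f2; rewrite L2norm_powE foo poweRyr ?ltxx// invr_eq0.
Qed.

End norms.

Definition sq_field {R : realType} n (D : set 'rV[R]_n) (w : 'rV[R]_n -> 'rV[R]_n) :=
  forall i, measurable_fun D (fun x => w x ord0 i) /\
    (rV_lebesgue n).-integrable D (EFin \o (fun x => w x ord0 i ^+ 2)).

Section sq_fields.
Context {R : realType} {n : nat}.
Variable D : set 'rV[R]_n.
Hypothesis mD : measurable D.
Local Notation mu := (rV_lebesgue n).
Implicit Types w z q : 'rV[R]_n -> 'rV[R]_n.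

Definition fnorm w := Num.sqrt (\int[mu]_(x in D) (enorm (w x) ^+ 2)).

Lemma sq_field_dot w z : sq_field D w -> sq_field D z ->
  mu.-integrable D (EFin \o (fun x => dot (w x) (z x))).
Proof.
move=> hw hz.
rewrite (_ : EFin \o _ = fun x => (\sum_(i : 'I_n) (w x ord0 i * z x ord0 i)%:E)%E).
  apply: integrable_sum => // i _.
  by apply: integrable_mul_sqr => //; [exact: (hw i).1|exact: (hz i).1|exact: (hw i).2|exact: (hz i).2].
by apply/funext => x; rewrite /= /dot -sumEFin.
Qed.

Lemma sq_field_enorm w : sq_field D w ->
  measurable_fun D (fun x => enorm (w x)) /\
  mu.-integrable D (EFin \o (fun x => enorm (w x) ^+ 2)).
Proof.
move=> hw; have d2 := sq_field_dot hw hw; split.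
  have ms : measurable_fun setT (@Num.sqrt R) by apply: continuous_measurable_fun; exact: sqrt_continuous.
  apply: (measurableT_comp ms (g := fun x => dot (w x) (w x))).
  by apply/measurable_EFinP; exact: measurable_int d2.
by apply: eq_integrable d2 => // x _; rewrite /= enorm_sqr.
Qed.

Lemma sq_fieldB w z : sq_field D w -> sq_field D z -> sq_field D (fun x => w x - z x).
Proof.
move=> hw hz i; have [mw w2] := hw i; have [mz z2] := hz i.
have wz := integrable_mul_sqr mD mw mz w2 z2.
split.
  rewrite (_ : (fun x => _) = (fun x => w x ord0 i - z x ord0 i)); first exact: measurable_funB.
  by apply/funext => x; rewrite !mxE.
have s2 := integrableD mD (integrableD mD w2 z2) (integrableZl mD (-2) wz).
apply: eq_integrable s2 => // x _; rewrite /= !mxE -EFinM -!EFinD; congr EFin; ring.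
Qed.

Lemma dot_integral_le w z : sq_field D w -> sq_field D z ->
  `|\int[mu]_(x in D) dot (w x) (z x)| <= fnorm w * fnorm z.
Proof.
move=> hw hz; have [mw w2] := sq_field_enorm hw; have [mz z2] := sq_field_enorm hz.
have wz := integrable_mul_sqr mD mw mz w2 z2.
apply: le_trans (le_normr_Rintegral mD (sq_field_dot hw hz)) _.
apply: le_trans (le_trans (ler_norm _) (Rintegral_cauchy_schwarz mD mw mz w2 z2)).
apply: le_Rintegral => //; last by move=> x _; exact: dot_cauchy_schwarz.
by have := integrable_abse (sq_field_dot hw hz); apply: eq_integrable.
Qed.

Lemma enorm_le_add (x y : 'rV[R]_n) : enorm x <= enorm y + enorm (y - x).
Proof.
have e0 (z : 'rV[R]_n) : 0 <= enorm z by exact: enorm_ge0.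
rewrite -(@ler_pXn2r _ 2)// ?nnegrE ?addr_ge0// sqrrD !enorm_sqr.
have := le_trans (ler_norm _) (dot_cauchy_schwarz y (x - y)).
have -> : enorm (x - y) = enorm (y - x) by rewrite /enorm -opprB dotNl dotNr opprK.
have -> : dot x x = dot y y + 2 * dot y (x - y) + dot (y - x) (y - x).
  rewrite !(dotDl, dotDr, dotNl, dotNr) (dotC y x); ring.
by move=> h; lra.
Qed.

Lemma fnorm_triangle w z : sq_field D w -> sq_field D z ->
  fnorm w <= fnorm z + fnorm (fun x => z x - w x).
Proof.
move=> hw hz; have hd := sq_fieldB hz hw.
have [mw w2] := sq_field_enorm hw; have [mz z2] := sq_field_enorm hz.
have [md d2] := sq_field_enorm hd.
by apply: sqrt_integral_triangle => // x _; [exact: enorm_ge0|exact: enorm_le_add].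
Qed.

End sq_fields.

(** * Integration by parts on a mesh *)

Section green.
Context {R : realType} {d : nat}.
Local Notation mu := (rV_lebesgue d.+1).

Lemma facet_bary (F : 'M[R]_(d.+2, d.+1)) a (t : 'rV[R]_d) : edges F \in unitmx ->
  bary F (param (facet F a) t) ord0 a = 0 /\
  forall b, bary F (param (facet F a) t) ord0 (lift a b) = weights t ord0 b.
Proof.
move=> uF.
pose w : 'rV[R]_d.+2 := \row_b (if unlift a b is Some c then weights t ord0 c else 0).
have wl b : w ord0 (lift a b) = weights t ord0 b by rewrite mxE liftK.
have wa : w ord0 a = 0 by rewrite mxE unlift_none.
have -> : param (facet F a) t = w *m F.
  rewrite -weights_mul; apply/rowP => j; rewrite !mxE [RHS](bigD1_ord a)//= wa mul0r add0r.
  by apply: eq_bigr => b _; rewrite [facet _ _ _ _]mxE; congr (_ * _); exact/esym/wl.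
have w1 : \sum_b w ord0 b = 1.
  by rewrite (bigD1_ord a)//= wa add0r -[RHS](weights_sum t); apply: eq_bigr => b _; exact: wl.
by rewrite (mul_bary uF w1); split=> // b; exact: wl.
Qed.

Lemma facet_closure (F : 'M[R]_(d.+2, d.+1)) a (t : 'rV[R]_d) : edges F \in unitmx ->
  ref_simplex t -> closure (open_simplex F) (param (facet F a) t).
Proof.
move=> uF /ref_simplexP ht; rewrite closure_open_simplex//; apply/subsimplexP => //.
have [h0 h1] := facet_bary a t uF.
split=> b; last by rewrite inE.
by case: (unliftP a b) => [c ->|->]; rewrite ?h0// h1.
Qed.

Section product_field.
Variables (psi : 'rV[R]_d.+1 -> R) (Q : 'rV[R]_d.+1 -> 'rV[R]_d.+1).
Hypotheses (psi1 : Ck 1 psi) (Q1 : C1_field Q).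

Lemma C1_field_scale : C1_field (fun x => psi x *: Q x).
Proof.
move=> i; rewrite (_ : (fun x => _) = (fun x => psi x * Q x ord0 i)); first exact: CkM.
by apply/funext => x; rewrite mxE.
Qed.

Lemma div_scale x : div (fun x => psi x *: Q x) x = psi x * div Q x + dot (Q x) (grad psi x).
Proof.
rewrite /div mulr_sumr /dot -big_split; apply: eq_bigr => i _ /=.
rewrite (_ : (fun y => _) = (psi * (fun y => Q y ord0 i))); last by apply/funext => y; rewrite mxE.
have dp := (psi1.2 (delta_mx ord0 i)).1 x; have dq := ((Q1 i).2 (delta_mx ord0 i)).1 x.
by rewrite (deriveM dp dq) [grad psi x _ _]mxE.
Qed.

End product_field.

Section mesh.
Variables (Omega : set 'rV[R]_d.+1) (T : mesh R d).
Hypotheses (oO : open Omega) (tT : triangulation Omega T).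
Variable Q : 'I_(nelt T) -> 'rV[R]_d.+1 -> 'rV[R]_d.+1.
Hypothesis Q1 : forall i, C1_field (Q i).

(** The jump of the field with the pieces Q i, whose traces are the values of
    their continuous extensions. *)
Definition piece_jump (e : side T * side T) x :=
  dot (Q e.1.1 x) (outer_normal (vertices e.1.1) e.1.2) +
  dot (Q e.2.1 x) (outer_normal (vertices e.2.1) e.2.2).

Let ut i := elt_unit tT i.

Lemma continuous_piece_jump e : continuous (piece_jump e).
Proof. exact: (CkD (C1_dot _ (@Q1 e.1.1)) (C1_dot _ (@Q1 e.2.1))).1. Qed.

Lemma interface_perm (e : side T * side T) : interface e -> exists s : {perm 'I_d.+1},
  facet (vertices e.1.1) e.1.2 = row_perm s (facet (vertices e.2.1) e.2.2).
Proof. by move=> /andP[_]; exact: facet_rows_perm. Qed.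

(** Integration by parts on each element; the two sides of an interface carry
    the same surface measure, and the sides without a neighbour lie outside the
    open set, where psi vanishes. *)
Lemma green_mesh psi : Ck 1 psi -> (forall x, ~ Omega x -> psi x = 0) ->
  \sum_i \int[mu]_(x in elt i) dot (Q i x) (grad psi x) =
  - (\sum_i \int[mu]_(x in elt i) (psi x * div (Q i) x)) +
  \sum_(e : side T * side T | interface e)
    facet_area (vertices e.1.1) e.1.2 *
    surf (facet (vertices e.1.1) e.1.2) (fun x => psi x * piece_jump e x).
Proof.
move=> psi1 psi0.
have cpsi : continuous psi by exact: psi1.1.
pose B (s : side T) := facet_area (vertices s.1) s.2 *
  surf (facet (vertices s.1) s.2) (fun x => dot (psi x *: Q s.1 x) (outer_normal (vertices s.1) s.2)).
have cB (s : side T) : continuous (fun x => dot (psi x *: Q s.1 x) (outer_normal (vertices s.1) s.2)).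
  exact: (C1_dot _ (C1_field_scale psi1 (@Q1 s.1))).1.
(* psi vanishes at the points of a side that has no neighbour *)
have B0 s : (forall s', ~~ adjacent s s') -> B s = 0.
  case: s => i a hs; rewrite /B /=; apply/eqP; rewrite mulf_eq0; apply/orP; right; apply/eqP.
  rewrite /surf Rintegral_ref_simplex; last exact: (continuous_comp_param (@cB (i, a))).
  rewrite -[RHS](Rintegral0 (open_simplex (std_simplex d))); apply: eq_Rintegral => t /set_mem ht.
  suff -> : psi (param (facet (vertices i) a) t) = 0 by rewrite scale0r /dot big1// => k _; rewrite mxE mul0r.
  apply: psi0 => Ox; have [h0 h1] := facet_bary a t (ut i).
  have [|s' ad] := facet_neighbour oO tT Ox h0; last by have := hs s'; rewrite ad.
  move=> b; case: (unliftP a b) => [c -> _|->]; last by rewrite eqxx.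
  rewrite h1; case: ht => w [w0 w1 ->].
  by rewrite weights_std_sum.
have elt_eq i : \int[mu]_(x in elt i) dot (Q i x) (grad psi x) =
    - (\int[mu]_(x in elt i) (psi x * div (Q i) x)) + \sum_a B (i, a).
  have -> : \sum_a B (i, a) = \int[mu]_(x in elt i) (psi x * div (Q i) x + dot (Q i x) (grad psi x)).
    rewrite -(divergence_simplex (ut i) (C1_field_scale psi1 (@Q1 i))).
    by apply: eq_Rintegral => x _; rewrite div_scale.
  have mi : measurable (elt i) by exact: measurable_open_simplex.
  have bi : bounded_set (elt i) by exact: bounded_open_simplex.
  have c1 : continuous (fun x => psi x * div (Q i) x).
    by move=> x; apply: continuousM; [exact: cpsi|exact: C1_field_div_continuous].
  have c2 : continuous (fun x => dot (Q i x) (grad psi x)).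
    apply: (Ck_sum (k := 0)) => k; apply: CkM; first exact: (Q1 i k).1.
    by rewrite (_ : (fun x => _) = 'D_(delta_mx ord0 k) psi); [exact: (psi1.2 _).2|apply/funext => x; rewrite mxE].
  by rewrite (RintegralD mi (continuous_integrable mi bi c1) (continuous_integrable mi bi c2)) addKr.
rewrite (eq_bigr _ (fun i _ => elt_eq i)) big_split sumrN; congr (_ + _).
rewrite pair_big /= (eq_bigr B); last by case.
rewrite (sum_sides tT B0); apply: eq_bigr => -[[i a] [j b]] /= ie.
have [s hs] := interface_perm ie; rewrite /= in hs.
have ae : facet_area (vertices j) b = facet_area (vertices i) a.
  by rewrite /facet_area hs gram_row_perm.
have se f : continuous f -> surf (facet (vertices j) b) f = surf (facet (vertices i) a) f.
  by move=> cf; rewrite hs surf_row_perm.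
rewrite /B /= ae -mulrDr; congr (_ * _); rewrite (se _ (@cB (j, b))).
rewrite /surf -RintegralD; first last.
- exact: (integrable_ref_simplex (continuous_comp_param (@cB (j, b)))).
- exact: (integrable_ref_simplex (continuous_comp_param (@cB (i, a)))).
- exact: measurable_ref_simplex.
by apply: eq_Rintegral => t _; rewrite /piece_jump /= !dotZl mulrDr.
Qed.

Section estimate.
Variable N : R.
Hypotheses (bO : bounded_set Omega) (N0 : 0 < N) (ON : forall x, Omega x -> forall i, `|x ord0 i| <= N).

Definition div_norm i := Num.sqrt (\int[mu]_(x in elt i) (div (Q i) x ^+ 2)).
Definition jump_norm (e : side T * side T) :=
  Num.sqrt (facet_area (vertices e.1.1) e.1.2 *
            surf (facet (vertices e.1.1) e.1.2) (fun x => piece_jump e x ^+ 2)).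

Let cst := 4 * N + Num.sqrt (8 * N).

(** The norms of psi on the elements and on the interfaces are all bounded by
    global quantities, through Poincare's inequality and the trace inequality. *)
Lemma residual_estimate psi : Ck 1 psi -> (forall x, ~ Omega x -> psi x = 0) ->
  `|\sum_i \int[mu]_(x in elt i) dot (Q i x) (grad psi x)| <=
  cst * (\sum_i div_norm i + \sum_(e | interface e) jump_norm e) * fnorm Omega (grad psi).
Proof.
move=> psi1 psi0.
have mO : measurable Omega by exact: open_measurable_rV.
have cpsi : continuous psi by exact: psi1.1.
have cg := continuous_enorm_grad psi1.
have cabs : continuous (fun x => `|psi x|).
  by move=> x; apply: (@continuous_comp _ _ _ psi Num.norm); [exact: cpsi|exact: norm_continuous].
have csq (f : 'rV[R]_d.+1 -> R) : continuous f -> continuous (fun x => f x ^+ 2).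
  by move=> cf x; exact: (continuousM (cf x) (cf x)).
have mf (D : set 'rV[R]_d.+1) (f : 'rV[R]_d.+1 -> R) : continuous f -> measurable_fun D f.
  by move=> cf; apply: (measurable_funS (E := setT)) => //; exact: continuous_measurable_rV.
pose P := Num.sqrt (\int[mu]_(x in Omega) (psi x ^+ 2)).
pose G := fnorm Omega (grad psi).
pose I := \int[mu]_(x in Omega) (`|psi x| * enorm (grad psi x)).
have P0 : 0 <= P by exact: sqrtr_ge0.
have G0 : 0 <= G by exact: sqrtr_ge0.
have IPG : I <= P * G.
  have := Rintegral_cauchy_schwarz (mu := mu) mO (mf _ _ cabs) (mf _ _ cg)
    (continuous_integrable mO bO (csq _ cabs)) (continuous_integrable mO bO (csq _ cg)).
  move=> /(le_trans (ler_norm _)); rewrite -/I.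
  by under eq_Rintegral do rewrite real_normK ?num_real//.
have P2 : P ^+ 2 <= 4 * N * I.
  rewrite sqr_sqrtr; first exact: poincare.
  by apply: Rintegral_ge0 => x _; exact: sqr_ge0.
have PG : P <= 4 * N * G.
  have [->|Pn0] := eqVneq P 0; first by rewrite !mulr_ge0// ltW.
  have Pp : 0 < P by rewrite lt_neqAle eq_sym Pn0.
  rewrite -(ler_pM2l Pp) -expr2; apply: (le_trans P2).
  by rewrite mulrCA ler_wpM2l// mulr_ge0// ltW.
have tr (i : 'I_(nelt T)) a : facet_area (vertices i) a * surf (facet (vertices i) a) (fun x => psi x ^+ 2) <=
    (Num.sqrt (8 * N) * G) ^+ 2.
  move: (facet_trace mO ON psi1 psi0 a (ut i)) => /le_trans; apply; rewrite -/I.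
  rewrite exprMn sqr_sqrtr; last by rewrite mulr_ge0// ltW.
  have : 0 <= (4 * N * G - P) * G by rewrite mulr_ge0// subr_ge0.
  by rewrite expr2; lra.
rewrite green_mesh//.
have eltb i : `|\int[mu]_(x in elt i) (psi x * div (Q i) x)| <= P * div_norm i.
  have mi : measurable (elt i) by exact: measurable_open_simplex.
  have bi : bounded_set (elt i) by exact: bounded_open_simplex.
  have cd : continuous (div (Q i)) by exact: C1_field_div_continuous.
  apply: le_trans (Rintegral_cauchy_schwarz (mu := mu) mi (mf _ _ cpsi) (mf _ _ cd)
    (continuous_integrable mi bi (csq _ cpsi)) (continuous_integrable mi bi (csq _ cd))) _.
  rewrite ler_wpM2r ?sqrtr_ge0// ler_wsqrtr//.
  rewrite Rintegral_mkcond [leRHS]Rintegral_mkcond; apply: le_Rintegral => //.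
  - by apply: integrable_patch => //; apply: continuous_integrable => //; exact: csq.
  - by apply: integrable_patch => //; apply: continuous_integrable => //; exact: csq.
  case: tT => _ sub _ _ _.
  move=> x _; rewrite /patch; case: ifPn => [/set_mem xi|_].
    by rewrite mem_set//; exact: sub xi.
  by case: ifP => // _; exact: sqr_ge0.
have faceb e : interface e -> `|facet_area (vertices e.1.1) e.1.2 *
    surf (facet (vertices e.1.1) e.1.2) (fun x => psi x * piece_jump e x)| <=
    Num.sqrt (8 * N) * G * jump_norm e.
  move=> _; set F := facet _ _; set A := facet_area _ _.
  have A0 : 0 <= A by exact/ltW/gram_facet_gt0.
  have c1 : continuous (psi \o param F) by exact: continuous_comp_param.
  have c2 : continuous (piece_jump e \o param F) by apply: continuous_comp_param; exact: continuous_piece_jump.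
  have mr := @measurable_ref_simplex R d; have br := @bounded_ref_simplex R d.
  have sq n (f : 'rV[R]_n -> R) : continuous f -> continuous (fun x => f x ^+ 2).
    by move=> cf x; exact: (continuousM (cf x) (cf x)).
  have mf' (f : 'rV[R]_d -> R) : continuous f -> measurable_fun (@ref_simplex R d) f.
    by move=> cf; apply: (measurable_funS (E := setT)) => //; exact: continuous_measurable_rV.
  have := Rintegral_cauchy_schwarz (mu := rV_lebesgue d) mr (mf' _ c1) (mf' _ c2)
    (continuous_integrable mr br (sq _ _ c1)) (continuous_integrable mr br (sq _ _ c2)).
  rewrite normrM (ger0_norm A0) -/(surf F (fun x => psi x * piece_jump e x)).
  move=> /(ler_wpM2l A0) /le_trans; apply.
  set s1 := Num.sqrt _; set s2 := Num.sqrt _.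
  have jE : jump_norm e = Num.sqrt A * s2 by rewrite /jump_norm -/A -/F sqrtrM.
  have t1 : Num.sqrt A * s1 <= Num.sqrt (8 * N) * G.
    rewrite -sqrtrM// -[leRHS]ger0_norm ?mulr_ge0 ?sqrtr_ge0// -sqrtr_sqr ler_wsqrtr//; exact: tr.
  have -> : A * (s1 * s2) = Num.sqrt A * s1 * (Num.sqrt A * s2).
    by rewrite -{1}(sqr_sqrtr A0); ring.
  by rewrite jE ler_wpM2r// mulr_ge0 ?sqrtr_ge0.
apply: (le_trans (ler_normD _ _)); rewrite normrN.
apply: (@le_trans _ _ (P * (\sum_i div_norm i) + Num.sqrt (8 * N) * G * (\sum_(e | interface e) jump_norm e))).
  apply: lerD; first by rewrite mulr_sumr; apply: le_trans (ler_norm_sum _ _ _) _; exact: ler_sum.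
  by rewrite mulr_sumr; apply: le_trans (ler_norm_sum _ _ _) _; exact: ler_sum.
set D := \sum_i _; set J := \sum_(e | _) _.
have D0 : 0 <= D by apply: sumr_ge0 => i _; exact: sqrtr_ge0.
have J0 : 0 <= J by apply: sumr_ge0 => i _; exact: sqrtr_ge0.
have s0 : 0 <= Num.sqrt (8 * N) by exact: sqrtr_ge0.
rewrite -/G /cst; move: (Num.sqrt _) s0 => s s0.
have h1 : 0 <= (4 * N * G - P) * D by rewrite mulr_ge0// subr_ge0.
have h2 : 0 <= s * D * G by rewrite !mulr_ge0.
have h3 : 0 <= 4 * N * J * G by rewrite !mulr_ge0// ltW.
lra.
Qed.

End estimate.
End mesh.
End green.

(** * The residual bound *)

Section more_sq_fields.
Context {R : realType} {n : nat}.
Local Notation mu := (rV_lebesgue n).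
Implicit Types (D E : set 'rV[R]_n) (w q : 'rV[R]_n -> 'rV[R]_n).

Lemma sq_field_continuous D w : measurable D -> bounded_set D ->
  (forall i, continuous (fun x => w x ord0 i)) -> sq_field D w.
Proof.
move=> mD bD cw i; split.
  by apply: (measurable_funS (E := setT)) => //; apply: continuous_measurable_rV; exact: cw.
by apply: continuous_integrable => // x; exact: (continuousM (cw i x) (cw i x)).
Qed.

Lemma sq_fieldS D E w : measurable D -> measurable E -> D `<=` E -> sq_field E w -> sq_field D w.
Proof.
move=> mD mE DE hw i; have [mw w2] := hw i; split; first exact: measurable_funS mw.
exact: integrableS w2.
Qed.

Lemma fnormS D E w : measurable D -> measurable E -> D `<=` E -> sq_field E w ->
  fnorm D w <= fnorm E w.
Proof.
move=> mD mE DE hw; rewrite /fnorm ler_wsqrtr//.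
have [_ wE] := sq_field_enorm mE hw; have [_ wD] := sq_field_enorm mD (sq_fieldS mD mE DE hw).
rewrite Rintegral_mkcond [leRHS]Rintegral_mkcond; apply: le_Rintegral => //.
- exact: integrable_patch.
- exact: integrable_patch.
move=> x _; rewrite /patch; case: ifPn => [/set_mem xD|_]; first by rewrite mem_set//; exact: DE.
by case: ifP => // _; exact: sqr_ge0.
Qed.

Lemma weak_grad_sq_field D v : measurable D -> H1 D v -> sq_field D (weak_grad D v).
Proof.
move=> mD [_ [g hg]] i; have hw : is_weak_grad D v (weak_grad D v).
  by rewrite /weak_grad; apply: (@xgetPex _ (fun=> 0) [set g | is_weak_grad D v g]); exists g.
exact: L2_integrable mD (hw i).1.
Qed.

Lemma L2norm_fnorm D w : measurable D -> sq_field D w -> L2norm D (fun x => enorm (w x)) = (fnorm D w)%:E.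
Proof. by move=> mD hw; rewrite L2normE//; exact: (sq_field_enorm mD hw).2. Qed.

End more_sq_fields.

Lemma absorb_error (R : realFieldType) (x y s b D G Gp e : R) :
  - x <= s * Gp -> - y <= b * D -> s * Gp <= s * (G + D) -> (s + b + 1) * D <= e -> 0 <= D ->
  - (x + y) <= s * G + e.
Proof. by move=> h1 h2 h3 h4 h5; lra. Qed.

Section residual.
Context {R : realType} {d : nat}.
Local Notation mu := (rV_lebesgue d.+1).
Variables (Omega : set 'rV[R]_d.+1) (T : mesh R d).
Hypotheses (oO : open Omega) (bO : bounded_set Omega) (tT : triangulation Omega T).

Let mO : measurable Omega. Proof. exact: open_measurable_rV. Qed.
Let me (i : 'I_(nelt T)) : measurable (elt i).
Proof. by apply: measurable_open_simplex; exact: elt_unit tT i. Qed.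
Let be (i : 'I_(nelt T)) : bounded_set (elt i). Proof. exact: bounded_open_simplex. Qed.
Let eO (i : 'I_(nelt T)) : elt i `<=` Omega. Proof. by case: tT. Qed.

(** The integrand is arbitrary on the boundaries of the elements, so it need not
    be measurable; but these boundaries form a null set. *)
Lemma mesh_integral (f : 'rV[R]_d.+1 -> R) (g : 'I_(nelt T) -> 'rV[R]_d.+1 -> R) :
  (forall i x, elt i x -> f x = g i x) ->
  (forall i, mu.-integrable (elt i) (EFin \o g i)) ->
  \int[mu]_(x in Omega) f x = \sum_i \int[mu]_(x in elt i) g i x.
Proof.
move=> fg ig.
pose Z := \big[setU/set0]_(i < nelt T) (closure (elt i) `\` elt i).
have mZ i : measurable (closure (@elt R d T i) `\` elt i).
  by apply: measurableD => //; apply: closed_measurable_rV; exact: closed_closure.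
have ZE : Z = \bigcup_(i in [set: 'I_(nelt T)]) (closure (elt i) `\` elt i).
  by rewrite /Z -bigcup_seq; apply: eq_bigcupl; split=> i _ //=; rewrite mem_index_enum.
have Z0 : mu Z = 0%E.
  by apply: null_bigU => i; split; [exact: mZ|exact: null_simplex_boundary (elt_unit tT i)].
transitivity (\int[mu]_x \sum_(i < nelt T) (g i \_ (elt i)) x).
  rewrite /Rintegral; congr fine; apply: (integral_off_null (N := Z)) => //.
    by apply: bigsetU_measurable => i _; exact: mZ.
  move=> x Zx; rewrite [in RHS]/patch mem_set// /patch; case: ifPn => [/set_mem Ox|/negP Ox].
    case: tT => _ _ _ _ cov; have [i _ xi] := cov _ (subset_closure Ox).
    have {}xi : elt i x.
      by apply: contrapT => nx; apply: Zx; rewrite ZE; exists i.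
    rewrite (bigD1 i)//= mem_set// big1 => [|j ji]; first by rewrite addr0 (fg i).
    case: ifPn => // /set_mem xj; move: ji.
    by rewrite (elt_disjoint tT xi xj) eqxx.
  rewrite big1// => i _; case: ifPn => // /set_mem xi.
  by case: Ox; apply/mem_set/eO; exact: xi.
rewrite Rintegral_sum//; first by apply: eq_bigr => i _; rewrite -Rintegral_mkcond.
by move=> i; exact: integrable_patch.
Qed.

Variables (Q : 'I_(nelt T) -> 'rV[R]_d.+1 -> 'rV[R]_d.+1) (q : 'rV[R]_d.+1 -> 'rV[R]_d.+1).
Hypotheses (Q1 : forall i, C1_field (Q i)) (qQ : forall i x, elt i x -> q x = Q i x).

Let sQ i : sq_field (elt i) (Q i).
Proof. by apply: sq_field_continuous => // k; exact: (Q1 i k).1. Qed.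

Variable N : R.
Hypotheses (N0 : 0 < N) (ON : forall x, Omega x -> forall i, `|x ord0 i| <= N).

Let S := \sum_i div_norm Q i + \sum_(e : side T * side T | interface e) jump_norm Q e.
Let cst := 4 * N + Num.sqrt (8 * N).

Let S0 : 0 <= S.
Proof. by apply: addr_ge0; apply: sumr_ge0 => *; exact: sqrtr_ge0. Qed.
Let cst0 : 0 <= cst. Proof. by rewrite addr_ge0 ?sqrtr_ge0// mulr_ge0// ltW. Qed.

(** Test functions are dense in the space in which the supremum is taken, and
    both sides are continuous in the weak gradient. *)
Lemma distr_div_le v : H10 Omega v ->
  distr_div Omega q v <= cst * S * fnorm Omega (weak_grad Omega v).
Proof.
move=> [h1 dense]; set w := weak_grad Omega v.
have sw : sq_field Omega w by exact: weak_grad_sq_field.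
pose ell z := \sum_i \int[mu]_(x in elt i) dot (Q i x) (z x).
have sloc z : sq_field Omega z -> forall i : 'I_(nelt T), sq_field (elt i) z.
  by move=> sz i; apply: sq_fieldS sz => //; exact: eO.
have -> : distr_div Omega q v = - ell w.
  rewrite /distr_div; congr (- _); apply: mesh_integral => [i x xi|i]; first by rewrite (qQ xi).
  by apply: sq_field_dot => //; exact: sloc.
(* B depends on the mesh, but only multiplies the distance from w to grad psi *)
pose B := \sum_i fnorm (elt i) (Q i).
have B0 : 0 <= B by apply: sumr_ge0 => i _; exact: sqrtr_ge0.
have ellB z : sq_field Omega z -> `|ell z| <= B * fnorm Omega z.
  move=> sz; rewrite mulr_suml; apply: le_trans (ler_norm_sum _ _ _) _; apply: ler_sum => i _.
  apply: le_trans (dot_integral_le (me i) (sQ i) (sloc _ sz i)) _.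
  by rewrite ler_wpM2l ?sqrtr_ge0//; apply: fnormS => //; exact: eO.
apply/ler_addgt0Pr => e e0.
have K0 : 0 < cst * S + B + 1 by rewrite ltr_pwDr// addr_ge0// mulr_ge0.
have [psi [spsi [A cA [AO Apsi]]] hpsi] := dense _ (divr_gt0 e0 K0).
have psi1 : Ck 1 psi by exact: smooth_C1.
have psi0 x : ~ Omega x -> psi x = 0 by move=> Ox; apply: Apsi => /AO.
have sg : sq_field Omega (grad psi).
  apply: sq_field_continuous => // i.
  by rewrite (_ : (fun x => _) = 'D_(delta_mx ord0 i) psi); [exact: (psi1.2 _).2|apply/funext => x; rewrite mxE].
have sd := sq_fieldB mO sw sg.
have hd : fnorm Omega (fun x => w x - grad psi x) < e / (cst * S + B + 1).
  rewrite -lte_fin -L2norm_fnorm//; apply: le_lt_trans hpsi.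
  by rewrite leeDr// L2norm_ge0.
have est := residual_estimate oO tT Q1 bO N0 ON psi1 psi0.
have tri := fnorm_triangle mO sg sw.
have bd := ellB _ sd.
have ellD : ell w = ell (grad psi) + ell (fun x => w x - grad psi x).
  rewrite /ell -big_split; apply: eq_bigr => i _ /=.
  rewrite -RintegralD//; [|exact: sq_field_dot (sQ i) (sloc _ sg i)|exact: sq_field_dot (sQ i) (sloc _ sd i)].
  by apply: eq_Rintegral => x _; rewrite dotDr dotNr addrC subrK.
set G := fnorm Omega w in tri *; set Gp := fnorm Omega (grad psi) in tri est.
set D := fnorm Omega _ in hd tri bd.
rewrite ellD -/S -/cst in est *.
have D0 : 0 <= D by exact: sqrtr_ge0.
have a1 : - ell (grad psi) <= cst * S * Gp by apply: le_trans est; rewrite -normrN ler_norm.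
have a2 : - ell (fun x => w x - grad psi x) <= B * D by apply: le_trans bd; rewrite -normrN ler_norm.
have a3 : cst * S * Gp <= cst * S * (G + D) by apply: ler_wpM2l tri; exact: mulr_ge0.
have a4 : (cst * S + B + 1) * D <= e by rewrite mulrC -ler_pdivlMr// ltW.
exact: absorb_error a1 a2 a3 a4 D0.
Qed.

Lemma Hm1norm_le : (Hm1norm Omega (distr_div Omega q) <= (cst * S)%:E)%E.
Proof.
apply: ge_ereal_sup => _ [v [hv _] <-]; rewrite lee_fin.
have sw := weak_grad_sq_field mO hv.1.
rewrite L2norm_fnorm//=; have := distr_div_le hv.
have [->|G0] := eqVneq (fnorm Omega (weak_grad Omega v)) 0.
  by move=> _; rewrite invr0 mulr0 mulr_ge0.
by move=> h; rewrite ler_pdivrMr// lt_neqAle eq_sym G0 sqrtr_ge0.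
Qed.

Lemma L2norm_div_elt i : L2norm (elt i) (div q) = (div_norm Q i)%:E.
Proof.
have oe : open (elt i) by apply: open_open_simplex; exact: elt_unit tT i.
rewrite (@eq_L2norm _ _ _ _ (div (Q i))); last first.
  by move=> x xi; apply: (div_local oe _ xi) => y; exact: qQ.
rewrite L2normE//; have cd := C1_field_div_continuous (Q1 i).
by apply: continuous_integrable => // x; exact: (continuousM (cd x) (cd x)).
Qed.

(** The traces exist on the whole facet, since it belongs to the closures of both
    elements. *)
Lemma interface_L2norm_jump (e : side T * side T) : interface e ->
  interface_L2norm e (jump e q) = (jump_norm Q e)%:E.
Proof.
move=> ie; have [s es] := interface_perm ie.
have cQ i : continuous (Q i) by move=> x; apply: continuous_rV => k; exact: (Q1 i k).1.
have tr i x : closure (elt i) x -> trace_from (elt i) q x = Q i x.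
  by move=> cx; apply: trace_from_continuous cx => // y; exact: qQ.
have jE t : ref_simplex t -> jump e q (param (facet (vertices e.1.1) e.1.2) t) =
    piece_jump Q e (param (facet (vertices e.1.1) e.1.2) t).
  move=> ht; rewrite /jump /piece_jump !tr//; last exact: facet_closure (elt_unit tT _) ht.
  rewrite es param_row_perm; apply: facet_closure (elt_unit tT _) _.
  by apply/ref_simplex_perm.
have cj : continuous (piece_jump Q e) by exact: continuous_piece_jump.
have cJ := continuous_comp_param (F := facet (vertices e.1.1) e.1.2) cj.
have iJ : (rV_lebesgue d).-integrable (@ref_simplex R d)
    (EFin \o (fun t => piece_jump Q e (param (facet (vertices e.1.1) e.1.2) t) ^+ 2)).
  apply: integrable_ref_simplex => t; exact: (continuousM (cJ t) (cJ t)).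
rewrite /interface_L2norm /simplex_L2norm.
rewrite (_ : (\int[_]_(t in _) _)%E = (surf (facet (vertices e.1.1) e.1.2) (fun x => piece_jump Q e x ^+ 2))%:E).
  rewrite -EFinM poweR_EFin powR12_sqrt//.
  by rewrite mulr_ge0 ?sqrtr_ge0//; apply: Rintegral_ge0 => t _; exact: sqr_ge0.
rewrite /surf /Rintegral fineK; last by apply: integrable_fin_num => //; exact: measurable_ref_simplex.
apply: eq_integral => t /set_mem ht; rewrite -(jE _ ht) real_normK ?num_real//.
Qed.

Lemma residual_bound :
  (Hm1norm Omega (distr_div Omega q) <= cst%:E *
   (\sum_(K < nelt T) L2norm (elt K) (div q) +
    \sum_(e : side T * side T | interface e) interface_L2norm e (jump e q)))%E.
Proof.
rewrite (eq_bigr _ (fun K _ => L2norm_div_elt K)) (eq_bigr _ interface_L2norm_jump).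
by rewrite !sumEFin -EFinD -EFinM; exact: Hm1norm_le.
Qed.

End residual.

Theorem lemma6p5 (R : realType) (d k : nat) (Omega : set 'rV[R]_d.+1)
    (L : 'rV[R]_d.+1 -> R -> 'rV[R]_d.+1 -> R)
    (Xi : 'rV[R]_d.+1 -> R -> R -> 'rV[R]_d.+1)
    (Phi : 'rV[R]_d.+1 -> R -> R -> R)
    (xi : 'rV[R]_d.+1 -> R -> 'rV[R]_d.+1)
    (phi : 'rV[R]_d.+1 -> R -> R)
    (u : 'rV[R]_d.+1 -> R)
    (hOmega : domain Omega) (hbounded : bounded_set Omega)
    (hk : (1 <= k)%N)
    (hL : smooth_lagrangian L)
    (hu2 : H2 Omega u)
    (hu : minimiser (action Omega L) (H10 Omega) u)
    (huniq : forall v, minimiser (action Omega L) (H10 Omega) v ->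
       {ae rV_lebesgue d.+1, forall x, Omega x -> v x = u x})
    (hgroup : one_parameter_group Xi Phi)
    (hinf : infinitesimals Xi Phi xi phi)
    (hsym : variational_symmetry Omega L Xi Phi) :
  exists C : R -> R, forall (T : mesh R d) (U : 'rV[R]_d.+1 -> R),
    triangulation Omega T ->
    minimiser (action Omega L) (fe_space0 Omega T k) U ->
    (Hm1norm Omega (distr_div Omega (conservation_law L xi phi U)) <=
     (C (shape_regularity T))%:E *
       (\sum_(K < nelt T)
           L2norm (elt K) (div (conservation_law L xi phi U)) +
        \sum_(e : side T * side T | interface e)
           interface_L2norm e (jump e (conservation_law L xi phi U))))%E.
Proof.
have [oO _ _] := hOmega; have [N [N0 ON]] := bounded_coord hbounded.
exists (fun=> 4 * N + Num.sqrt (8 * N)) => T U tT [[[_ Upoly] _] _].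
have [p hp] : {p : 'I_(nelt T) -> 'rV[R]_d.+1 -> R &
    forall i, polyfun k (p i) /\ forall x, elt i x -> U x = p i x}.
  by apply: (@choice _ _ (fun i p => polyfun k p /\ forall x, elt i x -> U x = p x)) => i;
    have [p p1 p2] := Upoly i; exists p.
have Q1 i : C1_field (conservation_law L xi phi (p i)).
  move=> j.
  have p2 := Ck_polyfun 2 (hp i).1.
  have cc := conservation_law_C1 hL hgroup hinf p2 j.
  exact: cc.
have qQ i x : elt i x -> conservation_law L xi phi U x = conservation_law L xi phi (p i) x.
  apply: conservation_law_local; last exact: (hp i).2.
  by apply: open_open_simplex; exact: elt_unit tT i.
have rb := residual_bound oO hbounded tT Q1 qQ N0 ON.
exact: rb.
Qed.
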